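(* Let $k$ be a field, $m$ a positive integer, and let $\Lambda$ be a finite dimensional $k$-algebra which has finite projective dimension $d$ as a $\Lambda$-bimodule (i.e. as a $\Lambda^{\mathrm{op}}\otimes_k\Lambda$-module). Regard the Laurent polynomial ring $\Lambda[t,t^{-1}]$ over $\Lambda$ as a graded algebra by setting $\deg(t):=m$ (with $\Lambda$ in degree $0$). If $d\le m$, then $\Lambda[t,t^{-1}]$ is intrinsically formal.
   Context: Algebras are associative and unital over the field $k$; gradings are $\mathbb{Z}$-gradings. A DG algebra $B$ is a graded $k$-algebra with a differential of degree $1$ satisfying the graded Leibniz rule; its cohomology algebra is the graded algebra $H^*(B)=\bigoplus_{i\in\mathbb{Z}}H^i(B)$. A graded algebra is viewed as a DG algebra with zero differential. A morphism of DG algebras is a quasi-isomorphism if it induces an isomorphism on cohomology algebras; two DG algebras are quasi-isomorphic if they are connected by a finite zigzag of quasi-isomorphisms of DG algebras. A DG algebra $B$ is formal if it is quasi-isomorphic to $H^*(B)$. A graded algebra $A$ is intrinsically formal if every DG algebra $B$ with $H^*(B)\simeq A$ as graded algebras is formal. *)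

(* Defs.v *)
From HB Require Import structures.
From mathcomp Require Import all_boot all_order all_algebra.
From mathcomp Require Import finmap.
From mathcomp Require Import boolp classical_sets functions cardinality fsbigop.
From Stdlib Require Import Relation_Operators.

Set Implicit Arguments.
Unset Strict Implicit.
Unset Printing Implicit Defensive.

Import GRing.Theory.

Local Open Scope ring_scope.
Local Open Scope quotient_scope.

(* Associative unital k-algebras.  MathComp's [algType] imposes 1 != 0; the zero
   algebra has to be allowed here, since it is the cohomology algebra of every
   acyclic DG algebra. *)
Record is_algebra (k : fieldType) (V : lmodType k) (one : V) (mul : V -> V -> V)
    := {
  alg_mulA : forall x y z, mul x (mul y z) = mul (mul x y) z;
  alg_mul1l : forall x, mul one x = x;
  alg_mul1r : forall x, mul x one = x;
  alg_mulDl : forall x y z, mul (x + y) z = mul x z + mul y z;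
  alg_mulDr : forall x y z, mul x (y + z) = mul x y + mul x z;
  alg_mulZl : forall (c : k) x y, mul (c *: x) y = c *: mul x y;
  alg_mulZr : forall (c : k) x y, mul x (c *: y) = c *: mul x y
}.

Record algebra (k : fieldType) := Algebra {
  alg_lmod : lmodType k;
  alg_one : alg_lmod;
  alg_mul : alg_lmod -> alg_lmod -> alg_lmod;
  alg_axiom : is_algebra alg_one alg_mul
}.

(* Carrier of an algebra, as a key for the module and ring structures. *)
Definition alg_sort (k : fieldType) (A : algebra k) : Type := alg_lmod A.
Coercion alg_sort : algebra >-> Sortclass.

Section AlgebraTheory.
Variables (k : fieldType) (A : algebra k).

HB.instance Definition _ := GRing.Lmodule.copy (alg_sort A) (alg_lmod A).
HB.instance Definition _ := GRing.Zmodule_isPzRing.Build (alg_sort A)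
  (alg_mulA (alg_axiom A)) (alg_mul1l (alg_axiom A)) (alg_mul1r (alg_axiom A))
  (alg_mulDl (alg_axiom A)) (alg_mulDr (alg_axiom A)).

Lemma algZAl (c : k) (x y : A) : (c *: x) * y = c *: (x * y).
Proof. exact: alg_mulZl (alg_axiom A) c x y. Qed.

Lemma algZAr (c : k) (x y : A) : x * (c *: y) = c *: (x * y).
Proof. exact: alg_mulZr (alg_axiom A) c x y. Qed.

Definition finite_dimensional : Prop :=
  exists s : seq A, forall v : A, exists c : nat -> k,
    v = \sum_(i < size s) c i *: s`_i.

End AlgebraTheory.

Section Bimodules.
Variables (k : fieldType) (A : algebra k).

(* k acts centrally (the two actions are k-bilinear), so that these are the
   modules over A^op (x)_k A. *)
Record is_bimodule (V : lmodType k) (l : A -> V -> V) (r : V -> A -> V) := {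
  bim_lDl : forall a b v, l (a + b) v = l a v + l b v;
  bim_lDr : forall a u v, l a (u + v) = l a u + l a v;
  bim_lZl : forall (c : k) a v, l (c *: a) v = c *: l a v;
  bim_lZr : forall (c : k) a v, l a (c *: v) = c *: l a v;
  bim_l1 : forall v, l 1 v = v;
  bim_lM : forall a b v, l (a * b) v = l a (l b v);
  bim_rDl : forall u v a, r (u + v) a = r u a + r v a;
  bim_rDr : forall v a b, r v (a + b) = r v a + r v b;
  bim_rZl : forall (c : k) v a, r (c *: v) a = c *: r v a;
  bim_rZr : forall (c : k) v a, r v (c *: a) = c *: r v a;
  bim_r1 : forall v, r v 1 = v;
  bim_rM : forall v a b, r v (a * b) = r (r v a) b;
  bim_lr : forall a v b, r (l a v) b = l a (r v b)
}.

Record bimodule := Bimodule {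
  bim_sort :> lmodType k;
  lact : A -> bim_sort -> bim_sort;
  ract : bim_sort -> A -> bim_sort;
  bim_axiom : is_bimodule lact ract
}.

Definition bimodule_morphism (M N : bimodule) (f : M -> N) : Prop :=
  [/\ linear f,
      forall a v, f (lact a v) = lact a (f v)
    & forall v a, f (ract v a) = ract (f v) a].

Definition projective_bimodule (P : bimodule) : Prop :=
  forall (M N : bimodule) (g : M -> N) (f : P -> N),
    bimodule_morphism g -> bimodule_morphism f ->
    (forall y, exists x, g x = y) ->
  exists h : P -> M, bimodule_morphism h /\ (forall x, g (h x) = f x).

(* 0 -> P_n -> ... -> P_1 -> P_0 -> M -> 0 exact with all P_i projective,
   indexed by all of nat with P_i = 0 for i > n. *)
Definition projective_resolution (M : bimodule) (n : nat)
    (P : nat -> bimodule) (d : forall i, P i.+1 -> P i) (e : P 0 -> M) : Prop :=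
  [/\ forall i, projective_bimodule (P i),
      (forall i, bimodule_morphism (d i)) /\ bimodule_morphism e,
      forall y, exists x, e x = y,
      (forall x, e x = 0 <-> exists y, d 0 y = x) /\
      (forall i (x : P i.+1), d i x = 0 <-> exists y, d i.+1 y = x)
    & forall i, (n < i)%N -> forall x : P i, x = 0].

Definition projdim_le (M : bimodule) (n : nat) : Prop :=
  exists (P : nat -> bimodule) (d : forall i, P i.+1 -> P i) (e : P 0 -> M),
    projective_resolution n d e.

(* With this convention the zero module has projective dimension 0. *)
Definition projdim_eq (M : bimodule) (n : nat) : Prop :=
  projdim_le M n /\ forall n', projdim_le M n' -> (n <= n')%N.

Lemma regular_is_bimodule :
  @is_bimodule A (fun a v => a * v) (fun v a => v * a).
Proof.
split=> *.
- exact: mulrDl.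
- exact: mulrDr.
- exact: algZAl.
- exact: algZAr.
- exact: mul1r.
- by rewrite mulrA.
- exact: mulrDl.
- exact: mulrDr.
- exact: algZAl.
- exact: algZAr.
- exact: mulr1.
- by rewrite mulrA.
- by rewrite mulrA.
Qed.

Definition regular_bimodule : bimodule := Bimodule regular_is_bimodule.

End Bimodules.

Section GradedAlgebras.
Variable k : fieldType.

(* A is the internal direct sum of the subspaces G i. *)
Record is_grading (A : algebra k) (G : int -> {pred A}) := {
  grading_sub : forall i, submod_closed (G i);
  grading_1 : 1 \in G 0;
  grading_M : forall i j x y, x \in G i -> y \in G j -> x * y \in G (i + j);
  grading_span : forall x, exists (s : seq int) (f : int -> A),
    (forall i, f i \in G i) /\ x = \sum_(i <- s) f i;
  grading_free : forall (s : seq int) (f : int -> A), uniq s ->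
    (forall i, f i \in G i) -> \sum_(i <- s) f i = 0 ->
    forall i, i \in s -> f i = 0
}.

Record gradedAlgebra := GradedAlgebra {
  ga_sort :> algebra k;
  homog : int -> {pred ga_sort};
  ga_axiom : is_grading homog
}.
Arguments homog : clear implicits.

Definition graded_morphism (A B : gradedAlgebra) (f : A -> B) : Prop :=
  [/\ linear f, monoid_morphism f
    & forall i x, x \in homog A i -> f x \in homog B i].

Definition graded_iso (A B : gradedAlgebra) (f : A -> B) : Prop :=
  graded_morphism f /\ bijective f.

Definition graded_isomorphic (A B : gradedAlgebra) : Prop :=
  exists f : A -> B, graded_iso f.

Record is_differential (A : gradedAlgebra) (d : A -> A) := {
  diff_linear : linear d;
  diff_deg : forall i x, x \in homog A i -> d x \in homog A (i + 1);
  diff_diff : forall x, d (d x) = 0;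
  diff_leibniz : forall i x y, x \in homog A i ->
    d (x * y) = d x * y + (-1) ^+ `|i|%N * (x * d y)
}.

Record dgAlgebra := DGAlgebra {
  dg_ga :> gradedAlgebra;
  diff : dg_ga -> dg_ga;
  dg_axiom : is_differential diff
}.

Lemma zero_is_differential (A : gradedAlgebra) :
  is_differential (fun _ : A => 0 : A).
Proof.
split=> [c x y|i x _|x|i x y _] //.
- by rewrite scaler0 addr0.
- by case: (grading_sub (ga_axiom A) (i + 1)).
- by rewrite mul0r !mulr0 addr0.
Qed.

Definition zero_dg (A : gradedAlgebra) : dgAlgebra :=
  DGAlgebra (zero_is_differential A).

Definition dg_morphism (B C : dgAlgebra) (f : B -> C) : Prop :=
  graded_morphism f /\ forall x, f (diff x) = diff (f x).

End GradedAlgebras.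

Arguments homog {k} A i : rename.

Section Laurent.
Variables (k : fieldType) (L : algebra k).

Definition finsupp_pred : {pred int -> L} :=
  fun f => `[< finite_set [set n | f n != 0] >].

(* f stands for \sum_n (lcoef f n) t^n, with t central. *)
Record laurent := Laurent { lcoef :> int -> L; _ : finsupp_pred lcoef }.

HB.instance Definition _ := [isSub for lcoef].
HB.instance Definition _ := [Choice of laurent by <:].

Lemma finsupp_seq (f : int -> L) :
  reflect (exists2 s : seq int, uniq s & forall n, n \notin s -> f n = 0)
          (f \in finsupp_pred).
Proof.
apply: (iffP idP).
  move=> /asboolP /finite_fsetP [S eS]; exists (enum_fset S) => [|n nS].
    exact: fset_uniq.
  apply/eqP; apply: contraNT nS => fn0.
  by have : [set n | f n != 0]%classic n by []; rewrite eS.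
case=> s us fs; apply/asboolP; apply: (@sub_finite_set _ _ [set` s]) => //.
by move=> n /= fn0; apply: contraNT fn0 => /fs ->.
Qed.

Lemma finsupp_submod : submod_closed finsupp_pred.
Proof.
split; first by apply/finsupp_seq; exists [::].
move=> c f g /finsupp_seq [s us fs] /finsupp_seq [t ut gt].
apply/finsupp_seq; exists (undup (s ++ t)); first exact: undup_uniq.
move=> n; rewrite mem_undup mem_cat negb_or => /andP [/fs fn /gt gn].
by change (c *: f n + g n = 0); rewrite fn gn scaler0 addr0.
Qed.

HB.instance Definition _ :=
  GRing.isSubmodClosed.Build k (int -> L) finsupp_pred
    (GRing.submod_closed_semi finsupp_submod).
HB.instance Definition _ := [SubChoice_isSubLmodule of laurent by <:].

Lemma lcoefP (f g : laurent) : (forall n, lcoef f n = lcoef g n) -> f = g.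
Proof. by move=> fg; apply/val_inj/funext. Qed.

Lemma lcoefD (f g : laurent) n : lcoef (f + g) n = lcoef f n + lcoef g n.
Proof. by []. Qed.

Lemma lcoefZ (c : k) (f : laurent) n : lcoef (c *: f) n = c *: lcoef f n.
Proof. by []. Qed.

Lemma laurent_seq (f : laurent) :
  exists2 s : seq int, uniq s & forall n, n \notin s -> lcoef f n = 0.
Proof. by case: f => f /= /finsupp_seq. Qed.

(* \sum_(i \in _) is a finite-support sum (0 by convention when the support is
   infinite); here the support is finite since that of f is. *)
Definition lconv (f g : int -> L) (n : int) : L :=
  \sum_(i \in [set: int]) f i * g (n - i).
Lemma lconvE (f g : int -> L) (s : seq int) n : uniq s ->
  (forall i, i \notin s -> f i = 0) ->
  lconv f g n = \sum_(i <- s) f i * g (n - i).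
Proof.
move=> us fs; rewrite /lconv (fsbigE s) //.
  by apply: eq_bigl => i; rewrite in_setT.
by move=> i _ /fs ->; rewrite mul0r.
Qed.

Lemma big_supp (F : int -> L) (s t : seq int) : uniq s -> uniq t ->
  (forall i, i \notin s -> F i = 0) -> (forall i, i \notin t -> F i = 0) ->
  \sum_(i <- s) F i = \sum_(i <- t) F i.
Proof.
move=> us ut Fs Ft.
have fsT r : uniq r -> (forall i, i \notin r -> F i = 0) ->
    \sum_(i \in [set: int]) F i = \sum_(i <- r) F i.
  move=> ur Fr; rewrite (fsbigE r) //; last by move=> i _ /Fr.
  by apply: eq_bigl => i; rewrite in_setT.
by rewrite -fsT // -fsT.
Qed.

Lemma lconv_supp (f g : int -> L) (s t : seq int) n :
  (forall i, i \notin s -> f i = 0) -> (forall i, i \notin t -> g i = 0) ->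
  n \notin undup [seq i + j | i <- s, j <- t] -> lconv f g n = 0.
Proof.
move=> fs gt; rewrite mem_undup => nst.
rewrite (@lconvE f g (undup s)) ?undup_uniq //; last first.
  by move=> i; rewrite mem_undup => /fs.
rewrite big_seq big1 // => i; rewrite mem_undup => si.
rewrite gt ?mulr0 //; apply: contra nst => tni.
by apply/allpairsP; exists (i, n - i); split=> //=; rewrite addrC subrK.
Qed.

Lemma lconv_finsupp (f g : laurent) : finsupp_pred (lconv f g).
Proof.
have [s us fs] := laurent_seq f; have [t ut gt] := laurent_seq g.
apply/finsupp_seq; exists (undup [seq i + j | i <- s, j <- t]).
  exact: undup_uniq.
by move=> n; apply: lconv_supp.
Qed.

Definition lmul (f g : laurent) : laurent := Laurent (lconv_finsupp f g).

Lemma lone_finsupp : finsupp_pred (fun n : int => if n == 0 then 1 else 0).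
Proof.
apply/finsupp_seq; exists [:: 0] => // n.
by rewrite inE => /negPf ->.
Qed.

Definition lone : laurent := Laurent lone_finsupp.

Lemma lcoefM (f g : laurent) n : lcoef (lmul f g) n = lconv f g n.
Proof. by []. Qed.

Lemma laurent_is_algebra : is_algebra lone lmul.
Proof.
split.
- move=> f g h; apply: lcoefP => n /=.
  have [s us fs] := laurent_seq f; have [t ut gt] := laurent_seq g.
  rewrite (lconvE _ _ us fs) (lconvE _ _ (undup_uniq [seq i + j | i <- s, j <- t])); last first.
    by move=> i; apply: lconv_supp.
  set S := undup _.
  under eq_bigr => i _ do rewrite (lconvE _ _ ut gt) big_distrr /=.
  under [RHS]eq_bigr => i _ do rewrite (lconvE _ _ us fs) big_distrl /=.
  rewrite [RHS]exchange_big /= big_seq [RHS]big_seq; apply: eq_bigr => i si.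
  transitivity (\sum_(j <- [seq i + j | j <- t]) f i * g (j - i) * h (n - j)).
    rewrite big_map; apply: eq_bigr => j _.
    by rewrite mulrA opprD addrA [i + j]addrC addrK.
  apply: big_supp.
  + by rewrite map_inj_uniq // => x y; apply: addrI.
  + exact: undup_uniq.
  + move=> j jt; rewrite gt ?mulr0 ?mul0r //.
    apply: contra jt => jit; apply/mapP; exists (j - i) => //.
    by rewrite addrC subrK.
  + move=> j; rewrite mem_undup => jst; rewrite gt ?mulr0 ?mul0r //.
    apply: contra jst => jit; apply/allpairsP; exists (i, j - i); split=> //=.
    by rewrite addrC subrK.
- move=> f; apply: lcoefP => n /=.
  rewrite (@lconvE _ _ [:: 0]) //; last by move=> i; rewrite inE => /negPf ->.
  by rewrite big_seq1 eqxx mul1r subr0.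
- move=> f; apply: lcoefP => n /=.
  have [s us fs] := laurent_seq f.
  rewrite (lconvE _ _ us fs).
  rewrite (@big_supp _ s [:: n]) //.
  + by rewrite big_seq1 subrr eqxx mulr1.
  + by move=> i /fs ->; rewrite mul0r.
  + move=> i; rewrite inE => ni; rewrite subr_eq0 eq_sym (negPf ni).
    by rewrite mulr0.
- move=> f g h; apply: lcoefP => n.
  have [s us fs] := laurent_seq f; have [t ut gt] := laurent_seq g.
  have ust := undup_uniq (s ++ t).
  have E (P : int -> L) : (forall i, i \notin s -> P i = 0) \/
      (forall i, i \notin t -> P i = 0) ->
      forall i, i \notin undup (s ++ t) -> P i = 0.
    move=> H i; rewrite mem_undup mem_cat negb_or => /andP [si ti].
    by case: H => ->.
  have fst := E f (or_introl fs); have gst := E g (or_intror gt).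
  have fgst i : i \notin undup (s ++ t) -> lcoef (f + g) i = 0.
    by move=> ist; rewrite lcoefD fst ?gst ?addr0.
  rewrite lcoefD !lcoefM (lconvE _ _ ust fst) (lconvE _ _ ust gst).
  rewrite (lconvE _ _ ust fgst).
  rewrite -big_split; apply: eq_bigr => i _.
  by rewrite lcoefD mulrDl.
- move=> f g h; apply: lcoefP => n.
  have [s us fs] := laurent_seq f.
  rewrite lcoefD !lcoefM !(lconvE _ _ us fs) -big_split; apply: eq_bigr => i _.
  by rewrite lcoefD mulrDr.
- move=> c f g; apply: lcoefP => n.
  have [s us fs] := laurent_seq f.
  rewrite lcoefZ !lcoefM !(lconvE _ _ us) //; last first.
    by move=> i /fs; rewrite lcoefZ => ->; rewrite scaler0.
  rewrite scaler_sumr; apply: eq_bigr => i _.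
  by rewrite lcoefZ algZAl.
- move=> c f g; apply: lcoefP => n.
  have [s us fs] := laurent_seq f.
  rewrite lcoefZ !lcoefM !(lconvE _ _ us) // scaler_sumr; apply: eq_bigr => i _.
  by rewrite lcoefZ algZAr.
Qed.

Definition laurent_algebra : algebra k := Algebra laurent_is_algebra.

(* With deg t = m and L in degree 0, degree i is the sum of the L t^n, n m = i. *)
Definition laurent_homog (m : nat) (i : int) : {pred laurent_algebra} :=
  fun f : laurent => `[< forall n : int, lcoef f n != 0 -> n * m%:Z = i >].

Lemma lcoef_sum (s : seq int) (F : int -> laurent) n :
  lcoef (\sum_(i <- s) F i) n = \sum_(i <- s) lcoef (F i) n.
Proof. exact: (big_morph (fun f : laurent => lcoef f n)). Qed.

Lemma laurent_homogP (m : nat) (i : int) (f : laurent) :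
  reflect (forall n : int, n * m%:Z != i -> lcoef f n = 0)
          (f \in laurent_homog m i).
Proof.
apply: (iffP idP) => [/asboolP H n|H].
  by move=> nmi; apply/eqP; apply: contraNT nmi => /H ->.
by apply/asboolP => n fn; apply/eqP; apply: contraNT fn => /H ->.
Qed.

Lemma laurent_part_finsupp (m : nat) (f : laurent) (i : int) :
  finsupp_pred (fun n => if n * m%:Z == i then lcoef f n else 0).
Proof.
have [s us fs] := laurent_seq f; apply/finsupp_seq; exists s => // n /fs ->.
by rewrite if_same.
Qed.

Lemma laurent_is_grading (m : nat) : is_grading (laurent_homog m).
Proof.
split.
- move=> i; split; first exact/laurent_homogP.
  move=> c f g /laurent_homogP fi /laurent_homogP gi; apply/laurent_homogP => n ni.
  by rewrite [LHS]lcoefD lcoefZ fi // gi // scaler0 addr0.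
- apply/laurent_homogP => n; apply: contraNeq => /=.
  by case: (n =P 0) => [->|_]; rewrite ?mul0r ?eqxx.
- move=> i j f g /laurent_homogP fi /laurent_homogP gj; apply/laurent_homogP => n nij.
  rewrite [LHS]lcoefM; apply: fsbig1 => a _.
  have [ai|ai] := eqVneq (a * m%:Z) i; last by rewrite fi // mul0r.
  rewrite gj ?mulr0 //; apply: contra nij => /eqP <-.
  by rewrite -ai -mulrDl addrC subrK.
- move=> f; have [s us fs] := laurent_seq f.
  exists (undup [seq n * m%:Z | n <- s]).
  exists (fun i => Laurent (laurent_part_finsupp m f i)); split.
    by move=> i; apply/laurent_homogP => n /negPf /= ->.
  apply: lcoefP => n; rewrite [RHS]lcoef_sum /=.
  have [/fs fn|ns] := boolP (n \notin s).
    by rewrite fn big1 // => i _; rewrite if_same.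
  rewrite (bigD1_seq (n * m%:Z)) ?undup_uniq //=; last first.
    by rewrite mem_undup; apply/mapP; exists n; rewrite // -[_ \in _]negbK.
  rewrite eqxx big1 ?addr0 // => i.
  by rewrite eq_sym => /negPf ->.
- move=> s f us fh sf0 i si; apply: lcoefP => n.
  have [ni|ni] := eqVneq (n * m%:Z) i; last first.
    by have /laurent_homogP -> := fh i.
  have := congr1 (fun g : laurent => lcoef g n) sf0.
  rewrite [LHS]lcoef_sum (bigD1_seq i) //= big1 ?addr0 // => j ji.
  by have /laurent_homogP -> := fh j; rewrite // ni eq_sym.
Qed.

Definition graded_laurent (m : nat) : gradedAlgebra k :=
  GradedAlgebra (laurent_is_grading m).

End Laurent.

Section GradedTheory.
Variables (k : fieldType) (A : gradedAlgebra k).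
Implicit Types (x y : A) (i j : int).

Lemma homog0 i : 0 \in homog A i.
Proof. by case: (grading_sub (ga_axiom A) i). Qed.

Lemma homogZD i (c : k) x y :
  x \in homog A i -> y \in homog A i -> c *: x + y \in homog A i.
Proof. by case: (grading_sub (ga_axiom A) i) => _; apply. Qed.

Lemma homogD i x y :
  x \in homog A i -> y \in homog A i -> x + y \in homog A i.
Proof. by move=> xi yi; rewrite -[x]scale1r homogZD. Qed.

Lemma homogZ i (c : k) x : x \in homog A i -> c *: x \in homog A i.
Proof. by move=> xi; rewrite -[c *: x]addr0 homogZD // homog0. Qed.

Lemma homogN i x : x \in homog A i -> - x \in homog A i.
Proof. by rewrite -scaleN1r; apply: homogZ. Qed.

Lemma homogM i j x y :
  x \in homog A i -> y \in homog A j -> x * y \in homog A (i + j).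
Proof. exact: grading_M (ga_axiom A) i j x y. Qed.

Lemma homog1 : 1 \in homog A 0. Proof. exact: grading_1 (ga_axiom A). Qed.

Definition decomposes x (f : int -> A) : Prop :=
  (forall i, f i \in homog A i) /\
  exists s : seq int, [/\ uniq s, forall i, i \notin s -> f i = 0
                        & x = \sum_(i <- s) f i].

Lemma decomposes0 (f : int -> A) : decomposes 0 f -> forall i, f i = 0.
Proof.
case=> fh [s [us fs s0]] i; have [si|/fs //] := boolP (i \in s).
exact: (grading_free (ga_axiom A) us fh (esym s0)).
Qed.

Lemma big_widen (f : int -> A) (s t : seq int) : uniq s -> uniq t ->
  {subset s <= t} -> (forall i, i \notin s -> f i = 0) ->
  \sum_(i <- s) f i = \sum_(i <- t) f i.
Proof.
move=> us ut st fs; rewrite [RHS](bigID (mem s)) /= [X in _ + X]big1 ?addr0 //.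
rewrite -[RHS]big_filter; apply/perm_big/uniq_perm; rewrite ?filter_uniq // => i.
by rewrite mem_filter andbC; case: (boolP (i \in s)) => [/st ->|]; rewrite ?andbF.
Qed.

Lemma decomposesZD (c : k) x y f g : decomposes x f -> decomposes y g ->
  decomposes (c *: x + y) (fun i => c *: f i + g i).
Proof.
case=> fh [s [us fs ->]] [gh [t [ut gt ->]]]; split=> [i|].
  exact: homogZD.
exists (undup (s ++ t)); split; first exact: undup_uniq.
  move=> i; rewrite mem_undup mem_cat negb_or => /andP [/fs -> /gt ->].
  by rewrite scaler0 addr0.
rewrite big_split -scaler_sumr /=; congr (_ *: _ + _); apply: big_widen => //.
- exact: undup_uniq.
- by move=> i si; rewrite mem_undup mem_cat si.
- exact: undup_uniq.
- by move=> i si; rewrite mem_undup mem_cat si orbT.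
Qed.

Lemma decomposes_uniq x f g : decomposes x f -> decomposes x g -> f = g.
Proof.
move=> xf xg; apply/funext => i.
have := decomposesZD (-1) xf xg; rewrite scaleN1r addNr => /decomposes0 /(_ i).
by move/eqP; rewrite scaleN1r addrC subr_eq0 => /eqP.
Qed.

Lemma decomposes_homog i x : x \in homog A i ->
  decomposes x (fun j => if j == i then x else 0).
Proof.
move=> xi; split=> [j|].
  by case: eqP => [->|] // _; exact: homog0.
exists [:: i]; split=> // [j|]; first by rewrite inE => /negPf ->.
by rewrite big_seq1 eqxx.
Qed.

Lemma decomposes_sum (s : seq int) (F : int -> A) (G : int -> int -> A) :
  (forall i, decomposes (F i) (G i)) ->
  decomposes (\sum_(i <- s) F i) (fun j => \sum_(i <- s) G i j).
Proof.
move=> FG; elim: s => [|a s IH].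
  rewrite big_nil; split=> [j|]; first by rewrite big_nil homog0.
  by exists [::]; split=> // [j _|]; rewrite !big_nil.
have := decomposesZD 1 (FG a) IH; rewrite scale1r big_cons; congr decomposes.
by apply/funext => j; rewrite scale1r big_cons.
Qed.

Lemma decomposes_ex x : exists f, decomposes x f.
Proof.
have [s [f [fh ->]]] := grading_span (ga_axiom A) x.
by eexists; apply: decomposes_sum => i; apply: decomposes_homog.
Qed.

End GradedTheory.

Section Cohomology.
Variables (k : fieldType) (B : dgAlgebra k).
Implicit Types (x y : B) (i j : int).

Lemma diffZD (c : k) x y : diff (c *: x + y) = c *: diff x + diff y.
Proof. exact: diff_linear (dg_axiom B) c x y. Qed.

Lemma diff0 : diff (0 : B) = 0.
Proof. by have := diffZD (-1) 0 0; rewrite scaler0 addr0 scaleN1r addNr. Qed.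

Lemma diffD x y : diff (x + y) = diff x + diff y.
Proof. by have := diffZD 1 x y; rewrite !scale1r. Qed.

Lemma diffZ (c : k) x : diff (c *: x) = c *: diff x.
Proof. by have := diffZD c x 0; rewrite diff0 !addr0. Qed.

Lemma diffN x : diff (- x) = - diff x.
Proof. by rewrite -scaleN1r diffZ scaleN1r. Qed.

Lemma diffK x : diff (diff x) = 0.
Proof. exact: diff_diff (dg_axiom B) x. Qed.

Lemma diff_homog i x : x \in homog B i -> diff x \in homog B (i + 1).
Proof. exact: diff_deg (dg_axiom B) i x. Qed.

Lemma diffM i x y : x \in homog B i ->
  diff (x * y) = diff x * y + (-1) ^+ `|i|%N * (x * diff y).
Proof. exact: diff_leibniz (dg_axiom B) i x y. Qed.

Lemma diff_sum (s : seq int) (F : int -> B) :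
  diff (\sum_(i <- s) F i) = \sum_(i <- s) diff (F i).
Proof. exact: (big_morph _ diffD diff0). Qed.

Lemma diff1 : diff (1 : B) = 0.
Proof.
have := diffM 1 (homog1 B); rewrite mulr1 mulr1 !mul1r => /esym/eqP.
by rewrite -subr_eq0 addrK => /eqP.
Qed.

Lemma decomposes_diff x f : decomposes x f ->
  decomposes (diff x) (fun i => diff (f (i - 1))).
Proof.
case=> fh [s [us fs ->]]; split=> [i|].
  by have := diff_homog (fh (i - 1)); rewrite subrK.
exists [seq i + 1 | i <- s]; split.
- by rewrite map_inj_uniq //; apply: addIr.
- move=> i si; rewrite fs ?diff0 //; apply: contra si => si.
  by apply/mapP; exists (i - 1); rewrite ?subrK.
- by rewrite big_map diff_sum; apply: eq_bigr => i _; rewrite addrK.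
Qed.

Lemma cocycle_components x f : decomposes x f -> diff x = 0 ->
  forall i, diff (f i) = 0.
Proof.
move=> /decomposes_diff H dx i; move: H; rewrite dx => /decomposes0 /(_ (i + 1)).
by rewrite addrK.
Qed.

Lemma sign_comm n x : x * (-1) ^+ n = (-1) ^+ n * x.
Proof. by rewrite -signr_odd; case: odd; rewrite ?expr0 ?expr1 ?mulrN1 ?mulN1r ?mulr1 ?mul1r. Qed.

Lemma diffMl x y : diff y = 0 -> diff (x * y) = diff x * y.
Proof.
move=> dy; have [f [fh [s [us fs ->]]]] := decomposes_ex x.
rewrite mulr_suml !diff_sum mulr_suml; apply: eq_bigr => i _.
by rewrite (diffM _ (fh i)) dy !mulr0 addr0.
Qed.

Lemma diffMr x : diff x = 0 ->
  exists2 x', diff x' = 0 & forall y, x * diff y = diff (x' * y).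
Proof.
move=> dx; have [f xf] := decomposes_ex x; have df := cocycle_components xf dx.
case: xf => fh [s [us fs ->]].
exists (\sum_(i <- s) (-1) ^+ `|i|%N * f i).
  rewrite diff_sum big1 // => i _.
  by rewrite -signr_odd; case: odd; rewrite ?expr0 ?expr1 ?mulN1r ?mul1r ?diffN df ?oppr0.
move=> y; rewrite !mulr_suml diff_sum; apply: eq_bigr => i _.
rewrite -mulrA -signr_odd; case: (boolP (odd `|i|)) => oi.
  rewrite expr1 mulN1r diffN (diffM _ (fh i)) df mul0r add0r.
  by rewrite -signr_odd oi expr1 mulN1r opprK.
rewrite expr0 mul1r (diffM _ (fh i)) df mul0r add0r.
by rewrite -signr_odd (negPf oi) expr0 mul1r.
Qed.

Definition is_cocycle : {pred B} := fun x => diff x == 0.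

Lemma cocycle_submod : submod_closed is_cocycle.
Proof.
split; first by apply/eqP; exact: diff0.
move=> c x y /eqP dx /eqP dy; apply/eqP.
by rewrite diffZD dx dy scaler0 addr0.
Qed.

HB.instance Definition _ := GRing.isSubmodClosed.Build k B is_cocycle
  (GRing.submod_closed_semi cocycle_submod).

Record cocycle := Cocycle { cval :> B; _ : cval \in is_cocycle }.

HB.instance Definition _ := [isSub for cval].
HB.instance Definition _ := [Choice of cocycle by <:].
HB.instance Definition _ := [SubChoice_isSubLmodule of cocycle by <:].

Lemma cvalP (z : cocycle) : diff (cval z) = 0.
Proof. by case: z => z /= /eqP. Qed.

Definition is_coboundary : {pred cocycle} :=
  fun z => `[< exists y, cval z = diff y >].

Lemma coboundaryP (z : cocycle) :
  reflect (exists y, cval z = diff y) (z \in is_coboundary).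
Proof. exact: asboolP. Qed.

Lemma coboundary_submod : submod_closed is_coboundary.
Proof.
split; first by apply/coboundaryP; exists 0; rewrite diff0.
move=> c z w /coboundaryP [x zx] /coboundaryP [y wy]; apply/coboundaryP.
by exists (c *: x + y); rewrite diffZD -zx -wy.
Qed.

HB.instance Definition _ := GRing.isSubmodClosed.Build k cocycle is_coboundary
  (GRing.submod_closed_semi coboundary_submod).

Definition cohom : Type := {ideal_quot is_coboundary}.
HB.instance Definition _ := GRing.Zmodule.on cohom.
HB.instance Definition _ := EqQuotient.on cohom.

Definition cclass (z : cocycle) : cohom := \pi_cohom z.

Lemma cclassP (z w : cocycle) :
  cclass z = cclass w <-> exists y, cval z = cval w + diff y.
Proof.
have -> : (cclass z = cclass w) <-> (z - w \in is_coboundary).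
  by rewrite Quotient.idealrBE; split => /eqP.
split=> [/coboundaryP [y zwy]|[y zwy]].
  by exists y; rewrite -zwy addrC subrK.
by apply/coboundaryP; exists y; rewrite -[LHS]/(cval z - cval w) zwy addrC addKr.
Qed.

Lemma cclassK (h : cohom) : cclass (repr h) = h.
Proof. exact: reprK. Qed.

Lemma cclassD (z w : cocycle) : cclass (z + w) = cclass z + cclass w.
Proof. exact: pi_addr. Qed.

Definition cohom_scale (c : k) (h : cohom) : cohom := cclass (c *: repr h).

Lemma cclassZ (c : k) (z : cocycle) : cohom_scale c (cclass z) = cclass (c *: z).
Proof.
have /cclassP [y zy] : cclass (repr (cclass z)) = cclass z by rewrite cclassK.
apply/cclassP; exists (c *: y).
rewrite -[LHS]/(c *: cval (repr (cclass z))) zy scalerDr diffZ.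
by rewrite -[cval (c *: z)]/(c *: cval z).
Qed.

Lemma cohom_scaleA (a b : k) h :
  cohom_scale a (cohom_scale b h) = cohom_scale (a * b) h.
Proof. by rewrite -[h]cclassK !cclassZ scalerA. Qed.

Lemma cohom_scale1 : left_id 1 cohom_scale.
Proof. by move=> h; rewrite -[h]cclassK !cclassZ scale1r. Qed.

Lemma cohom_scaleDr : right_distributive cohom_scale +%R.
Proof.
move=> a h h'; rewrite -[h]cclassK -[h']cclassK -cclassD !cclassZ.
by rewrite -cclassD scalerDr.
Qed.

Lemma cohom_scaleDl h : {morph cohom_scale^~ h : a b / a + b}.
Proof. by move=> a b; rewrite -[h]cclassK !cclassZ -cclassD scalerDl. Qed.

HB.instance Definition _ := GRing.Zmodule_isLmodule.Build k cohom
  cohom_scaleA cohom_scale1 cohom_scaleDr cohom_scaleDl.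

Lemma cmul_cocycle (z w : cocycle) : cval z * cval w \in is_cocycle.
Proof. by apply/eqP; rewrite diffMl ?cvalP // mul0r. Qed.

Definition cmul (z w : cocycle) : cocycle := Cocycle (cmul_cocycle z w).

Lemma cone_cocycle : (1 : B) \in is_cocycle.
Proof. by apply/eqP; exact: diff1. Qed.

Definition cone : cocycle := Cocycle cone_cocycle.

Definition cohom_one : cohom := cclass cone.

Definition cohom_mul (g h : cohom) : cohom := cclass (cmul (repr g) (repr h)).

Lemma cclassM (z w : cocycle) :
  cohom_mul (cclass z) (cclass w) = cclass (cmul z w).
Proof.
have /cclassP [x zx] : cclass (repr (cclass z)) = cclass z by rewrite cclassK.
have /cclassP [y wy] : cclass (repr (cclass w)) = cclass w by rewrite cclassK.
have [z' _ zz'] := diffMr (cvalP z).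
apply/cclassP; exists (x * cval (repr (cclass w)) + z' * y).
rewrite diffD -zz' diffMl ?cvalP //=.
by rewrite [in LHS]zx mulrDl {1}wy mulrDr -!addrA; congr (_ + _); rewrite addrC.
Qed.

Lemma cclassZE (c : k) (z : cocycle) : cclass (c *: z) = c *: cclass z.
Proof. by rewrite -cclassZ. Qed.

Lemma cocycleP (z w : cocycle) : cval z = cval w -> z = w.
Proof. exact: val_inj. Qed.

Lemma cohom_is_algebra : is_algebra cohom_one cohom_mul.
Proof.
split.
- move=> f g h; rewrite -[f]cclassK -[g]cclassK -[h]cclassK !cclassM.
  by congr cclass; apply: cocycleP; rewrite /= mulrA.
- move=> h; rewrite -[h]cclassK cclassM.
  by congr cclass; apply: cocycleP; rewrite /= mul1r.
- move=> h; rewrite -[h]cclassK cclassM.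
  by congr cclass; apply: cocycleP; rewrite /= mulr1.
- move=> f g h; rewrite -[f]cclassK -[g]cclassK -[h]cclassK -cclassD !cclassM.
  by rewrite -cclassD; congr cclass; apply: cocycleP; rewrite /= mulrDl.
- move=> f g h; rewrite -[f]cclassK -[g]cclassK -[h]cclassK -cclassD !cclassM.
  by rewrite -cclassD; congr cclass; apply: cocycleP; rewrite /= mulrDr.
- move=> c g h; rewrite -[g]cclassK -[h]cclassK -cclassZE !cclassM -cclassZE.
  by congr cclass; apply: cocycleP; rewrite /= algZAl.
- move=> c g h; rewrite -[g]cclassK -[h]cclassK -cclassZE !cclassM -cclassZE.
  by congr cclass; apply: cocycleP; rewrite /= algZAr.
Qed.

Definition cohom_algebra : algebra k := Algebra cohom_is_algebra.

Definition cohom_homog (i : int) : {pred cohom_algebra} :=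
  fun h : cohom => `[< exists2 z, cval z \in homog B i & h = cclass z >].

Lemma cohom_homogP (i : int) (h : cohom) :
  reflect (exists2 z, cval z \in homog B i & h = cclass z) (h \in cohom_homog i).
Proof. exact: asboolP. Qed.

Lemma cclass_0 : cclass 0 = 0.
Proof. by apply: (addrI (cclass 0)); rewrite -cclassD !addr0. Qed.

Lemma cclass_sum (s : seq int) (F : int -> cocycle) :
  cclass (\sum_(i <- s) F i) = \sum_(i <- s) cclass (F i).
Proof. exact: (big_morph cclass cclassD cclass_0). Qed.

Lemma cval_sum (s : seq int) (F : int -> cocycle) :
  cval (\sum_(i <- s) F i) = \sum_(i <- s) cval (F i).
Proof. exact: (big_morph cval). Qed.

Lemma cclass0 (z : cocycle) : cclass z = 0 <-> exists y, cval z = diff y.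
Proof.
rewrite -cclass_0.
have c0 : cval 0 = 0 by [].
split=> [/cclassP [y zy]|[y zy]].
  by exists y; rewrite zy c0 add0r.
by apply/cclassP; exists y; rewrite zy c0 add0r.
Qed.

Lemma cohom_is_grading : is_grading cohom_homog.
Proof.
split.
- move=> i; split.
    apply/cohom_homogP; exists 0; first exact: homog0.
    by apply/esym/cclass0; exists 0; rewrite diff0.
  move=> c f g /cohom_homogP [z zi ->] /cohom_homogP [w wi ->].
  apply/cohom_homogP; exists (c *: z + w); first exact: homogZD.
  by rewrite cclassD cclassZE.
- by apply/cohom_homogP; exists cone; rewrite //= homog1.
- move=> i j f g /cohom_homogP [z zi ->] /cohom_homogP [w wi ->].
  apply/cohom_homogP; exists (cmul z w); first exact: homogM.
  exact: cclassM.
- move=> h; have [f xf] := decomposes_ex (cval (repr h)).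
  have df := cocycle_components xf (cvalP _).
  have zf i : f i \in is_cocycle by apply/eqP.
  case: xf => fh [s [us fs hE]].
  exists s, (fun i => cclass (Cocycle (zf i))); split=> [i|].
    by apply/cohom_homogP; exists (Cocycle (zf i)); first exact: fh.
  rewrite -cclass_sum -[LHS]cclassK; congr cclass; apply: cocycleP.
  by rewrite cval_sum.
- move=> s f us fh sf0 i si.
  have /choice [z zf] : forall i, exists z, cval z \in homog B i /\ f i = cclass z.
    by move=> j; have /cohom_homogP [w wj ->] := fh j; exists w.
  move: sf0; rewrite (eq_bigr _ (fun i _ => (zf i).2)) -cclass_sum => /cclass0 [y].
  rewrite cval_sum => zy; rewrite (zf i).2; apply/cclass0.
  have [g yg] := decomposes_ex y; exists (g (i - 1)).
  have := decomposes_diff yg; rewrite -zy => zg.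
  have zz : decomposes (\sum_(i <- s) cval (z i))
      (fun i => if i \in s then cval (z i) else 0).
    split=> [j|]; first by case: ifP => _; rewrite ?homog0 ?(zf j).1.
    exists s; split=> // [j /negPf ->|] //.
    by rewrite big_seq [RHS]big_seq; apply: eq_bigr => j ->.
  by have /(congr1 (@^~ i)) /= := decomposes_uniq zz zg; rewrite si.
Qed.

(* ker d / im d; as d is homogeneous, this is the direct sum of the H^i(B). *)
Definition cohomology : gradedAlgebra k := GradedAlgebra cohom_is_grading.

End Cohomology.

Arguments is_cocycle {k} B.

Section Formality.
Variable k : fieldType.

Lemma dg_morphism_cocycle (B C : dgAlgebra k) (f : B -> C) :
  dg_morphism f -> forall z : cocycle B, f (cval z) \in is_cocycle C.
Proof.
move=> [[fl _ _] fd] z; apply/eqP; rewrite -fd cvalP.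
by have := fl (-1) 0 0; rewrite scaler0 addr0 scaleN1r addNr.
Qed.

Definition cohom_map (B C : dgAlgebra k) (f : B -> C) (fP : dg_morphism f) :
    cohomology B -> cohomology C :=
  fun h : cohom B => cclass (Cocycle (dg_morphism_cocycle fP (repr h))).

Lemma cohom_map_cclass (B C : dgAlgebra k) (f : B -> C) (fP : dg_morphism f)
    (z : cocycle B) :
  cohom_map fP (cclass z) = cclass (Cocycle (dg_morphism_cocycle fP z)).
Proof.
have /cclassP [x zx] : cclass (repr (cclass z)) = cclass z by rewrite cclassK.
apply/cclassP; exists (f x) => /=; rewrite zx.
by case: fP => [[fl _ _] fd]; rewrite -fd -[cval z]scale1r fl !scale1r.
Qed.

Definition quasi_isomorphism (B C : dgAlgebra k) (f : B -> C)
    (fP : dg_morphism f) : Prop :=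
  graded_iso (cohom_map fP).

Definition quasi_isomorphic : dgAlgebra k -> dgAlgebra k -> Prop :=
  clos_refl_sym_trans (dgAlgebra k)
    (fun B C => exists (f : B -> C) (fP : dg_morphism f), quasi_isomorphism fP).

Definition formal (B : dgAlgebra k) : Prop :=
  quasi_isomorphic B (zero_dg (cohomology B)).

Definition intrinsically_formal (A : gradedAlgebra k) : Prop :=
  forall B : dgAlgebra k, graded_isomorphic (cohomology B) A -> formal B.

End Formality.

(* Main.v *)
Require Import Defs.
From HB Require Import structures.
From mathcomp Require Import all_boot all_order all_algebra.
From mathcomp Require Import boolp classical_sets functions fsbigop.
From mathcomp Require Import zify.
From Stdlib Require Import Relation_Operators.

(** Let B be a DG algebra with cohomology A = L[t, 1/t].  Two DG algebras A and B are
    quasi-isomorphic as soon as there is a DG A-B-bimodule W with a cocycle x of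
    degree 0 such that a |-> a x and b |-> x b are isomorphisms on cohomology: the
    triangular matrices with corners A and B and upper entry in W, with the
    differential twisted by x, project onto A and onto B by quasi-isomorphisms
    (bimodule_zigzag).  So it suffices to realize A, seen as a bimodule over itself,
    by a DG A-B-bimodule.

    This is done in two steps.  First L[t, 1/t] is realized by a DG L-B-bimodule X.
    Because H(B) is concentrated in the multiples of m and t is invertible in it, a
    suitable X is governed by the L-bimodule H^0(X), and one needs H^0(X) = L.
    Free objects are sums of copies of the tensor product of L and B, projective
    L-bimodules are realized with the help of an Eilenberg swindle
    (eilenberg_swindle, projective_object), and a projective resolution of length d
    is turned into an iterated mapping cone (tower).  At each stage a map given on
    H^0 has to be lifted to a morphism, and the obstructions lie in the cohomology
    of the target in the degrees -1, -2, ..., -(m - 1), where it vanishes; this is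
    where d <= m enters.

    Secondly, since X is built from at most m + 1 layers, the same argument lifts
    multiplication by t on H(X) to an endomorphism T of X of degree m, bilinear over
    L and B.  It commutes strictly with L but is only invertible on cohomology.  A
    two-sided mapping telescope of T (torus) has the cohomology of X
    (torus_in_inj, torus_in_surj) and carries a strict automorphism t, hence a left
    action of A; this is the bimodule W. *)

Set Implicit Arguments.
Unset Strict Implicit.
Unset Printing Implicit Defensive.

Import GRing.Theory.

Local Open Scope ring_scope.

(** * Additive maps, signs and gradings *)

Section AdditiveMaps.

Definition addmap (U V : zmodType) (f : U -> V) : Prop :=
  forall x y, f (x + y) = f x + f y.

Variables (U V : zmodType) (f : U -> V).
Hypothesis fD : addmap f.

Lemma addmap0 : f 0 = 0.
Proof. by apply: (addrI (f 0)); rewrite -fD !addr0. Qed.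

Lemma addmapN x : f (- x) = - f x.
Proof. by apply: (addrI (f x)); rewrite -fD !subrr addmap0. Qed.

Lemma addmapB x y : f (x - y) = f x - f y.
Proof. by rewrite fD addmapN. Qed.

Lemma addmap_sum I (r : seq I) (P : pred I) (F : I -> U) :
  f (\sum_(i <- r | P i) F i) = \sum_(i <- r | P i) f (F i).
Proof. exact: (big_morph f fD addmap0). Qed.

End AdditiveMaps.

Lemma addmap_comp (U V W : zmodType) (g : V -> W) (f : U -> V) :
  addmap g -> addmap f -> addmap (fun x => g (f x)).
Proof. by move=> gD fD x y; rewrite fD gD. Qed.

Section Signs.
Variable k : fieldType.

Definition sg (i : int) : k := (-1) ^+ `|i|%N.

Lemma sgE i : sg i = if odd `|i| then -1 else 1.
Proof. by rewrite /sg -signr_odd; case: odd. Qed.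

Lemma sgD i j : sg (i + j) = sg i * sg j.
Proof.
rewrite !sgE (_ : odd `|i + j| = odd `|i| (+) odd `|j|); last by lia.
by case: (odd `|i|); case: (odd `|j|); rewrite ?mulN1r ?mulrN1 ?opprK ?mulr1.
Qed.

Lemma sg0 : sg 0 = 1. Proof. by []. Qed.
Lemma sg1 : sg 1 = -1. Proof. by rewrite sgE. Qed.

Lemma sgN i : sg (- i) = sg i. Proof. by rewrite /sg abszN. Qed.

Lemma sgK i : sg i * sg i = 1.
Proof. by rewrite sgE; case: ifP; rewrite ?mulrNN ?mulr1. Qed.

Lemma sg1D i : sg (i + 1) = - sg i.
Proof. by rewrite sgD sg1 mulrN1. Qed.

Lemma sg_mul (A : algebra k) i (x : A) : (-1) ^+ `|i|%N * x = sg i *: x.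
Proof. by rewrite sgE -signr_odd; case: odd; rewrite ?mulN1r ?mul1r ?scaleN1r ?scale1r. Qed.

End Signs.

Section Gradings.
Variable k : fieldType.

Record is_direct (V : lmodType k) (h : int -> {pred V}) : Prop := {
  dir_sub : forall i, submod_closed (h i);
  dir_span : forall x, exists (s : seq int) (f : int -> V),
    (forall i, f i \in h i) /\ x = \sum_(i <- s) f i;
  dir_free : forall (s : seq int) (f : int -> V), uniq s ->
    (forall i, f i \in h i) -> \sum_(i <- s) f i = 0 ->
    forall i, i \in s -> f i = 0
}.

Section Closure.
Variables (V : lmodType k) (h : int -> {pred V}).
Hypothesis hsub : forall i, submod_closed (h i).

Lemma dir0 i : 0 \in h i. Proof. by case: (hsub i). Qed.

Lemma dirZD i (c : k) x y : x \in h i -> y \in h i -> c *: x + y \in h i.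
Proof. by case: (hsub i) => _; apply. Qed.

Lemma dirD i x y : x \in h i -> y \in h i -> x + y \in h i.
Proof. by move=> xi yi; rewrite -[x]scale1r dirZD. Qed.

Lemma dirZ i (c : k) x : x \in h i -> c *: x \in h i.
Proof. by move=> xi; rewrite -[c *: x]addr0 dirZD // dir0. Qed.

Lemma dirN i x : x \in h i -> - x \in h i.
Proof. by rewrite -scaleN1r; apply: dirZ. Qed.

Lemma dirB i x y : x \in h i -> y \in h i -> x - y \in h i.
Proof. by move=> xi yi; apply/dirD => //; apply: dirN. Qed.

Lemma dir_sum I (r : seq I) (P : pred I) (F : I -> V) i :
  (forall j, P j -> F j \in h i) -> \sum_(j <- r | P j) F j \in h i.
Proof.
by move=> Fh; apply: (big_ind (fun x => x \in h i)) => // *; [exact: dir0|exact: dirD].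
Qed.

(** A form of the spanning condition that is closed under sums, so that on a direct
    sum it can be checked on the summands. *)
Definition spanned (x : V) := exists (s : seq int) (f : int -> V),
  [/\ uniq s, forall i, f i \in h i & x = \sum_(i <- s) f i].

Lemma spanned_homog i x : x \in h i -> spanned x.
Proof.
move=> xi; exists [:: i], (fun j => if j == i then x else 0); split=> //.
  by move=> j; case: eqP => [->|] // _; exact: dir0.
by rewrite big_seq1 eqxx.
Qed.

Lemma spanned0 : spanned 0.
Proof. by apply: (@spanned_homog 0); exact: dir0. Qed.

Lemma big_mask (s t : seq int) (f : int -> V) : uniq s -> uniq t -> {subset s <= t} ->
  \sum_(i <- s) f i = \sum_(i <- t) (if i \in s then f i else 0).
Proof.
move=> us ut st; rewrite -big_mkcond -[RHS]big_filter.
apply/perm_big/uniq_perm; rewrite ?filter_uniq // => i.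
by rewrite mem_filter andbC; case: (boolP (i \in s)) => [/st ->|]; rewrite ?andbF.
Qed.

Lemma spannedD x y : spanned x -> spanned y -> spanned (x + y).
Proof.
move=> [s [f [us fh ->]]] [t [g [ut gh ->]]].
have ust := undup_uniq (s ++ t).
exists (undup (s ++ t)),
  (fun i => (if i \in s then f i else 0) + (if i \in t then g i else 0)).
split=> // [i|].
  by apply: dirD; case: ifP => // _; exact: dir0.
rewrite big_split /=; congr (_ + _); apply: big_mask => // i it;
  by rewrite mem_undup mem_cat it ?orbT.
Qed.

Lemma spanned_sum I (r : seq I) (P : pred I) (F : I -> V) :
  (forall j, P j -> spanned (F j)) -> spanned (\sum_(j <- r | P j) F j).
Proof.
by move=> Fh; apply: (big_ind spanned) => // *; [exact: spanned0|exact: spannedD].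
Qed.

End Closure.

Lemma direct_intro (V : lmodType k) (h : int -> {pred V}) :
  (forall i, submod_closed (h i)) -> (forall x, spanned h x) ->
  (forall (s : seq int) (f : int -> V), uniq s ->
    (forall i, f i \in h i) -> \sum_(i <- s) f i = 0 ->
    forall i, i \in s -> f i = 0) -> is_direct h.
Proof.
by move=> hs hx hf; split=> // x; have [s [f [_ fh ->]]] := hx x; exists s, f.
Qed.

Lemma direct_spanned (V : lmodType k) (h : int -> {pred V}) :
  is_direct h -> forall x, spanned h x.
Proof.
move=> hd x; have [s [f [fh ->]]] := dir_span hd x.
apply: spanned_sum => [|i _]; first exact: dir_sub.
by apply: (spanned_homog (dir_sub hd)); exact: fh.
Qed.

Lemma homog_direct (A : gradedAlgebra k) : is_direct (homog A).
Proof.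
by split; [exact: grading_sub (ga_axiom A)|exact: grading_span (ga_axiom A)
  |exact: grading_free (ga_axiom A)].
Qed.

End Gradings.

Lemma big_supp_eq (I : choiceType) (W : zmodType) (F : I -> W) (s t : seq I) :
  uniq s -> uniq t -> (forall i, i \notin s -> F i = 0) ->
  (forall i, i \notin t -> F i = 0) -> \sum_(i <- s) F i = \sum_(i <- t) F i.
Proof.
move=> us ut Fs Ft.
have E (r : seq I) : uniq r -> (forall i, i \notin r -> F i = 0) ->
    \sum_(i \in [set: I]) F i = \sum_(i <- r) F i.
  move=> ur Fr; rewrite (fsbigE r) //; last by move=> i _ /Fr.
  by apply: eq_bigl => i; rewrite in_setT.
by rewrite -E // -E.
Qed.

(** * Functions of finite support *)

Section FiniteSupport.
Variables (k : fieldType) (I : choiceType).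

Section Carrier.
Variable U : lmodType k.

Definition finsupp : {pred I -> U} :=
  fun f => `[< exists2 s : seq I, uniq s & forall n, n \notin s -> f n = 0 >].

Record fs := Fs { fsval :> I -> U; _ : finsupp fsval }.

HB.instance Definition _ := [isSub for fsval].
HB.instance Definition _ := [Choice of fs by <:].

Lemma finsuppP (f : I -> U) :
  (exists s : seq I, forall n, n \notin s -> f n = 0) -> finsupp f.
Proof.
move=> [s fs0]; apply/asboolP; exists (undup s); first exact: undup_uniq.
by move=> n; rewrite mem_undup; exact: fs0.
Qed.

Lemma fs_submod : submod_closed finsupp.
Proof.
split; first by apply: finsuppP; exists [::].
move=> c f g /asboolP [s us f0] /asboolP [t ut g0]; apply: finsuppP; exists (s ++ t) => n.
rewrite mem_cat negb_or => /andP [/f0 fn /g0 gn].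
by change (c *: f n + g n = 0); rewrite fn gn scaler0 addr0.
Qed.

HB.instance Definition _ := GRing.isSubmodClosed.Build k (I -> U) finsupp
  (GRing.submod_closed_semi fs_submod).
HB.instance Definition _ := [SubChoice_isSubLmodule of fs by <:].

Lemma fsP (f g : fs) : (forall n, f n = g n) -> f = g.
Proof. by move=> fg; apply/val_inj/funext. Qed.

Lemma fsDE (f g : fs) n : (f + g) n = f n + g n. Proof. by []. Qed.
Lemma fsZE (c : k) (f : fs) n : (c *: f) n = c *: f n. Proof. by []. Qed.
Lemma fsNE (f : fs) n : (- f) n = - f n. Proof. by []. Qed.
Lemma fs0E n : (0 : fs) n = 0. Proof. by []. Qed.

Lemma fs_sumE J (r : seq J) (P : pred J) (F : J -> fs) n :
  (\sum_(j <- r | P j) F j) n = \sum_(j <- r | P j) F j n.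
Proof. exact: (big_morph (fun f : fs => f n)). Qed.

Lemma fs_supp (f : fs) : exists2 s : seq I, uniq s & forall n, n \notin s -> f n = 0.
Proof. by case: f => f /= /asboolP. Qed.

Lemma delta_supp (i : I) (u : U) : finsupp (fun j => if j == i then u else 0).
Proof. by apply: finsuppP; exists [:: i] => n; rewrite inE => /negPf ->. Qed.

Definition delta (i : I) (u : U) : fs := Fs (delta_supp i u).

Lemma deltaE i u j : delta i u j = if j == i then u else 0. Proof. by []. Qed.

Lemma deltaD i : addmap (delta i).
Proof. by move=> u v; apply: fsP => j; rewrite fsDE !deltaE; case: ifP; rewrite ?addr0. Qed.

Lemma fs_delta (f : fs) : exists2 s : seq I, uniq s & f = \sum_(i <- s) delta i (f i).
Proof.
have [s us f0] := fs_supp f; exists s => //; apply: fsP => n; rewrite fs_sumE.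
have [ns|/f0 fn] := boolP (n \in s).
  rewrite (bigD1_seq n) //= eqxx big1 ?addr0 // => i.
  by rewrite eq_sym => /negPf ->.
rewrite fn big_seq big1 // => i _; rewrite deltaE.
by case: eqP => // <-; rewrite fn.
Qed.

Lemma fs_ind (Q : fs -> Prop) : Q 0 -> (forall f g, Q f -> Q g -> Q (f + g)) ->
  (forall i u, Q (delta i u)) -> forall f, Q f.
Proof. by move=> Q0 QD Qd f; have [s _ ->] := fs_delta f; apply: (big_ind Q). Qed.

End Carrier.

Section Map.
Variables (U V : lmodType k) (h : I -> U -> V).
Hypothesis h0 : forall i, h i 0 = 0.

Lemma fsmap_supp (f : fs U) : finsupp (fun i => h i (f i)).
Proof.
by have [s _ f0] := fs_supp f; apply: finsuppP; exists s => n /f0 ->.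
Qed.

Definition fsmap (f : fs U) : fs V := Fs (fsmap_supp f).

End Map.

(** Cohomological statements about direct sums are checked one summand at a time;
    the condition R i 0 0 keeps the family of chosen values finitely supported. *)
Lemma fs_choice (U V : lmodType k) (R : I -> U -> V -> Prop) (f : fs U) :
  (forall i, exists v, R i (f i) v) -> (forall i, R i 0 0) ->
  exists g : fs V, forall i, R i (f i) (g i).
Proof.
move=> ex R0; have [s _ f0] := fs_supp f.
have /choice [g gP] : forall i, exists v, R i (f i) v /\ (f i = 0 -> v = 0).
  move=> i; have [fi|fi] := EM (f i = 0); first by exists 0; rewrite fi.
  by have [v v1] := ex i; exists v.
have gs : finsupp g by apply: finsuppP; exists s => n /f0 /(gP n).2.
by exists (Fs gs) => i; exact: (gP i).1.
Qed.

Section Sum.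
Variables (U : lmodType k) (W : zmodType) (h : I -> U -> W).
Hypothesis hD : forall i, addmap (h i).

Definition fsum (f : fs U) : W := \sum_(i \in [set: I]) h i (f i).

Lemma fsumE (f : fs U) (s : seq I) : uniq s -> (forall i, i \notin s -> f i = 0) ->
  fsum f = \sum_(i <- s) h i (f i).
Proof.
move=> us f0; rewrite /fsum (fsbigE s) //; last first.
  by move=> i _ /f0 ->; rewrite addmap0.
by apply: eq_bigl => i; rewrite in_setT.
Qed.

Lemma fsumD : addmap fsum.
Proof.
move=> f g; have [s us f0] := fs_supp f; have [t ut g0] := fs_supp g.
have fst i : i \notin undup (s ++ t) -> f i = 0 /\ g i = 0.
  by rewrite mem_undup mem_cat negb_or => /andP [/f0 -> /g0 ->].
rewrite !(fsumE (undup_uniq (s ++ t))) => [|i /fst []|i /fst []|i /fst [fi gi]] //.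
  by rewrite -big_split /=; apply: eq_bigr => i _; rewrite hD.
by rewrite fsDE fi gi addr0.
Qed.

Lemma fsum_delta i u : fsum (delta i u) = h i u.
Proof.
rewrite (@fsumE _ [:: i]) // => [|j]; first by rewrite big_seq1 deltaE eqxx.
by rewrite inE deltaE => /negPf ->.
Qed.

End Sum.

Lemma addmap_delta (U : lmodType k) (W : zmodType) (f g : fs U -> W) :
  addmap f -> addmap g -> (forall i u, f (delta i u) = g (delta i u)) -> f =1 g.
Proof.
move=> fD gD fg; apply: fs_ind => [|x y xe ye|//]; first by rewrite !addmap0.
by rewrite fD gD xe ye.
Qed.

End FiniteSupport.

(** * Bimodules over two algebras *)

Section Bimod.
Variables (k : fieldType) (L R : algebra k).

Record is_bimod (V : lmodType k) (l : L -> V -> V) (r : V -> R -> V) : Prop := {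
  bm_lDl : forall a b v, l (a + b) v = l a v + l b v;
  bm_lDr : forall a, addmap (l a);
  bm_lZ : forall (c : k) a v, l (c *: a) v = c *: l a v;
  bm_l1 : forall v, l 1 v = v;
  bm_lM : forall a b v, l (a * b) v = l a (l b v);
  bm_rDl : forall u v a, r (u + v) a = r u a + r v a;
  bm_rDr : forall v, addmap (r v);
  bm_rZ : forall (c : k) v a, r v (c *: a) = c *: r v a;
  bm_r1 : forall v, r v 1 = v;
  bm_rM : forall v a b, r v (a * b) = r (r v a) b;
  bm_lr : forall a v b, r (l a v) b = l a (r v b)
}.

Record bimod := Bimod {
  bm_sort :> lmodType k;
  la : L -> bm_sort -> bm_sort;
  ra : bm_sort -> R -> bm_sort;
  bm_ax : is_bimod la ra
}.

Section Theory.
Variable M : bimod.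
Implicit Types (u v : M).

Lemma laDl a b v : la (a + b) v = la a v + la b v.
Proof. exact: (bm_lDl (bm_ax M)). Qed.
Lemma laD a u v : la a (u + v) = la a u + la a v.
Proof. exact: (bm_lDr (bm_ax M)). Qed.
Lemma laZl (c : k) a v : la (c *: a) v = c *: la a v.
Proof. exact: (bm_lZ (bm_ax M)). Qed.
Lemma la1 v : la 1 v = v. Proof. exact: (bm_l1 (bm_ax M)). Qed.
Lemma laM a b v : la (a * b) v = la a (la b v).
Proof. exact: (bm_lM (bm_ax M)). Qed.
Lemma raD u v b : ra (u + v) b = ra u b + ra v b.
Proof. exact: (bm_rDl (bm_ax M)). Qed.
Lemma raDr v a b : ra v (a + b) = ra v a + ra v b.
Proof. exact: (bm_rDr (bm_ax M)). Qed.
Lemma raZr (c : k) v b : ra v (c *: b) = c *: ra v b.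
Proof. exact: (bm_rZ (bm_ax M)). Qed.
Lemma ra1 v : ra v 1 = v. Proof. exact: (bm_r1 (bm_ax M)). Qed.
Lemma raM v a b : ra v (a * b) = ra (ra v a) b.
Proof. exact: (bm_rM (bm_ax M)). Qed.
Lemma la_ra a v b : ra (la a v) b = la a (ra v b).
Proof. exact: (bm_lr (bm_ax M)). Qed.

Lemma scale_la (c : k) v : c *: v = la (c *: (1 : L)) v.
Proof. by rewrite laZl la1. Qed.
Lemma laZ a (c : k) v : la a (c *: v) = c *: la a v.
Proof. by rewrite scale_la -laM algZAr mulr1 laZl. Qed.
Lemma raZ (c : k) v b : ra (c *: v) b = c *: ra v b.
Proof. by rewrite !scale_la la_ra. Qed.

Lemma la0 a : la a 0 = 0 :> M. Proof. exact: addmap0 (laD a). Qed.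
Lemma laDl' v : addmap (fun a : L => la a v). Proof. by move=> a b; rewrite laDl. Qed.
Lemma la0l v : la 0 v = 0. Proof. exact: addmap0 (laDl' v). Qed.
Lemma laN a v : la a (- v) = - la a v. Proof. exact: addmapN (laD a) v. Qed.
Lemma laB a u v : la a (u - v) = la a u - la a v. Proof. by rewrite laD laN. Qed.
Lemma la_sum a J (r : seq J) P (F : J -> M) :
  la a (\sum_(j <- r | P j) F j) = \sum_(j <- r | P j) la a (F j).
Proof. exact: (addmap_sum (laD a)). Qed.
Lemma la_suml v J (r : seq J) P (F : J -> L) :
  la (\sum_(j <- r | P j) F j) v = \sum_(j <- r | P j) la (F j) v.
Proof. exact: (addmap_sum (laDl' v)). Qed.

Lemma raD' b : addmap (fun v => ra v b). Proof. by move=> u v; rewrite raD. Qed.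
Lemma ra0 b : ra 0 b = 0 :> M. Proof. exact: addmap0 (raD' b). Qed.
Lemma ra0r v : ra v 0 = 0. Proof. exact: addmap0 (raDr v). Qed.
Lemma raN v b : ra (- v) b = - ra v b. Proof. exact: addmapN (raD' b) v. Qed.
Lemma raNr v b : ra v (- b) = - ra v b. Proof. exact: addmapN (raDr v) b. Qed.
Lemma raB u v b : ra (u - v) b = ra u b - ra v b. Proof. by rewrite raD raN. Qed.
Lemma raBr u a b : ra u (a - b) = ra u a - ra u b. Proof. by rewrite raDr raNr. Qed.
Lemma ra_sum b J (r : seq J) P (F : J -> M) :
  ra (\sum_(j <- r | P j) F j) b = \sum_(j <- r | P j) ra (F j) b.
Proof. exact: (addmap_sum (raD' b)). Qed.
Lemma ra_sumr v J (r : seq J) P (F : J -> R) :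
  ra v (\sum_(j <- r | P j) F j) = \sum_(j <- r | P j) ra v (F j).
Proof. exact: (addmap_sum (raDr v)). Qed.

End Theory.

Record bmap (M N : bimod) (f : M -> N) : Prop := {
  bmapD : addmap f;
  bmap_la : forall a v, f (la a v) = la a (f v);
  bmap_ra : forall v b, f (ra v b) = ra (f v) b
}.

Lemma bmapZ (M N : bimod) (f : M -> N) : bmap f ->
  forall (c : k) v, f (c *: v) = c *: f v.
Proof. by move=> fb c v; rewrite !scale_la (bmap_la fb). Qed.

Lemma bmap_id (M : bimod) : bmap (@id M). Proof. by []. Qed.

Lemma bmap_comp (M N Q : bimod) (g : N -> Q) (f : M -> N) :
  bmap g -> bmap f -> bmap (g \o f).
Proof.
move=> gb fb; split=> [u v|a v|v b] /=.
- by rewrite (bmapD fb) (bmapD gb).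
- by rewrite (bmap_la fb) (bmap_la gb).
- by rewrite (bmap_ra fb) (bmap_ra gb).
Qed.

Lemma bmap_add (M N : bimod) (f g : M -> N) :
  bmap f -> bmap g -> bmap (fun x => f x + g x).
Proof.
move=> fb gb; split=> [u v|a v|v b].
- by rewrite (bmapD fb) (bmapD gb) addrACA.
- by rewrite (bmap_la fb) (bmap_la gb) laD.
- by rewrite (bmap_ra fb) (bmap_ra gb) raD.
Qed.

Lemma bmap_scale (M N : bimod) (f : M -> N) (c : k) :
  bmap f -> bmap (fun x => c *: f x).
Proof.
move=> fb; split=> [u v|a v|v b].
- by rewrite (bmapD fb) scalerDr.
- by rewrite (bmap_la fb) laZ.
- by rewrite (bmap_ra fb) raZ.
Qed.

Lemma bmap_opp (M N : bimod) (f : M -> N) : bmap f -> bmap (fun x => - f x).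
Proof.
move=> fb; split=> [u v|a v|v b].
- by rewrite (bmapD fb) opprD.
- by rewrite (bmap_la fb) laN.
- by rewrite (bmap_ra fb) raN.
Qed.

Lemma bmap_sub (M N : bimod) (f g : M -> N) :
  bmap f -> bmap g -> bmap (fun x => f x - g x).
Proof. by move=> fb gb; apply: bmap_add => //; apply: bmap_opp. Qed.

Section FsBimod.
Variables (I : choiceType) (M : bimod).

Definition fsl a (f : fs I M) : fs I M := fsmap (h := fun _ : I => la a) (fun=> la0 M a) f.
Definition fsr (f : fs I M) b : fs I M := fsmap (h := fun _ v => ra v b) (fun=> ra0 M b) f.

Lemma fs_is_bimod : is_bimod fsl fsr.
Proof.
by split; rewrite /addmap => *; apply: fsP => n; rewrite ?(fsDE, fsZE) /=
  ?(laDl, laD, laZl, la1, laM, raD, raDr, raZr, ra1, raM, la_ra).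
Qed.

Definition fs_bimod : bimod := Bimod fs_is_bimod.

Lemma fs_laE a (f : fs_bimod) n : fsval (la a f) n = la a (fsval f n).
Proof. by []. Qed.
Lemma fs_raE (f : fs_bimod) b n : fsval (ra f b) n = ra (fsval f n) b.
Proof. by []. Qed.

Lemma delta_bmap i : bmap (fun u : M => delta i u : fs_bimod).
Proof.
split=> [|a v|v b]; first exact: deltaD.
  by apply: fsP => j; rewrite fs_laE !deltaE; case: ifP; rewrite ?la0.
by apply: fsP => j; rewrite fs_raE !deltaE; case: ifP; rewrite ?ra0.
Qed.

Lemma fsum_bmap (N : bimod) (h : I -> M -> N) :
  (forall i, bmap (h i)) -> bmap (fsum h : fs_bimod -> N).
Proof.
move=> hb; have hD i : addmap (h i) := bmapD (hb i).
have sD := fsumD hD; split=> [|a|f b]; first exact: sD.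
  apply: (@addmap_delta _ _ M N (fun v => fsum h (la a (v : fs_bimod) : fs_bimod))
     (fun v => la a (fsum h v))).
  - exact: addmap_comp sD (@laD fs_bimod a).
  - exact: addmap_comp (@laD N a) sD.
  - move=> i u; rewrite -(bmap_la (delta_bmap i)) !fsum_delta //.
    exact: bmap_la.
apply: (@addmap_delta _ _ M N (fun v => fsum h (ra (v : fs_bimod) b : fs_bimod))
     (fun v => ra (fsum h v) b)).
- exact: addmap_comp sD (@raD' fs_bimod b).
- exact: addmap_comp (@raD' N b) sD.
- move=> i u; rewrite -(bmap_ra (delta_bmap i)) !fsum_delta //.
  exact: bmap_ra.
Qed.

End FsBimod.

End Bimod.

Arguments la {k L R M} : rename.
Arguments ra {k L R M} : rename.

Section Regular.
Variables (k : fieldType) (L : algebra k).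

Lemma of_bimodule_ax (M : bimodule L) : is_bimod (@lact k L M) (@ract k L M).
Proof.
case: M => V l r [lDl lDr lZl lZr l1 lM rDl rDr rZl rZr r1 rM lr].
by split=> // *; rewrite ?lM ?rM.
Qed.

Definition of_bimodule (M : bimodule L) : bimod L L := Bimod (of_bimodule_ax M).

Lemma to_bimodule_ax (M : bimod L L) : is_bimodule (@la k L L M) (@ra k L L M).
Proof.
by split=> *; rewrite ?(laDl, laD, laZl, laZ, la1, laM, raD, raDr, raZ, raZr, ra1, raM, la_ra).
Qed.

Definition to_bimodule (M : bimod L L) : bimodule L := Bimodule (to_bimodule_ax M).

End Regular.

(** * Free bimodules over a finite dimensional algebra *)

Section Basis.
Variables (k : fieldType) (L : algebra k) (n : nat).

Record is_basis (e : 'I_n -> L) (c : 'I_n -> L -> k) : Prop := {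
  basD : forall i, addmap (c i : L -> k^o);
  basZ : forall i (a : k) x, c i (a *: x) = a * c i x;
  bas_span : forall x, x = \sum_i c i x *: e i;
  bas_dual : forall i j, c i (e j) = (i == j)%:R
}.

End Basis.

(** The functions from n to R stand for the tensor product of L and R over k: f is
    the sum of the e_i (x) f_i.  Finite dimensionality of L enters only here, to
    write this tensor product in coordinates. *)
Section Free.
Variables (k : fieldType) (L R : algebra k) (n : nat).
Variables (e : 'I_n -> L) (c : 'I_n -> L -> k).
Hypothesis ec : is_basis e c.

Lemma bas_sum i J (r : seq J) P (F : J -> L) :
  c i (\sum_(j <- r | P j) F j) = \sum_(j <- r | P j) c i (F j).
Proof. exact: (addmap_sum (basD ec i)). Qed.

Lemma basM i a b : c i (a * b) = \sum_j c i (a * e j) * c j b.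
Proof.
rewrite {1}(bas_span ec b) mulr_sumr bas_sum; apply: eq_bigr => j _.
by rewrite algZAr (basZ ec) mulrC.
Qed.

Definition one_l (a : L) (f : {ffun 'I_n -> R}) : {ffun 'I_n -> R} :=
  [ffun i => \sum_j c i (a * e j) *: f j].
Definition one_r (f : {ffun 'I_n -> R}) (b : R) : {ffun 'I_n -> R} :=
  [ffun i => f i * b].

Lemma one_is_bimod : is_bimod one_l one_r.
Proof.
split.
- move=> a b v; apply/ffunP => i; rewrite !ffunE -big_split; apply: eq_bigr => j _.
  by rewrite mulrDl (basD ec) scalerDl.
- move=> a u v; apply/ffunP => i; rewrite !ffunE -big_split; apply: eq_bigr => j _.
  by rewrite ffunE scalerDr.
- move=> a b v; apply/ffunP => i; rewrite !ffunE scaler_sumr; apply: eq_bigr => j _.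
  by rewrite algZAl (basZ ec) scalerA.
- move=> v; apply/ffunP => i; rewrite !ffunE (bigD1 i) //= big1 ?addr0 => [|j ji].
    by rewrite mul1r (bas_dual ec) eqxx scale1r.
  by rewrite mul1r (bas_dual ec) eq_sym (negPf ji) scale0r.
- move=> a b v; apply/ffunP => i; rewrite !ffunE.
  under [RHS]eq_bigr => l _ do rewrite ffunE scaler_sumr.
  rewrite exchange_big; apply: eq_bigr => j _ /=.
  by rewrite -mulrA basM scaler_suml; apply: eq_bigr => l _; rewrite scalerA.
- by move=> u v a; apply/ffunP => i; rewrite !ffunE mulrDl.
- by move=> v a b; apply/ffunP => i; rewrite !ffunE mulrDr.
- by move=> a v b; apply/ffunP => i; rewrite !ffunE algZAr.
- by move=> v; apply/ffunP => i; rewrite !ffunE mulr1.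
- by move=> v a b; apply/ffunP => i; rewrite !ffunE mulrA.
- move=> a v b; apply/ffunP => i; rewrite !ffunE mulr_suml; apply: eq_bigr => j _.
  by rewrite ffunE algZAl.
Qed.

Definition one_bimod : bimod L R := Bimod one_is_bimod.

Definition one_gen : one_bimod :=
  ([ffun i => c i 1 *: (1 : R)] : {ffun 'I_n -> R}).

Lemma one_span (x : {ffun 'I_n -> R}) : x = \sum_i la (e i) (ra one_gen (x i)).
Proof.
apply/ffunP => j; rewrite sum_ffunE.
transitivity (\sum_i c j (e i) *: (x i : R)).
  rewrite (bigD1 j) //= big1 ?addr0 => [|i ij].
    by rewrite (bas_dual ec) eqxx scale1r.
  by rewrite (bas_dual ec) eq_sym (negPf ij) scale0r.
apply: eq_bigr => i _; rewrite !ffunE.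
under eq_bigr => l _ do rewrite !ffunE algZAl mul1r scalerA.
by rewrite -scaler_suml -basM mulr1.
Qed.

Definition one_lin (W : bimod L R) (w : W) (x : {ffun 'I_n -> R}) : W :=
  \sum_i la (e i) (ra w (x i)).

Lemma one_lin_bmap (W : bimod L R) (w : W) : bmap (one_lin w : one_bimod -> W).
Proof.
split=> [x y|a x|x b].
- rewrite -big_split; apply: eq_bigr => i _; by rewrite ffunE raDr laD.
- rewrite la_sum /one_lin.
  under eq_bigr => i _ do rewrite ffunE ra_sumr la_sum.
  rewrite exchange_big; apply: eq_bigr => j _ /=.
  rewrite -laM {2}(bas_span ec (a * e j)) la_suml; apply: eq_bigr => i _.
  by rewrite raZr laZ laZl.
- by rewrite ra_sum; apply: eq_bigr => i _; rewrite ffunE raM la_ra.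
Qed.

Lemma one_lin_gen (W : bimod L R) (w : W) : one_lin w one_gen = w.
Proof.
rewrite -[RHS]la1 (bas_span ec 1) la_suml; apply: eq_bigr => i _.
by rewrite ffunE raZr ra1 laZ laZl.
Qed.

Variable I : choiceType.

Definition free_bimod : bimod L R := fs_bimod I one_bimod.

Definition free_gen (p : I) : free_bimod := delta p one_gen.

Definition lin (W : bimod L R) (g : I -> W) : free_bimod -> W :=
  fsum (fun p => one_lin (g p)).

Lemma lin_bmap (W : bimod L R) (g : I -> W) : bmap (lin g).
Proof. by apply: fsum_bmap => p; exact: one_lin_bmap. Qed.

Lemma lin_delta (W : bimod L R) (g : I -> W) p x :
  lin g (delta p x) = \sum_i la (e i) (ra (g p) (x i)).
Proof. by rewrite /lin fsum_delta // => q; exact: (bmapD (one_lin_bmap _)). Qed.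

Lemma lin_gen (W : bimod L R) (g : I -> W) p : lin g (free_gen p) = g p.
Proof. by rewrite lin_delta -[RHS]one_lin_gen. Qed.

Lemma free_ext (W : bimod L R) (f g : free_bimod -> W) :
  bmap f -> bmap g -> (forall p, f (free_gen p) = g (free_gen p)) -> f =1 g.
Proof.
move=> fb gb fg; apply: addmap_delta => [||p u]; [exact: bmapD fb|exact: bmapD gb|].
have db := @delta_bmap _ L R I one_bimod p.
rewrite (one_span u) (addmap_sum (bmapD db)).
rewrite (addmap_sum (bmapD fb)) (addmap_sum (bmapD gb)); apply: eq_bigr => i _.
rewrite (bmap_la db) (bmap_ra db) (bmap_la fb) (bmap_ra fb) (bmap_la gb) (bmap_ra gb).
by congr (la _ (ra _ _)); exact: fg.
Qed.

Lemma lin_unique (W : bimod L R) (f : free_bimod -> W) :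
  bmap f -> f =1 lin (fun p => f (free_gen p)).
Proof. by move=> fb; apply: free_ext => // [|p]; [exact: lin_bmap|rewrite lin_gen]. Qed.

End Free.

(** * Differential graded bimodules *)

Section DGBim.
Variables (k : fieldType) (L : algebra k) (B : dgAlgebra k).
Local Notation sg := (sg k).

(** L sits in degree 0 and has no differential, so it acts without signs, and the
    differential is left L-linear. *)
Record is_dgbim (M : bimod L B) (d : M -> M) (h : int -> {pred M}) : Prop := {
  dgb_dir : is_direct h;
  dgb_hl : forall i a x, x \in h i -> la a x \in h i;
  dgb_hr : forall i j x b, x \in h i -> b \in homog B j -> ra x b \in h (i + j);
  dgb_dD : addmap d;
  dgb_dl : forall a x, d (la a x) = la a (d x);
  dgb_dh : forall i x, x \in h i -> d x \in h (i + 1);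
  dgb_dd : forall x, d (d x) = 0;
  dgb_leib : forall i x b, x \in h i ->
    d (ra x b) = ra (d x) b + sg i *: ra x (diff b)
}.

Record dgbim := DGBim {
  dg_bim :> bimod L B;
  dd : dg_bim -> dg_bim;
  hh : int -> {pred dg_bim};
  dg_ax : is_dgbim dd hh
}.
Arguments hh : clear implicits.

Section Theory.
Variable X : dgbim.
Implicit Types (x y : X) (i j : int).

Lemma hh_sub i : submod_closed (hh X i).
Proof. exact: dir_sub (dgb_dir (dg_ax X)) i. Qed.
Lemma hh0 i : 0 \in hh X i. Proof. exact: dir0 hh_sub i. Qed.
Lemma hhD i x y : x \in hh X i -> y \in hh X i -> x + y \in hh X i.
Proof. exact: dirD hh_sub i x y. Qed.
Lemma hhB i x y : x \in hh X i -> y \in hh X i -> x - y \in hh X i.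
Proof. exact: dirB hh_sub i x y. Qed.
Lemma hhN i x : x \in hh X i -> - x \in hh X i.
Proof. exact: dirN hh_sub i x. Qed.
Lemma hhZ i (c : k) x : x \in hh X i -> c *: x \in hh X i.
Proof. exact: dirZ hh_sub i c x. Qed.
Lemma hhl i a x : x \in hh X i -> la a x \in hh X i.
Proof. exact: (dgb_hl (dg_ax X)). Qed.
Lemma hhr i j x b : x \in hh X i -> b \in homog B j -> ra x b \in hh X (i + j).
Proof. exact: (dgb_hr (dg_ax X)). Qed.
Lemma hhd i x : x \in hh X i -> dd x \in hh X (i + 1).
Proof. exact: (dgb_dh (dg_ax X)). Qed.
Lemma ddD x y : dd (x + y) = dd x + dd y. Proof. exact: (dgb_dD (dg_ax X)). Qed.
Lemma dd0 : dd (0 : X) = 0. Proof. exact: addmap0 ddD. Qed.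
Lemma ddN x : dd (- x) = - dd x. Proof. exact: addmapN ddD x. Qed.
Lemma ddB x y : dd (x - y) = dd x - dd y. Proof. exact: addmapB ddD x y. Qed.
Lemma dd_sum J (r : seq J) P (F : J -> X) :
  dd (\sum_(j <- r | P j) F j) = \sum_(j <- r | P j) dd (F j).
Proof. exact: (addmap_sum ddD). Qed.
Lemma ddl a x : dd (la a x) = la a (dd x). Proof. exact: (dgb_dl (dg_ax X)). Qed.
Lemma ddZ (c : k) x : dd (c *: x) = c *: dd x.
Proof. by rewrite !scale_la ddl. Qed.
Lemma ddd x : dd (dd x) = 0. Proof. exact: (dgb_dd (dg_ax X)). Qed.
Lemma ddr i x b : x \in hh X i ->
  dd (ra x b) = ra (dd x) b + sg i *: ra x (diff b).
Proof. exact: (dgb_leib (dg_ax X)). Qed.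

Definition cyc i x : Prop := x \in hh X i /\ dd x = 0.
Definition bnd i x : Prop := exists2 y, y \in hh X (i - 1) & x = dd y.
Lemma cyc0 i : cyc i 0. Proof. by split; [exact: hh0|exact: dd0]. Qed.
Lemma cycD i x y : cyc i x -> cyc i y -> cyc i (x + y).
Proof. by move=> [hx dx] [hy dy]; split; rewrite ?hhD // ddD dx dy addr0. Qed.
Lemma cycZ i (c : k) x : cyc i x -> cyc i (c *: x).
Proof. by move=> [hx dx]; split; rewrite ?hhZ // ddZ dx scaler0. Qed.
Lemma cycN i x : cyc i x -> cyc i (- x).
Proof. by rewrite -scaleN1r; exact: cycZ. Qed.
Lemma cycB i x y : cyc i x -> cyc i y -> cyc i (x - y).
Proof. by move=> cx cy; apply/cycD/cycN. Qed.
Lemma cycl i a x : cyc i x -> cyc i (la a x).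
Proof. by move=> [hx dx]; split; rewrite ?hhl // ddl dx la0. Qed.
Lemma cycr i j x b : cyc i x -> b \in homog B j -> diff b = 0 -> cyc (i + j) (ra x b).
Proof.
move=> [hx dx] hb db; split; first exact: hhr.
by rewrite (ddr _ hx) dx db ra0 ra0r scaler0 addr0.
Qed.
Lemma bnd_dd i y : y \in hh X i -> bnd (i + 1) (dd y).
Proof. by move=> hy; exists y; rewrite ?addrK. Qed.
Lemma bnd0 i : bnd i 0. Proof. by exists 0; rewrite ?hh0 ?dd0. Qed.
Lemma bndD i x y : bnd i x -> bnd i y -> bnd i (x + y).
Proof. by move=> [u hu ->] [v hv ->]; exists (u + v); rewrite ?hhD ?ddD. Qed.
Lemma bndZ i (c : k) x : bnd i x -> bnd i (c *: x).
Proof. by move=> [u hu ->]; exists (c *: u); rewrite ?hhZ ?ddZ. Qed.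
Lemma bndN i x : bnd i x -> bnd i (- x).
Proof. by rewrite -scaleN1r; exact: bndZ. Qed.
Lemma bndB i x y : bnd i x -> bnd i y -> bnd i (x - y).
Proof. by move=> bx bY; apply/bndD/bndN. Qed.
Lemma bndl i a x : bnd i x -> bnd i (la a x).
Proof. by move=> [u hu ->]; exists (la a u); rewrite ?hhl ?ddl. Qed.
Lemma bndr i j x b : bnd i x -> b \in homog B j -> diff b = 0 ->
  bnd (i + j) (ra x b).
Proof.
move=> [u hu ->] hb db; exists (ra u b); first by have := hhr hu hb; rewrite addrAC.
by rewrite (ddr _ hu) db ra0r scaler0 addr0.
Qed.
(** Together with bndr this makes the cohomology of X a right module over that of
    B. *)
Lemma bndrr i j x b : cyc i x -> b \in homog B (j - 1) -> bnd (i + j) (ra x (diff b)).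
Proof.
move=> [hx dx] hb; exists (sg i *: ra x b).
  by apply: hhZ; rewrite -addrA; exact: hhr.
by rewrite ddZ (ddr _ hx) dx ra0 add0r scalerA sgK scale1r.
Qed.
Lemma bnd_sym i x y : bnd i (x - y) -> bnd i (y - x).
Proof. by move/bndN; rewrite opprB. Qed.
Lemma bnd_trans i y x z : bnd i (x - y) -> bnd i (y - z) -> bnd i (x - z).
Proof. by move=> b1 b2; have := bndD b1 b2; rewrite addrA subrK. Qed.

End Theory.

Arguments cyc : clear implicits.
Arguments bnd : clear implicits.

Record dgmor (X Y : dgbim) (f : X -> Y) : Prop := {
  dgm_b : bmap f;
  dgm_h : forall i x, x \in hh X i -> f x \in hh Y i;
  dgm_d : forall x, f (dd x) = dd (f x)
}.

Definition null (X Y : dgbim) (f : X -> Y) : Prop := exists u : X -> Y,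
  [/\ bmap u, forall i x, x \in hh X i -> u x \in hh Y (i - 1)
    & forall x, f x = dd (u x) + u (dd x)].

Section Morphisms.
Variables (X Y Z : dgbim).

Lemma dgm_cyc (f : X -> Y) i x : dgmor f -> cyc X i x -> cyc Y i (f x).
Proof.
move=> [fb fh fd] [hx dx]; split; first exact: fh.
by rewrite -fd dx (addmap0 (bmapD fb)).
Qed.

Lemma dgm_bnd (f : X -> Y) i x : dgmor f -> bnd X i x -> bnd Y i (f x).
Proof. by move=> [fb fh fd] [y hy ->]; exists (f y); [exact: fh|exact: fd]. Qed.

Lemma dgmor_comp (g : Y -> Z) (f : X -> Y) : dgmor g -> dgmor f -> dgmor (g \o f).
Proof.
move=> [gb gh gd] [fb fh fd]; split; first exact: bmap_comp.
  by move=> i x hx; apply: gh; exact: fh.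
by move=> x /=; rewrite fd gd.
Qed.

End Morphisms.

Section Shift.
Variables (X : dgbim) (n : int).

Lemma shift_ax : @is_dgbim X (fun x => sg n *: dd x) (fun i => hh X (i + n)).
Proof.
split.
- split; first by move=> i; exact: hh_sub.
    move=> x; have [s [f [us fh ->]]] := direct_spanned (dgb_dir (dg_ax X)) x.
    exists [seq i - n | i <- s], (fun i => f (i + n)); split=> // .
    by rewrite big_map; apply: eq_bigr => i _; rewrite subrK.
  move=> s f us fh sf i si.
  have := dir_free (dgb_dir (dg_ax X)) (s := [seq i + n | i <- s]) (f := fun i => f (i - n)).
  move=> /(_ _ _ _ (i + n)); rewrite addrK; apply.
  + by rewrite map_inj_uniq //; exact: addIr.
  + by move=> j; have := fh (j - n); rewrite subrK.
  + by rewrite big_map -[RHS]sf; apply: eq_bigr => j _; rewrite addrK.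
  + by apply/mapP; exists i.
- by move=> i a x; exact: hhl.
- by move=> i j x b hx hb; rewrite addrAC; exact: hhr.
- by move=> x y; rewrite ddD scalerDr.
- by move=> a x; rewrite ddl laZ.
- by move=> i x hx; apply: hhZ; rewrite addrAC; exact: hhd.
- by move=> x; rewrite ddZ ddd !scaler0.
- move=> i x b hx; rewrite (ddr _ hx) scalerDr raZ; congr (_ + _).
  by rewrite scalerA sgD mulrC -mulrA sgK mulr1.
Qed.

Definition shift : dgbim := DGBim shift_ax.

Lemma shift_ddE (x : shift) : dd x = sg n *: dd (x : X). Proof. by []. Qed.
Lemma shift_hhE i : hh shift i = hh X (i + n). Proof. by []. Qed.

Lemma shift_cyc i x : cyc shift i x <-> cyc X (i + n) x.
Proof.
split=> [[hx dx]|[hx dx]]; split=> //.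
  by have := congr1 (fun y : X => sg n *: y) dx; rewrite shift_ddE scalerA sgK scale1r scaler0.
by rewrite shift_ddE dx scaler0.
Qed.

Lemma shift_bnd i x : bnd shift i x <-> bnd X (i + n) x.
Proof.
split=> [[y hy ->]|[y hy ->]].
  exists (sg n *: (y : X)); last by rewrite ddZ.
  by apply: hhZ; rewrite addrAC; exact: hy.
have hy' : sg n *: y \in hh X (i - 1 + n) by apply: hhZ; rewrite addrAC.
exists (sg n *: y); first exact: hy'.
by rewrite shift_ddE ddZ scalerA sgK scale1r.
Qed.

End Shift.

Section Cone.
Variables (Y X : dgbim) (f : Y -> X).
Hypothesis fm : dgmor f.

Definition cone_l a (p : X * Y) : X * Y := (la a p.1, la a p.2).
Definition cone_r (p : X * Y) b : X * Y := (ra p.1 b, ra p.2 b).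

Lemma cone_is_bimod : is_bimod (L := L) (R := B) (V := (X * Y)%type) cone_l cone_r.
Proof.
split; rewrite /addmap /cone_l /cone_r => *; rewrite -?surjective_pairing;
  (try by apply: injective_projections => /=;
  rewrite ?(laDl, laD, laZl, la1, laM, raD, raDr, raZr, ra1, raM, la_ra)).
Qed.

Definition cone_bimod : bimod L B := Bimod cone_is_bimod.

Definition cone_d (p : cone_bimod) : cone_bimod := (dd p.1 + f p.2, - dd p.2).
Definition cone_h (i : int) : {pred cone_bimod} :=
  fun p => (p.1 \in hh X i) && (p.2 \in hh Y (i + 1)).

Lemma cone_hP i (p : cone_bimod) :
  p \in cone_h i <-> p.1 \in hh X i /\ p.2 \in hh Y (i + 1).
Proof. by split=> [/andP|[h1 h2]] //; apply/andP. Qed.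

Lemma pair_sum1 J (r : seq J) (P : pred J) (F : J -> cone_bimod) :
  (\sum_(j <- r | P j) F j).1 = \sum_(j <- r | P j) (F j).1.
Proof. exact: (big_morph (fun p : cone_bimod => p.1)). Qed.
Lemma pair_sum2 J (r : seq J) (P : pred J) (F : J -> cone_bimod) :
  (\sum_(j <- r | P j) F j).2 = \sum_(j <- r | P j) (F j).2.
Proof. exact: (big_morph (fun p : cone_bimod => p.2)). Qed.

Lemma cone_sub i : submod_closed (cone_h i).
Proof.
split; first by apply/cone_hP; rewrite !hh0.
by move=> c p q /cone_hP [p1 p2] /cone_hP [q1 q2]; apply/cone_hP; rewrite !hhD // hhZ.
Qed.

Lemma cone_ax : is_dgbim cone_d cone_h.
Proof.
have fD := bmapD (dgm_b fm).
split.
- apply: direct_intro; first exact: cone_sub.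
    move=> p; have -> : p = ((p.1, 0) : cone_bimod) + ((0, p.2) : cone_bimod).
      by apply: injective_projections; rewrite /= ?addr0 ?add0r.
    apply: (spannedD cone_sub).
      have [s [g [us gh ->]]] := direct_spanned (dgb_dir (dg_ax X)) p.1.
      exists s, (fun i => (g i, 0)); split=> // [i|]; first by apply/cone_hP; rewrite hh0 gh.
      by apply: injective_projections; rewrite ?pair_sum1 ?pair_sum2 //= [RHS]big1.
    have [s [g [us gh ->]]] := direct_spanned (dgb_dir (dg_ax Y)) p.2.
    exists [seq i - 1 | i <- s], (fun i => (0, g (i + 1))); split=> //.
    + by rewrite map_inj_uniq //; exact: addIr.
    + by move=> i; apply/cone_hP; rewrite hh0 gh.
    + rewrite big_map; apply: injective_projections.
        by rewrite pair_sum1 [RHS]big1.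
      by rewrite pair_sum2; apply: eq_bigr => i _ /=; rewrite subrK.
  move=> s g us gh sg0 i si; apply: injective_projections.
    have := congr1 (fun p : cone_bimod => p.1) sg0; rewrite pair_sum1 => s1.
    by apply: (dir_free (dgb_dir (dg_ax X)) us _ s1) => // j; case/cone_hP: (gh j).
  have := congr1 (fun p : cone_bimod => p.2) sg0; rewrite pair_sum2 => s2.
  apply: (dir_free (dgb_dir (shift_ax Y 1)) us _ s2) => // j; by case/cone_hP: (gh j).
- by move=> i a p /cone_hP [p1 p2]; apply/cone_hP; rewrite !hhl.
- by move=> i j p b /cone_hP [p1 p2] hb; apply/cone_hP; rewrite addrAC !hhr.
- move=> p q; apply: injective_projections => /=; last by rewrite ddD opprD.
  by rewrite ddD fD addrACA.
- move=> a p; apply: injective_projections => /=; last by rewrite ddl laN.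
  by rewrite ddl (bmap_la (dgm_b fm)) laD.
- move=> i p /cone_hP [p1 p2]; apply/cone_hP; split=> /=.
    by rewrite hhD ?hhd // (dgm_h fm).
  by rewrite hhN // hhd.
- move=> p; apply: injective_projections => /=; last by rewrite ddN ddd !oppr0.
  by rewrite ddD ddd add0r (addmapN fD) (dgm_d fm) subrr.
- move=> i p b /cone_hP [p1 p2]; apply: injective_projections => /=.
    by rewrite (ddr _ p1) (bmap_ra (dgm_b fm)) raD addrAC.
  by rewrite (ddr _ p2) raN opprD sg1D scaleNr opprK.
Qed.

Definition mcone : dgbim := DGBim cone_ax.

Lemma cone_ddE (p : mcone) : dd p = (dd p.1 + f p.2, - dd p.2) :> X * Y. Proof. by []. Qed.
Lemma cone_hhP i (p : mcone) :
  p \in hh mcone i <-> p.1 \in hh X i /\ p.2 \in hh Y (i + 1).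
Proof. exact: cone_hP. Qed.

End Cone.

(** Direct sums of shifted copies of X; the shift of the n-th copy by w n comes with
    the usual sign on its differential. *)
Section DSum.
Variables (I : choiceType) (X : dgbim) (w : I -> int).

Lemma dsum_d0 i : sg (w i) *: dd (0 : X) = 0. Proof. by rewrite dd0 scaler0. Qed.

Definition dsum_d (f : fs_bimod I X) : fs_bimod I X :=
  fsmap (h := fun i x => sg (w i) *: dd (x : X)) dsum_d0 f.

Definition dsum_h (i : int) : {pred fs_bimod I X} :=
  fun f => `[< forall n, fsval f n \in hh X (i - w n) >].

Lemma dsum_hP i (f : fs_bimod I X) :
  f \in dsum_h i <-> forall n, fsval f n \in hh X (i - w n).
Proof. by split=> [/asboolP|?] //; apply/asboolP. Qed.

Lemma dsum_sub i : submod_closed (dsum_h i).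
Proof.
split; first by apply/dsum_hP => n; exact: hh0.
by move=> c f g /dsum_hP hf /dsum_hP hg; apply/dsum_hP => n; apply: hhD; [apply: hhZ; exact: hf|exact: hg].
Qed.

Lemma delta_dsum_h n i x : x \in hh X (i - w n) -> (delta n x : fs_bimod I X) \in dsum_h i.
Proof.
by move=> hx; apply/dsum_hP => j /=; case: eqP => [->|_] //; exact: hh0.
Qed.

Lemma dsum_ax : is_dgbim dsum_d dsum_h.
Proof.
split.
- apply: direct_intro; first exact: dsum_sub.
    move=> f; have [s _ ->] := fs_delta f; apply: (spanned_sum dsum_sub) => n _.
    have [t [g [ut gh ->]]] := direct_spanned (dgb_dir (dg_ax X)) (f n).
    rewrite (addmap_sum (@deltaD _ _ _ n)).
    apply: (spanned_sum dsum_sub) => i _; apply: (spanned_homog dsum_sub (i := i + w n)).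
    by apply: delta_dsum_h; rewrite addrK.
  move=> s g us gh sg0 i si; apply: fsP => n.
  have := congr1 (fun f : fs_bimod I X => fsval f n) sg0; rewrite fs_sumE => s1.
  apply: (dir_free (dgb_dir (shift_ax X (- w n))) us _ s1) => // j.
  by move/dsum_hP: (gh j).
- by move=> i a f /dsum_hP hf; apply/dsum_hP => n; rewrite fs_laE hhl.
- by move=> i j f b /dsum_hP hf hb; apply/dsum_hP => n; rewrite fs_raE addrAC hhr.
- by move=> f g; apply: fsP => n; rewrite fsDE /= ddD scalerDr.
- by move=> a f; apply: fsP => n; rewrite fs_laE /= ddl laZ.
- move=> i f /dsum_hP hf; apply/dsum_hP => n /=.
  by apply: hhZ; rewrite addrAC; exact: hhd.
- by move=> f; apply: fsP => n /=; rewrite ddZ ddd !scaler0.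
- move=> i f b /dsum_hP hf; apply: fsP => n.
  rewrite fsDE fsZE !fs_raE /= (ddr _ (hf n)) scalerDr raZ; congr (_ + _).
  by rewrite scalerA sgD sgN mulrC -mulrA sgK mulr1.
Qed.

Definition dsum : dgbim := DGBim dsum_ax.

Lemma dsum_ddE (f : dsum) n : fsval (dd f) n = sg (w n) *: dd (fsval f n).
Proof. by []. Qed.
Lemma dsum_hhP i (f : dsum) :
  f \in hh dsum i <-> forall n, fsval f n \in hh X (i - w n).
Proof. exact: dsum_hP. Qed.

End DSum.

End DGBim.

Arguments hh {k L B} X i : rename.
Arguments cyc {k L B} X i x : rename.
Arguments bnd {k L B} X i x : rename.

(** * Cohomology concentrated in multiples of m *)

Section Data.
Variables (k : fieldType) (L : algebra k) (B : dgAlgebra k) (m : nat).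
Local Notation sg := (sg k).

Definition bcyc (i : int) (x : B) : Prop := x \in homog B i /\ diff x = 0.
Definition bbnd (i : int) (x : B) : Prop := exists2 y, y \in homog B (i - 1) & x = diff y.

(** What is retained of an isomorphism of the cohomology of B with the Laurent
    polynomials over L: q sends a cocycle of degree 0 to its class in L, and t and t'
    are cocycles representing the variable and its inverse. *)
Record laurent_like (q : B -> L) (t t' : B) : Prop := {
  qZD : forall (c : k) x y, bcyc 0 x -> bcyc 0 y -> q (c *: x + y) = c *: q x + q y;
  q1 : q 1 = 1;
  qM : forall x y, bcyc 0 x -> bcyc 0 y -> q (x * y) = q x * q y;
  q_eq0 : forall x, bcyc 0 x -> (q x = 0 <-> bbnd 0 x);
  q_surj : forall a, exists2 x, bcyc 0 x & q x = a;
  b_conc : forall i x, ~~ (m%:Z %| i)%Z -> bcyc i x -> bbnd i x;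
  t_cyc : bcyc m t;
  t'_cyc : bcyc (- m%:Z) t';
  tt' : bbnd 0 (1 - t * t');
  t't : bbnd 0 (1 - t' * t);
  q_conj : forall x, bcyc 0 x -> q (t * x * t') = q x
}.

Lemma bcyc0 i : bcyc i 0. Proof. by split; [exact: homog0|exact: diff0]. Qed.
Lemma bcyc1 : bcyc 0 1. Proof. by split; [exact: homog1|exact: diff1]. Qed.
Lemma bcycZ i (c : k) x : bcyc i x -> bcyc i (c *: x).
Proof. by move=> [hx dx]; split; [exact: homogZ|rewrite diffZ dx scaler0]. Qed.
Lemma bcycM i j x y : bcyc i x -> bcyc j y -> bcyc (i + j) (x * y).
Proof.
move=> [hx dx] [hy dy]; split; first exact: homogM.
by rewrite (diffM _ hx) dx dy mul0r !mulr0 addr0.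
Qed.

Lemma bbndMl i j (x y : B) : bbnd i x -> bcyc j y -> bbnd (i + j) (x * y).
Proof.
move=> [u hu ->] [hy dy]; exists (u * y); first by rewrite addrAC; exact: homogM.
by rewrite (diffM _ hu) dy !mulr0 addr0.
Qed.

Lemma bbndMr i j (x y : B) : bcyc i x -> bbnd j y -> bbnd (i + j) (x * y).
Proof.
move=> [hx dx] [u hu ->]; exists (sg i *: (x * u)).
  by apply: homogZ; rewrite -addrA; exact: homogM.
by rewrite diffZ (diffM _ hx) dx mul0r add0r sg_mul scalerA sgK scale1r.
Qed.

Lemma bbndD i (x y : B) : bbnd i x -> bbnd i y -> bbnd i (x + y).
Proof. by move=> [u hu ->] [v hv ->]; exists (u + v); rewrite ?homogD ?diffD. Qed.

Lemma bbnd_unit i (b c : B) : bcyc i b -> bbnd 0 (1 - c) -> bbnd i (b * c) -> bbnd i b.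
Proof.
move=> cb c1 bc; rewrite -[b](subrK (b * c)); apply: bbndD => //.
by rewrite -{1}[b]mulr1 -mulrBr -[i]addr0; exact: bbndMr.
Qed.

Lemma cycr0 (X : dgbim L B) i x b : cyc X i x -> bcyc 0 b -> cyc X i (ra x b).
Proof. by move=> cx [hb db]; rewrite -[i]addr0; exact: cycr. Qed.
Lemma bndr0 (X : dgbim L B) i x b : bnd X i x -> bcyc 0 b -> bnd X i (ra x b).
Proof. by move=> cx [hb db]; rewrite -[i]addr0; exact: bndr. Qed.

(** Cohomology concentrated in the degrees i with m dividing i + s.  Morphisms of
    nonzero degree s will be handled as morphisms of degree 0 into a shift, which
    changes s. *)
Definition conc (s : int) (X : dgbim L B) : Prop :=
  forall i x, ~~ (m%:Z %| i + s)%Z -> cyc X i x -> bnd X i x.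

Variables (q : B -> L) (t t' : B).
Hypothesis qt : laurent_like q t t'.

Lemma q0 : q 0 = 0.
Proof. by apply/(q_eq0 qt); [exact: bcyc0|exists 0; rewrite ?homog0 ?diff0]. Qed.
Lemma qD x y : bcyc 0 x -> bcyc 0 y -> q (x + y) = q x + q y.
Proof. by move=> cx cy; have := qZD qt 1 cx cy; rewrite !scale1r. Qed.
Lemma qZ (c : k) x : bcyc 0 x -> q (c *: x) = c *: q x.
Proof. by move=> cx; have := qZD qt c cx (bcyc0 0); rewrite q0 !addr0. Qed.
Lemma q_sum J (r : seq J) (F : J -> B) : (forall j, bcyc 0 (F j)) ->
  q (\sum_(j <- r) F j) = \sum_(j <- r) q (F j).
Proof.
move=> Fc; suff [] : bcyc 0 (\sum_(j <- r) F j) /\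
  q (\sum_(j <- r) F j) = \sum_(j <- r) q (F j) by [].
apply: (big_rec2 (fun x y => bcyc 0 x /\ q x = y)) => [|j x y _ [cy <-]].
  by split; [exact: bcyc0|exact: q0].
split; last exact: qD.
by have [h1 d1] := Fc j; have [h2 d2] := cy; split; rewrite ?homogD ?diffD ?d1 ?d2 ?addr0.
Qed.

Section Periodicity.
Variable X : dgbim L B.

Lemma cyc_t i x : cyc X i x -> cyc X (i + m) (ra x t).
Proof. by case: (t_cyc qt) => ht dt cx; exact: cycr. Qed.
Lemma cyc_t' i x : cyc X i x -> cyc X (i - m%:Z) (ra x t').
Proof. by case: (t'_cyc qt) => ht dt cx; exact: cycr. Qed.
Lemma bnd_t i x : bnd X i x -> bnd X (i + m) (ra x t).
Proof. by case: (t_cyc qt) => ht dt cx; exact: bndr. Qed.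
Lemma bnd_t' i x : bnd X i x -> bnd X (i - m%:Z) (ra x t').
Proof. by case: (t'_cyc qt) => ht dt cx; exact: bndr. Qed.

Lemma bnd_ra1 i x b : cyc X i x -> bbnd 0 (1 - b) -> bnd X i (x - ra x b).
Proof.
move=> cx [y hy yb]; rewrite -{1}(ra1 x) -raBr yb -[i]addr0; exact: bndrr.
Qed.

Lemma tt'_bnd i x : cyc X i x -> bnd X i (x - ra (ra x t) t').
Proof. by move=> cx; rewrite -raM; apply: bnd_ra1 => //; exact: tt' qt. Qed.
Lemma t't_bnd i x : cyc X i x -> bnd X i (x - ra (ra x t') t).
Proof. by move=> cx; rewrite -raM; apply: bnd_ra1 => //; exact: t't qt. Qed.

Lemma bnd_tI i x : cyc X i x -> bnd X (i + m) (ra x t) -> bnd X i x.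
Proof.
move=> cx /bnd_t'; rewrite addrK => b1.
by rewrite -[x](subrK (ra (ra x t) t')); apply: bndD b1; exact: tt'_bnd.
Qed.
Lemma bnd_t'I i x : cyc X i x -> bnd X (i - m%:Z) (ra x t') -> bnd X i x.
Proof.
move=> cx /bnd_t; rewrite subrK => b1.
by rewrite -[x](subrK (ra (ra x t') t)); apply: bndD b1; exact: t't_bnd.
Qed.

End Periodicity.

Lemma int_period (Q : int -> Prop) : Q 0 ->
  (forall i, Q i -> Q (i + m)) -> (forall i, Q i -> Q (i - m%:Z)) ->
  forall i, (m%:Z %| i)%Z -> Q i.
Proof.
move=> Q0 Qp Qn i /dvdzP [n ->].
elim/int_rec: n => [|n IH|n IH]; first by rewrite mul0r.
  by rewrite -addn1 PoszD mulrDl mul1r; exact: Qp.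
by rewrite -addn1 PoszD opprD mulrDl mulN1r; exact: Qn.
Qed.

Definition injH (X Y : dgbim L B) (f : X -> Y) (i : int) : Prop :=
  forall x, cyc X i x -> bnd Y i (f x) -> bnd X i x.
Definition surjH (X Y : dgbim L B) (f : X -> Y) (i : int) : Prop :=
  forall y, cyc Y i y -> exists2 x, cyc X i x & bnd Y i (y - f x).

(** Multiplication by t identifies the cohomology in degrees i and i + m, so for
    concentrated objects degree 0 decides about all degrees. *)
Lemma injH_all (X Y : dgbim L B) (f : X -> Y) : conc 0 X -> dgmor f ->
  injH f 0 -> forall i, injH f i.
Proof.
move=> Xc fm f0 i; have fr := bmap_ra (dgm_b fm).
have [|mi] := boolP (m%:Z %| i)%Z; last by move=> x cx _; apply: Xc; rewrite ?addr0.
apply: int_period i => // i fi x cx bx.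
  apply: (bnd_t'I cx); rewrite addrK; apply: fi; first by have := cyc_t' cx; rewrite addrK.
  by rewrite fr; have := bnd_t' bx; rewrite addrK.
apply: (bnd_tI cx); rewrite subrK; apply: fi; first by have := cyc_t cx; rewrite subrK.
by rewrite fr; have := bnd_t bx; rewrite subrK.
Qed.

Lemma surjH_all (X Y : dgbim L B) (f : X -> Y) : conc 0 Y -> dgmor f ->
  surjH f 0 -> forall i, surjH f i.
Proof.
move=> Yc fm f0 i; have fr := bmap_ra (dgm_b fm).
have [|mi] := boolP (m%:Z %| i)%Z; last first.
  move=> y cy; exists 0; first exact: cyc0.
  by rewrite (addmap0 (bmapD (dgm_b fm))) subr0; apply: Yc; rewrite ?addr0.
apply: int_period i => // i fi y cy.
  have [|x cx bx] := fi (ra y t'); first by have := cyc_t' cy; rewrite addrK.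
  exists (ra x t); first exact: cyc_t.
  rewrite fr; apply: bnd_trans (t't_bnd cy) _; rewrite -raB; exact: bnd_t.
have [|x cx bx] := fi (ra y t); first by have := cyc_t cy; rewrite subrK.
exists (ra x t'); first exact: cyc_t'.
rewrite fr; apply: bnd_trans (tt'_bnd cy) _; rewrite -raB; exact: bnd_t'.
Qed.

(** H^0(X) presented by a bimodule M through a map on representatives, meaningful on
    cocycles of degree 0 only, so that no quotient has to be formed. *)
Record model (X : dgbim L B) (M : bimod L L) (al : X -> M) : Prop := {
  modD : forall x y, cyc X 0 x -> cyc X 0 y -> al (x + y) = al x + al y;
  mod_la : forall a x, cyc X 0 x -> al (la a x) = la a (al x);
  mod_ra : forall x b, cyc X 0 x -> bcyc 0 b -> al (ra x b) = ra (al x) (q b);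
  mod_eq0 : forall x, cyc X 0 x -> (al x = 0 <-> bnd X 0 x);
  mod_surj : forall v, exists2 x, cyc X 0 x & al x = v
}.

Section Model.
Variables (X : dgbim L B) (M : bimod L L) (al : X -> M).
Hypothesis mX : model al.

Lemma mod0 : al 0 = 0.
Proof. by apply/(mod_eq0 mX); [exact: cyc0|exact: bnd0]. Qed.
Lemma modN x : cyc X 0 x -> al (- x) = - al x.
Proof.
move=> cx; apply: (addrI (al x)); rewrite -(modD mX) ?subrr ?mod0 //; exact: cycN.
Qed.
Lemma modB x y : cyc X 0 x -> cyc X 0 y -> al (x - y) = al x - al y.
Proof. by move=> cx cy; rewrite (modD mX) ?modN //; exact: cycN. Qed.
Lemma mod_sum J (r : seq J) (F : J -> X) : (forall j, cyc X 0 (F j)) ->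
  al (\sum_(j <- r) F j) = \sum_(j <- r) al (F j).
Proof.
move=> Fc; suff [] : cyc X 0 (\sum_(j <- r) F j) /\
  al (\sum_(j <- r) F j) = \sum_(j <- r) al (F j) by [].
apply: (big_rec2 (fun x y => cyc X 0 x /\ al x = y)) => [|j x y _ [cy <-]].
  by split; [exact: cyc0|exact: mod0].
by split; [exact: cycD|exact: modD].
Qed.
Lemma mod_eq x y : cyc X 0 x -> cyc X 0 y -> (al x = al y <-> bnd X 0 (x - y)).
Proof.
move=> cx cy; split=> [xy|/(mod_eq0 mX (cycB cx cy))].
  by apply/(mod_eq0 mX (cycB cx cy)); rewrite modB // xy subrr.
by rewrite modB // => /eqP; rewrite subr_eq0 => /eqP.
Qed.

End Model.

(** The three properties that drive the construction.  Free objects are faithful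
    and full with respect to every Z; attaching cells loses some of this, in an
    amount that the vanishing property kills controls. *)
Definition faithful_to (X Z : dgbim L B) : Prop := forall f : X -> Z, dgmor f ->
  (forall x, cyc X 0 x -> bnd Z 0 (f x)) -> null f.
Definition full_to (X : dgbim L B) (M : bimod L L) (al : X -> M)
    (Z : dgbim L B) : Prop :=
  forall (N : bimod L L) (be : Z -> N), model be -> forall phi : M -> N, bmap phi ->
  exists2 f : X -> Z, dgmor f & forall x, cyc X 0 x -> be (f x) = phi (al x).
Definition kills (X : dgbim L B) (s : int) : Prop :=
  forall Z, conc s Z -> forall f : X -> Z, dgmor f -> null f.

Lemma faithful_kills (X : dgbim L B) (s : int) : (forall Z, faithful_to X Z) ->
  ~~ (m%:Z %| s)%Z -> kills X s.
Proof.
move=> fX ms Z Zc f fm; apply: fX => // x cx; apply: Zc; first by rewrite add0r.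
exact: dgm_cyc.
Qed.

Lemma conc_shift (X : dgbim L B) s n : conc s X -> conc (s + n) (shift X n).
Proof.
move=> Xc i x mi /shift_cyc cx; apply/shift_bnd; apply: Xc cx.
by rewrite -addrA [n + s]addrC.
Qed.

End Data.

(** * Free differential graded bimodules *)

Section FreeDG.
Variables (k : fieldType) (L : algebra k) (B : dgAlgebra k) (m : nat).
Variables (q : B -> L) (t t' : B).
Hypothesis qt : laurent_like m q t t'.
Variables (n : nat) (e : 'I_n -> L) (c : 'I_n -> L -> k).
Hypothesis ec : is_basis e c.
Local Notation sg := (sg k).
Local Notation LB := (one_bimod B ec).

Definition one_d (x : LB) : LB := [ffun i => diff (x i)].
Definition one_h (i : int) : {pred LB} := fun x => [forall j, x j \in homog B i].

Lemma one_hP i (x : LB) : x \in one_h i <-> forall j, x j \in homog B i.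
Proof. by split=> [/forallP|?] //; apply/forallP. Qed.

Lemma one_ax : is_dgbim one_d one_h.
Proof.
have hsub i : submod_closed (one_h i).
  split; first by apply/one_hP => j; rewrite ffunE homog0.
  move=> a x y /one_hP hx /one_hP hy; apply/one_hP => j.
  by rewrite !ffunE; apply: homogZD.
split.
- apply: direct_intro => //.
    move=> x; have -> : x = \sum_j [ffun l => if l == j then x j else 0].
      apply/ffunP => l; rewrite sum_ffunE (bigD1 l) //= ffunE eqxx big1 ?addr0 // => j.
      by rewrite ffunE eq_sym => /negPf ->.
    apply: spanned_sum => // j _.
    have [s [f [us fh ->]]] := direct_spanned (homog_direct B) (x j).
    exists s, (fun i => [ffun l => if l == j then f i else 0]); split=> // [i|].
      by apply/one_hP => l; rewrite ffunE; case: ifP; rewrite ?homog0.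
    apply/ffunP => l; rewrite sum_ffunE ffunE; case: ifP => lj.
      by apply: eq_bigr => i _; rewrite ffunE lj.
    by rewrite big1 // => i _; rewrite ffunE lj.
  move=> s f us fh s0 i si; apply/ffunP => j; rewrite ffunE.
  apply: (dir_free (homog_direct B) us (f := fun i => f i j)) => // [l|].
    by move/one_hP: (fh l).
  by have := congr1 (fun x : LB => x j) s0; rewrite sum_ffunE ffunE.
- move=> i a x /one_hP hx; apply/one_hP => j; rewrite ffunE.
  by apply: (dir_sum (@grading_sub _ _ _ (ga_axiom B))) => l _; exact: homogZ.
- move=> i j x b /one_hP hx hb; apply/one_hP => l; rewrite ffunE; exact: homogM.
- by move=> x y; apply/ffunP => j; rewrite !ffunE diffD.
- move=> a x; apply/ffunP => j; rewrite !ffunE (addmap_sum (@diffD _ B)).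
  by apply: eq_bigr => l _; rewrite diffZ ffunE.
- by move=> i x /one_hP hx; apply/one_hP => j; rewrite ffunE; exact: diff_homog.
- by move=> x; apply/ffunP => j; rewrite !ffunE diffK.
- move=> i x b /one_hP hx; apply/ffunP => j.
  by rewrite !ffunE (diffM _ (hx j)) sg_mul.
Qed.

Definition one_dg : dgbim L B := DGBim one_ax.

Variable I : choiceType.

Definition freeB : dgbim L B := dsum one_dg (fun _ : I => 0).
Definition gen (p : I) : freeB := free_gen B ec p.
Definition linB (Z : dgbim L B) (g : I -> Z) : freeB -> Z := lin (ec := ec) g.

Lemma freeB_hhP i (x : freeB) :
  x \in hh freeB i <-> forall p j, fsval x p j \in homog B i.
Proof.
split=> [/dsum_hhP hx p j|hx].
  by have := hx p; rewrite subr0 => /one_hP.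
by apply/dsum_hhP => p; rewrite subr0; apply/one_hP => j; exact: hx.
Qed.

Lemma freeB_ddE (x : freeB) p j : fsval (dd x) p j = diff (fsval x p j).
Proof. by rewrite dsum_ddE sg0 scale1r ffunE. Qed.

Lemma freeB_cycP i (x : freeB) : cyc freeB i x <-> forall p j, bcyc i (fsval x p j).
Proof.
split=> [[/freeB_hhP hx dx] p j|cx].
  by split=> //; rewrite -freeB_ddE dx fs0E ffunE.
split; first by apply/freeB_hhP => p j; case: (cx p j).
apply: fsP => p; apply/ffunP => j; rewrite freeB_ddE fs0E ffunE.
by case: (cx p j).
Qed.

Lemma freeB_bnd i (x : freeB) : (forall p j, bbnd i (fsval x p j)) -> bnd freeB i x.
Proof.
move=> bx.
pose R (_ : I) (u v : LB) := (forall j, v j \in homog B (i - 1)) /\ u = one_d v.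
have [p|p|y yP] := @fs_choice k I LB LB R x.
- have /choice [v vP] : forall j, exists y, y \in homog B (i - 1) /\ fsval x p j = diff y.
    by move=> j; have [y] := bx p j; exists y.
  exists [ffun j => v j]; split=> [j|].
    by rewrite ffunE; case: (vP j).
  by apply/ffunP => j; rewrite !ffunE; case: (vP j).
- split=> [j|]; first by rewrite ffunE homog0.
  by apply/ffunP => j; rewrite !ffunE diff0.
- exists y; first by apply/freeB_hhP => p; case: (yP p).
  by apply: fsP => p; apply/ffunP => j; rewrite freeB_ddE (yP p).2 ffunE.
Qed.

Lemma gen_cyc p : cyc freeB 0 (gen p).
Proof.
apply/freeB_cycP => r j; rewrite /gen /free_gen deltaE; case: eqP => _.
  by rewrite ffunE; apply: bcycZ; exact: bcyc1.
by rewrite ffunE; exact: bcyc0.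
Qed.

Lemma freeB_conc : conc m 0 freeB.
Proof.
move=> i x; rewrite addr0 => mi /freeB_cycP cx; apply: freeB_bnd => p j.
exact: (b_conc qt).
Qed.

Section Maps.
Variables (Z : dgbim L B) (g : I -> Z).

Lemma linB_bmap : bmap (linB g). Proof. exact: lin_bmap. Qed.
Lemma linBE (x : freeB) (s : seq I) : uniq s -> (forall p, p \notin s -> fsval x p = 0) ->
  linB g x = \sum_(p <- s) \sum_i la (e i) (ra (g p) (fsval x p i)).
Proof.
by move=> us x0; rewrite /linB /lin (fsumE _ us) // => p; exact: bmapD (one_lin_bmap ec _).
Qed.

Lemma linB_hh i j (x : freeB) : (forall p, g p \in hh Z i) ->
  x \in hh freeB j -> linB g x \in hh Z (i + j).
Proof.
move=> hg /freeB_hhP hx; have [s us x0] := fs_supp x.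
rewrite (linBE us) //; apply: (dir_sum (@hh_sub _ _ _ Z)) => p _.
by apply: (dir_sum (@hh_sub _ _ _ Z)) => l _; apply: hhl; apply: hhr.
Qed.

Lemma dd_linB i (x : freeB) : (forall p, g p \in hh Z i) ->
  dd (linB g x) = lin (ec := ec) (fun p => dd (g p)) x + sg i *: linB g (dd x).
Proof.
move=> hg; have [s us x0] := fs_supp x.
rewrite (linBE us) // dd_sum.
have -> : linB g (dd x) = \sum_(p <- s) \sum_i la (e i) (ra (g p) (fsval (dd x) p i)).
  by apply: linBE => // p /x0 xp; apply/ffunP => j; rewrite freeB_ddE xp !ffunE diff0.
rewrite /lin (fsumE _ us) //; last by move=> p; exact: bmapD (one_lin_bmap ec _).
rewrite scaler_sumr -big_split; apply: eq_bigr => p _ /=.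
rewrite dd_sum scaler_sumr -big_split; apply: eq_bigr => l _ /=.
by rewrite ddl (ddr _ (hg p)) laD laZ freeB_ddE.
Qed.

End Maps.

Lemma linB_dgmor (Z : dgbim L B) (g : I -> Z) : (forall p, cyc Z 0 (g p)) ->
  dgmor (linB g).
Proof.
move=> cg; split; first exact: linB_bmap.
  by move=> i x hx; rewrite -[i]add0r; apply: linB_hh => // p; case: (cg p).
move=> x; rewrite (@dd_linB _ _ 0) => [|p]; last by case: (cg p).
rewrite sg0 scale1r [X in _ = X + _](_ : _ = 0) ?add0r //.
apply/esym; have [s us x0] := fs_supp x.
rewrite /lin (fsumE _ us) //; last by move=> p; exact: bmapD (one_lin_bmap ec _).
by apply/esym; apply: big1 => p _; apply: big1 => l _; rewrite (cg p).2 ra0 la0.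
Qed.

(** Choosing primitives of the images of the generators gives the homotopy. *)
Lemma freeB_null (Z : dgbim L B) (f : freeB -> Z) : dgmor f ->
  (forall p, bnd Z 0 (f (gen p))) -> null f.
Proof.
move=> fm fb.
have /choice [y yP] : forall p, exists y, y \in hh Z (0 - 1) /\ f (gen p) = dd y.
  by move=> p; have [y] := fb p; exists y.
exists (linB y); split; first exact: linB_bmap.
  move=> i x hx; rewrite addrC -[- 1]add0r; apply: linB_hh => // p.
  by case: (yP p).
move=> x; rewrite (@dd_linB _ _ (0 - 1)) => [|p]; last by case: (yP p).
rewrite sub0r sgN sg1 scaleN1r subrK.
apply: (free_ext (ec := ec) (W := Z)); first exact: dgm_b fm.
  exact: lin_bmap.
by move=> p; rewrite lin_gen; case: (yP p).
Qed.

Lemma freeB_faithful (Z : dgbim L B) : faithful_to freeB Z.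
Proof. by move=> f fm f0; apply: freeB_null => // p; apply: f0; exact: gen_cyc. Qed.

Local Notation freeL := (free_bimod L ec I).

Lemma q_ffun0 (i : I) : [ffun j => q ((0 : LB) j)] = 0 :> one_bimod L ec.
Proof. by apply/ffunP => j; rewrite !ffunE (q0 qt). Qed.

Definition freeq (x : freeB) : freeL :=
  fsmap (h := fun _ (u : LB) => [ffun j => q (u j)] : one_bimod L ec) q_ffun0 x.

Lemma freeqE (x : freeB) p j : fsval (freeq x) p j = q (fsval x p j).
Proof. by rewrite /= ffunE. Qed.

Lemma freeq_model : model q (X := freeB) freeq.
Proof.
split.
- move=> x y /freeB_cycP cx /freeB_cycP cy; apply: fsP => p; apply/ffunP => j.
  by rewrite freeqE [in RHS]fsDE [RHS]ffunE !freeqE -(qD qt) // fsDE ffunE.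
- move=> a x /freeB_cycP cx; apply: fsP => p; apply/ffunP => j.
  rewrite freeqE !fs_laE !ffunE (q_sum qt) => [|l]; last exact: bcycZ.
  by apply: eq_bigr => l _; rewrite (qZ qt) // ffunE.
- move=> x b /freeB_cycP cx cb; apply: fsP => p; apply/ffunP => j.
  by rewrite freeqE !fs_raE !ffunE (qM qt).
- move=> x cx; have /freeB_cycP cx' := cx; split=> [x0|[y /freeB_hhP hy xy]].
    apply: freeB_bnd => p j; apply/(q_eq0 qt) => //.
    by rewrite -freeqE x0 fs0E ffunE.
  apply: fsP => p; apply/ffunP => j; rewrite freeqE fs0E ffunE.
  by apply/(q_eq0 qt) => //; exists (fsval y p j); rewrite // xy freeB_ddE.
- move=> v.
  pose R (_ : I) (a : one_bimod L ec) (u : LB) := forall j, bcyc 0 (u j) /\ q (u j) = a j.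
  have [p|p|x xP] := @fs_choice k I (one_bimod L ec) LB R v.
  + have /choice [u uP] : forall j, exists b, bcyc 0 b /\ q b = fsval v p j.
      by move=> j; have [b] := q_surj qt (fsval v p j); exists b.
    by exists [ffun j => u j] => j; rewrite ffunE.
  + by move=> j; rewrite !ffunE (q0 qt); split; first exact: bcyc0.
  + exists x; first by apply/freeB_cycP => p j; case: (xP p j).
    by apply: fsP => p; apply/ffunP => j; rewrite freeqE; case: (xP p j).
Qed.

(** A bimodule map out of the degree zero cohomology is realized by lifting the
    images of the generators to cocycles. *)
Lemma freeB_full (Z : dgbim L B) : full_to q freeq Z.
Proof.
move=> N be mZ phi phib.
have /choice [g gP] : forall p, exists z, cyc Z 0 z /\ be z = phi (free_gen L ec p).
  by move=> p; have [z] := mod_surj mZ (phi (free_gen L ec p)); exists z.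
have cg p : cyc Z 0 (g p) by case: (gP p).
exists (linB g); first exact: linB_dgmor.
move=> x cx; have /freeB_cycP cx' := cx; have [s us x0] := fs_supp x.
rewrite (lin_unique phib) (linBE _ us) // /lin (fsumE _ us).
- rewrite (mod_sum mZ) => [|p]; last first.
    elim: (index_enum _) => [|l r IH]; rewrite ?big_nil ?big_cons; first exact: cyc0.
    by apply: cycD IH; apply: cycl; exact: cycr0.
  apply: eq_bigr => p _; rewrite (mod_sum mZ) => [|l]; last first.
    by apply: cycl; exact: cycr0.
  apply: eq_bigr => l _; rewrite (mod_la mZ); last first.
    exact: cycr0.
  by rewrite (mod_ra mZ) // freeqE (gP p).2.
- by move=> p; exact: bmapD (one_lin_bmap ec _).
- by move=> p /x0 xp; apply/ffunP => j; rewrite freeqE xp !ffunE (q0 qt).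
Qed.

End FreeDG.

(** * Projective bimodules as cokernels of split injections *)

Section Swindle.
Variables (k : fieldType) (L : algebra k).
Variables (n : nat) (e : 'I_n -> L) (c : 'I_n -> L -> k).
Hypothesis ec : is_basis e c.
Variable P : bimod L L.
Hypothesis Pproj : forall (N : bimod L L) (g : N -> P), bmap g ->
  (forall y, exists x, g x = y) -> exists2 s : P -> N, bmap s & forall y, g (s y) = y.

Let I : choiceType := (nat * P)%type.
Local Notation Fr := (free_bimod L ec I).

(** Only free bimodules have an evident differential graded lift.  A projective P is
    the image of an idempotent E of a free bimodule F0, but an idempotent can only
    be lifted up to homotopy.  On a countable sum of copies of F0, leave the image
    of 1 - E in place and move the image of E from each copy to the next: this map
    tau is injective with retraction rho, and its cokernel is the image of E in
    copy number 0.  So P is the cokernel of a split injection of free bimodules,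
    and is realized by a cone. *)
Lemma eilenberg_swindle : exists (tau rho : Fr -> Fr) (pi : Fr -> P),
  [/\ bmap tau, bmap rho, bmap pi, forall x, rho (tau x) = x
    & (forall y, exists x, pi x = y) /\
      forall x, pi x = 0 <-> exists y, x = tau y].
Proof.
pose F0 := free_bimod L ec (P : choiceType).
pose g0 (p : P) : F0 := free_gen L ec p.
pose pi0 : F0 -> P := lin (ec := ec) id.
have pi0b : bmap pi0 by exact: lin_bmap.
have pi0g p : pi0 (g0 p) = p by exact: lin_gen.
have [|s sb pis] := Pproj pi0b; first by move=> y; exists (g0 y).
pose E x := s (pi0 x).
have Eb : bmap E by apply: (bmap_comp sb pi0b).
have EE x : E (E x) = E x by rewrite /E pis.
pose Q x := x - E x.
have Qb : bmap Q by apply: bmap_sub => //; exact: bmap_id.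
have EQ x : E (Q x) = 0 by rewrite /Q (addmapB (bmapD Eb)) EE subrr.
have QE x : Q (E x) = 0 by rewrite /Q EE subrr.
have QQ x : Q (Q x) = Q x by rewrite {1}/Q EQ subr0.
have pQ x : pi0 (Q x) = 0 by rewrite /Q (addmapB (bmapD pi0b)) /E pis subrr.
pose ins (i : nat) : F0 -> Fr := lin (ec := ec) (fun p => free_gen L ec (i, p) : Fr).
have insb i : bmap (ins i) by exact: lin_bmap.
have insg i p : ins i (g0 p) = free_gen L ec (i, p) by exact: lin_gen.
have ins0 i : ins i 0 = 0 by exact: addmap0 (bmapD (insb i)).
have insD i := bmapD (insb i).
(* ins i is the inclusion of copy number i; E and Q = 1 - E are complementary *)
pose tau0 i x : Fr := ins i (Q x) + ins i.+1 (E x).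
pose rho0 i x : Fr := ins i (Q x) + (if i is j.+1 then ins j (E x) else 0).
pose p0 (i : nat) x : P := if i is 0%N then pi0 x else 0.
have tau0b i : bmap (tau0 i).
  by apply: bmap_add; [exact: bmap_comp (insb _) Qb|exact: bmap_comp (insb _) Eb].
have zb (M N : bimod L L) : bmap (fun _ : M => 0 : N).
  by split=> [x y|a x|x a]; rewrite ?addr0 ?la0 ?ra0.
have rho0b i : bmap (rho0 i).
  apply: bmap_add; first exact: bmap_comp (insb _) Qb.
  by case: i => [|i]; [exact: zb|exact: bmap_comp (insb _) Eb].
have p0b i : bmap (p0 i) by case: i => [|i]; [exact: pi0b|exact: zb].
pose tau : Fr -> Fr := lin (ec := ec) (fun ip : I => tau0 ip.1 (g0 ip.2)).
pose rho : Fr -> Fr := lin (ec := ec) (fun ip : I => rho0 ip.1 (g0 ip.2)).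
pose pi : Fr -> P := lin (ec := ec) (fun ip : I => p0 ip.1 (g0 ip.2)).
have taub : bmap tau by exact: lin_bmap.
have rhob : bmap rho by exact: lin_bmap.
have pib : bmap pi by exact: lin_bmap.
have tau_ins i x : tau (ins i x) = tau0 i x.
  apply: (free_ext (ec := ec) (f := tau \o ins i)) => // [|p]; first exact: bmap_comp.
  by rewrite /= insg [LHS]lin_gen.
have rho_ins i x : rho (ins i x) = rho0 i x.
  apply: (free_ext (ec := ec) (f := rho \o ins i)) => // [|p]; first exact: bmap_comp.
  by rewrite /= insg [LHS]lin_gen.
have pi_ins i x : pi (ins i x) = p0 i x.
  apply: (free_ext (ec := ec) (f := pi \o ins i)) => // [|p]; first exact: bmap_comp.
  by rewrite /= insg [LHS]lin_gen.
have ext (N : bimod L L) (f g : Fr -> N) : bmap f -> bmap g ->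
    (forall i x, f (ins i x) = g (ins i x)) -> f =1 g.
  by move=> fb gb fg; apply: (free_ext (ec := ec)) => // -[i p]; rewrite -insg.
have QED x : Q x + E x = x by rewrite /Q subrK.
have rt x : rho (tau x) = x.
  apply: (ext _ (rho \o tau) id) => {x} [||i x]; [exact: bmap_comp|exact: bmap_id|].
  rewrite /= tau_ins /tau0 (bmapD rhob) !rho_ins /rho0 QQ EQ QE EE ins0 add0r.
  have -> : (if i is j.+1 then ins j 0 else 0) = 0 by case: (i).
  by rewrite addr0 -insD QED.
have one x : x = tau (rho x) + ins 0%N (s (pi x)).
  apply: (ext _ id (fun x => tau (rho x) + ins 0%N (s (pi x)))) => {x} [||i x].
  - exact: bmap_id.
  - apply: bmap_add; first exact: (bmap_comp taub rhob).
    exact: (bmap_comp (insb _) (bmap_comp sb pib)).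
  rewrite rho_ins pi_ins /rho0 (bmapD taub) tau_ins /tau0 QQ EQ ins0 addr0.
  case: i => [|i] /=.
    by rewrite (addmap0 (bmapD taub)) addr0 -[s _]/(E x) -insD QED.
  by rewrite tau_ins /tau0 QE EE ins0 add0r (addmap0 (bmapD sb)) ins0 addr0 -insD QED.
exists tau, rho, pi; split=> //; split=> [y|x].
  by exists (ins 0%N (g0 y)); rewrite pi_ins /p0 pi0g.
split=> [px|[y ->]].
  by exists (rho x); rewrite {1}[x]one px (addmap0 (bmapD sb)) ins0 addr0.
apply: (ext _ (pi \o tau) (fun=> 0)) => {x y} [||i x]; [exact: bmap_comp|exact: zb|].
rewrite /= tau_ins /tau0 (bmapD pib) !pi_ins /p0.
by case: (i); rewrite ?pQ addr0.
Qed.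

End Swindle.

(** * Attaching a cell *)

Section ConeNull.
Variables (k : fieldType) (L : algebra k) (B : dgAlgebra k).
Variables (Y X : dgbim L B) (f : Y -> X).
Hypothesis fm : dgmor f.
Local Notation C := (mcone fm).

Definition cone_inl (x : X) : C := ((x, 0) : X * Y).
Definition cone_inr (y : Y) : C := ((0, y) : X * Y).

Lemma cone_eqP (p r : C) : p.1 = r.1 -> p.2 = r.2 -> p = r.
Proof. exact: (@injective_projections X Y). Qed.


Lemma cone_eta (p : C) : p = cone_inl p.1 + cone_inr p.2.
Proof. by refine (cone_eqP _ _); rewrite /= ?addr0 ?add0r. Qed.

Lemma cone_inl_bmap : bmap cone_inl.
Proof.
by split=> [x y|a x|x b]; refine (cone_eqP _ _); rewrite /= ?addr0 ?la0 ?ra0.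
Qed.

Lemma cone_inl_dgmor : dgmor cone_inl.
Proof.
split; first exact: cone_inl_bmap.
  by move=> i x hx; apply/cone_hhP; split=> //; exact: hh0.
move=> x; rewrite cone_ddE; refine (cone_eqP _ _) => /=.
  by rewrite (addmap0 (bmapD (dgm_b fm))) addr0.
by rewrite dd0 oppr0.
Qed.

Lemma cone_inr_bmap : bmap cone_inr.
Proof.
by split=> [x y|a x|x b]; refine (cone_eqP _ _); rewrite /= ?addr0 ?la0 ?ra0.
Qed.

Lemma cone_inr_hh i y : y \in hh Y (i + 1) -> cone_inr y \in hh C i.
Proof. by move=> hy; apply/cone_hhP; split=> //; exact: hh0. Qed.

Lemma cone_inr_dd y : dd (cone_inr y) = cone_inl (f y) - cone_inr (dd y).
Proof.
by refine (cone_eqP _ _); rewrite cone_ddE /= ?dd0 ?add0r ?subr0.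
Qed.

Lemma cone_rep_bnd i (p : C) : cyc C i p -> bnd Y (i + 1) p.2 ->
  exists2 x, cyc X i x & bnd C i (p - cone_inl x).
Proof.
move=> [/cone_hhP [hx hy]]; rewrite cone_ddE => dp [y hy' yE].
have dx : dd p.1 + f p.2 = 0 := congr1 (fun z : X * Y => z.1) dp.
rewrite addrK in hy'.
exists (p.1 + f y).
  split; first by rewrite hhD // (dgm_h fm).
  by rewrite ddD -(dgm_d fm) -yE.
exists (cone_inr (- y)); first by apply: cone_inr_hh; rewrite subrK hhN.
rewrite {1}[p]cone_eta cone_inr_dd (bmapD cone_inl_bmap).
rewrite (addmapN (bmapD (dgm_b fm))) ddN (addmapN (bmapD cone_inl_bmap)).
rewrite (addmapN (bmapD cone_inr_bmap)) opprK -yE.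
by rewrite opprD addrACA subrr add0r addrC.
Qed.

(** Let u contract the restriction of F to the base X.  Subtracting the homotopy
    that extends u by zero replaces F by a homotopic map that vanishes on X, hence
    is a morphism from Y to the shift of Z by -1; if that one is null, so is F. *)
Section Reduce.
Variables (Z : dgbim L B) (F : C -> Z) (u : X -> Z).
Hypothesis Fm : dgmor F.
Hypothesis ub : bmap u.
Hypothesis uh : forall i x, x \in hh X i -> u x \in hh Z (i - 1).
Hypothesis Fu : forall x, F (cone_inl x) = dd (u x) + u (dd x).

Definition cell_map (y : Y) : shift Z (-1) := F (cone_inr y) - u (f y).

Lemma cell_map_dgmor : dgmor cell_map.
Proof.
have FD := bmapD (dgm_b Fm); split.
- apply: (@bmap_sub _ _ _ _ (shift Z (-1))); last exact: bmap_comp ub (dgm_b fm).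
  exact: bmap_comp (dgm_b Fm) cone_inr_bmap.
- move=> i y hy; rewrite shift_hhE; apply: hhB.
    by apply: (dgm_h Fm); apply: cone_inr_hh; rewrite subrK.
  by apply: uh; exact: (dgm_h fm).
- move=> y; rewrite shift_ddE sgN sg1 scaleN1r /cell_map ddB opprB.
  have -> : cone_inr (dd y) = cone_inl (f y) - dd (cone_inr y).
    by rewrite cone_inr_dd opprB addrC subrK.
  rewrite (addmapB FD) Fu (dgm_d Fm) (dgm_d fm).
  by rewrite addrAC addrK.
Qed.

Lemma cone_null : null cell_map -> null F.
Proof.
have FD := bmapD (dgm_b Fm).
move=> [v [vb vh vE]]; exists (fun p : C => u p.1 - v p.2); split.
- apply: bmap_sub; first exact: (@bmap_comp _ _ _ _ _ _ u (fun p : C => p.1)).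
  exact: (@bmap_comp _ _ _ C Y Z (v : Y -> Z) (fun p : C => p.2)).
- move=> i p /cone_hhP [p1 p2]; apply: hhB; first exact: uh.
  by have := vh _ _ p2; rewrite shift_hhE addrK.
- move=> p; rewrite {1}[p]cone_eta FD Fu cone_ddE /=.
  have -> : F (cone_inr p.2) = - dd (v p.2 : Z) + v (dd p.2) + u (f p.2).
    have := vE p.2; rewrite shift_ddE sgN sg1 scaleN1r /cell_map => /eqP.
    by rewrite subr_eq => /eqP.
  rewrite ddB (bmapD ub) (addmapN (bmapD vb)) opprK.
  by rewrite (AC (2*3) ((1*3)*(2*5*4))).
Qed.

End Reduce.

Lemma cone_faithful m Z : conc m 0 Z -> faithful_to X Z -> kills m Y (-1) ->
  faithful_to C Z.
Proof.
move=> Zc fX kY F Fm F0.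
have [x cx|u [ub uh uE]] := fX _ (dgmor_comp Fm cone_inl_dgmor).
  by apply: F0; exact: dgm_cyc cone_inl_dgmor _.
apply: (cone_null Fm ub uh uE); apply: kY; last exact: cell_map_dgmor.
by rewrite -[-1]add0r; exact: conc_shift.
Qed.

Lemma cone_kills m s : kills m X s -> kills m Y (s - 1) -> kills m C s.
Proof.
move=> kX kY Z Zc F Fm.
have [u [ub uh uE]] := kX _ Zc _ (dgmor_comp Fm cone_inl_dgmor).
apply: (cone_null Fm ub uh uE); apply: kY; last exact: cell_map_dgmor.
exact: conc_shift.
Qed.

(** The contraction of F on the base is only determined up to a morphism from X to
    the shift of Z by -1.  When f has a retraction r on degree zero cohomology,
    correcting it by the cell map composed with r makes the new cell map vanish on
    cohomology. *)
Lemma cone_faithful_split (r : X -> Y) Z : dgmor r ->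
  (forall y, cyc Y 0 y -> bnd Y 0 (y - r (f y))) ->
  faithful_to X Z -> faithful_to Y (shift Z (-1)) -> faithful_to C Z.
Proof.
move=> rm rf fX fY F Fm F0.
have [x cx|u0 [ub0 uh0 uE0]] := fX _ (dgmor_comp Fm cone_inl_dgmor).
  by apply: F0; exact: dgm_cyc cone_inl_dgmor _.
have h0m := cell_map_dgmor Fm ub0 uh0 uE0.
set h0 := cell_map F u0 in h0m.
pose u x := u0 x + (h0 (r x) : Z).
have hrm := dgmor_comp h0m rm.
have ub : bmap u.
  exact: (bmap_add ub0 (dgm_b hrm : @bmap _ _ _ X Z (fun x => h0 (r x)))).
have uh i x : x \in hh X i -> u x \in hh Z (i - 1).
  by move=> hx; apply: hhD; [exact: uh0|exact: (dgm_h hrm)].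
have uE x : F (cone_inl x) = dd (u x) + u (dd x).
  have := dgm_d hrm x; rewrite shift_ddE sgN sg1 scaleN1r /= => dx.
  by rewrite -[LHS]/((F \o cone_inl) x) uE0 /u dx ddD [RHS]addrACA subrr addr0.
apply: (cone_null Fm ub uh uE); apply: fY; first exact: cell_map_dgmor.
move=> y cy; have -> : cell_map F u y = h0 (y - r (f y)).
  by rewrite (addmapB (bmapD (dgm_b h0m))) /cell_map /u opprD addrA.
by apply: dgm_bnd h0m _; exact: rf.
Qed.

End ConeNull.

(** The cone of a map f that realizes an injection phi with cokernel pi.  As f is
    then injective on cohomology in every degree, the cohomology of the cone is the
    cokernel of that of f. *)
Section ConeModel.
Variables (k : fieldType) (L : algebra k) (B : dgAlgebra k) (m : nat).
Variables (q : B -> L) (t t' : B).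
Hypothesis qt : laurent_like m q t t'.
Variables (Y X : dgbim L B) (f : Y -> X).
Hypothesis fm : dgmor f.
Variables (K P M : bimod L L) (ka : Y -> K) (al : X -> P).
Hypotheses (mY : model q ka) (mX : model q al).
Hypotheses (cY : conc m 0 Y) (cX : conc m 0 X).
Variables (phi : K -> P) (pi : P -> M).
Hypothesis pib : bmap pi.
Hypothesis fphi : forall y, cyc Y 0 y -> al (f y) = phi (ka y).
Hypothesis phi_inj : forall v, phi v = 0 -> v = 0.
Hypothesis pi_surj : forall w, exists v, pi v = w.
Hypothesis pi_ker : forall v, pi v = 0 <-> exists w, v = phi w.
Local Notation C := (mcone fm).

Lemma attach_inj i : injH f i.
Proof.
move: i; apply: (injH_all qt cY fm) => y cy by0; apply/(mod_eq0 mY cy)/phi_inj.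
by rewrite -fphi //; apply/(mod_eq0 mX) => //; exact: dgm_cyc fm cy.
Qed.

Lemma cone_rep i (p : C) : cyc C i p -> exists2 x, cyc X i x & bnd C i (p - cone_inl fm x).
Proof.
move=> cp; have [/cone_hhP [hx hy]] := cp; rewrite cone_ddE => dp.
apply: cone_rep_bnd => //.
have dx : dd p.1 + f p.2 = 0 := congr1 (fun z : X * Y => z.1) dp.
have dy : dd p.2 = 0.
  by have := congr1 (fun z : X * Y => - z.2) dp; rewrite /= opprK oppr0.
apply: attach_inj; first by split.
exists (- p.1); first by rewrite addrK hhN.
by rewrite ddN; apply/eqP; rewrite -addr_eq0 addrC; apply/eqP.
Qed.

Lemma cone_conc : conc m 0 C.
Proof.
move=> i p mi cp; have [x cx bx] := cone_rep cp.
rewrite -[p](subrK (cone_inl fm x)); apply: (bndD bx).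
by apply: dgm_bnd (cone_inl_dgmor fm) _; exact: cX.
Qed.

Lemma cone_inl_bnd i x : bnd C i (cone_inl fm x) ->
  exists2 y, cyc Y i y & bnd X i (x - f y).
Proof.
move=> [p /cone_hhP [h1 h2]]; rewrite cone_ddE => pE.
have xE : x = dd p.1 + f p.2 := congr1 (fun z : X * Y => z.1) pE.
have dy : dd p.2 = 0.
  by have := congr1 (fun z : X * Y => - z.2) pE; rewrite /= opprK oppr0.
rewrite subrK in h2; exists p.2; first by split.
by exists p.1; rewrite // xE addrK.
Qed.

Lemma cone_model : exists ga : C -> M, model q ga /\
  forall p x, cyc C 0 p -> cyc X 0 x -> bnd C 0 (p - cone_inl fm x) -> ga p = pi (al x).
Proof.
have inlm := cone_inl_dgmor fm; have inlD := bmapD (dgm_b inlm).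
have wd x x' : cyc X 0 x -> cyc X 0 x' -> bnd C 0 (cone_inl fm (x - x')) ->
    pi (al x) = pi (al x').
  move=> cx cx' /cone_inl_bnd [y cy /(mod_eq mX (cycB cx cx') (dgm_cyc fm cy)) xy].
  apply/eqP; rewrite -subr_eq0 -(addmapB (bmapD pib)) -(modB mX) // xy fphi //.
  by apply/eqP/pi_ker; exists (ka y).
have /choice [r rP] : forall p : C, exists x, cyc C 0 p ->
    cyc X 0 x /\ bnd C 0 (p - cone_inl fm x).
  move=> p; have [cp|ncp] := EM (cyc C 0 p); last by exists 0.
  by have [x cx bx] := cone_rep cp; exists x.
have E p x : cyc C 0 p -> cyc X 0 x -> bnd C 0 (p - cone_inl fm x) ->
    pi (al (r p)) = pi (al x).
  move=> cp cx bx; have [cr br] := rP p cp; apply: wd => //.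
  rewrite (addmapB inlD); apply: bnd_trans _ bx; exact: bnd_sym.
exists (fun p => pi (al (r p))); split=> //; split.
- move=> p p' cp cp'; have [cr br] := rP p cp; have [cr' br'] := rP p' cp'.
  rewrite -(bmapD pib) -(modD mX) //; apply: E; [exact: cycD|exact: cycD|].
  by rewrite inlD opprD addrACA; exact: bndD.
- move=> a p cp; have [cr br] := rP p cp.
  rewrite -(bmap_la pib) -(mod_la mX) //; apply: E; [exact: cycl|exact: cycl|].
  by rewrite (bmap_la (dgm_b inlm)) -laB; exact: bndl.
- move=> p b cp cb; have [cr br] := rP p cp.
  rewrite -(bmap_ra pib) -(mod_ra mX) //; apply: E; [exact: cycr0|exact: cycr0|].
  by rewrite (bmap_ra (dgm_b inlm)) -raB; exact: bndr0.
- move=> p cp; have [cr br] := rP p cp; split=> [/pi_ker [v]|bp].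
    have [y cy <-] := mod_surj mY v; rewrite -fphi // => /(mod_eq mX cr (dgm_cyc fm cy)).
    move=> b1; rewrite -[p](subrK (cone_inl fm (r p))); apply: (bndD br).
    rewrite -[r p](subrK (f y)) inlD; apply: bndD; first exact: dgm_bnd inlm b1.
    exists (cone_inr fm y); first by apply: cone_inr_hh; rewrite subrK; case: cy.
    rewrite cone_inr_dd; case: cy => _ ->.
    by rewrite (addmap0 (bmapD (cone_inr_bmap fm))) subr0.
  rewrite (E _ 0 cp) ?(mod0 mX) ?(addmap0 (bmapD pib)) //; first exact: cyc0.
  by rewrite (addmap0 inlD) subr0.
- move=> w; have [v <-] := pi_surj w; have [x cx <-] := mod_surj mX v.
  exists (cone_inl fm x); first exact: dgm_cyc inlm cx.
  apply: E => //; first exact: dgm_cyc inlm cx.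
  by rewrite subrr; exact: bnd0.
Qed.

(** A map psi out of M lifts to g on X by composition with pi.  On cohomology g
    vanishes on the image of f, so faithfulness of Y provides a null homotopy of
    g \o f, and this is what is needed to extend g to the cone. *)
Lemma cone_full (ga : C -> M) (Z : dgbim L B) :
  (forall p x, cyc C 0 p -> cyc X 0 x -> bnd C 0 (p - cone_inl fm x) -> ga p = pi (al x)) ->
  faithful_to Y Z -> full_to q al Z -> full_to q ga Z.
Proof.
move=> gaE fY fX N be mZ psi psib.
have [g gm gE] := fX _ _ mZ _ (bmap_comp psib pib).
have [y cy|u [ub uh uE]] := fY _ (dgmor_comp gm fm).
  have cfy := dgm_cyc fm cy.
  apply/(mod_eq0 mZ); first exact: dgm_cyc gm cfy.
  rewrite /= gE //= fphi //.
  have -> : pi (phi (ka y)) = 0 by apply/pi_ker; exists (ka y).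
  exact: addmap0 (bmapD psib).
pose F (p : C) := g p.1 + u p.2.
have Fm : dgmor F.
  split.
  - apply: bmap_add; first exact: (@bmap_comp _ _ _ C X Z g (fun p : C => p.1)  (dgm_b gm)).
    exact: (@bmap_comp _ _ _ C Y Z u (fun p : C => p.2) ub).
  - move=> i p /cone_hhP [h1 h2]; apply: hhD; first exact: (dgm_h gm).
    by have := uh _ _ h2; rewrite addrK.
  - move=> p; rewrite /F cone_ddE /= (bmapD (dgm_b gm)) -/((g \o f) p.2) uE.
    by rewrite (addmapN (bmapD ub)) (dgm_d gm) ddD addrA addrK.
exists F => // p cp; have [x cx bx] := cone_rep cp.
rewrite (gaE _ _ cp cx bx) -[RHS]/((psi \o pi) (al x)) -gE //.
apply/(mod_eq mZ); [exact: dgm_cyc Fm cp|exact: dgm_cyc gm cx|].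
have -> : F p - g x = F (p - cone_inl fm x).
  rewrite (addmapB (bmapD (dgm_b Fm))) {3}/F /= (addmap0 (bmapD ub)).
  by rewrite addr0.
exact: dgm_bnd Fm bx.
Qed.

End ConeModel.

(** * Realizing bimodules of small projective dimension *)

Definition in_ker (k : fieldType) (U V : lmodType k) (f : U -> V) : {pred U} :=
  fun x => f x == 0.

Section Kernel.
Variables (k : fieldType) (L R : algebra k) (M N : bimod L R) (f : M -> N).
Hypothesis fb : bmap f.

Lemma ker_submod : submod_closed (in_ker f).
Proof.
split; first by apply/eqP; exact: addmap0 (bmapD fb).
by move=> c x y /eqP fx /eqP fy; apply/eqP; rewrite (bmapD fb) (bmapZ fb) fx fy scaler0 addr0.
Qed.

Record ker := Ker { kval :> M; _ : kval \in in_ker f }.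

HB.instance Definition _ := [isSub for kval].
HB.instance Definition _ := [Choice of ker by <:].
HB.instance Definition _ := GRing.isSubmodClosed.Build k M (in_ker f)
  (GRing.submod_closed_semi ker_submod).
HB.instance Definition _ := [SubChoice_isSubLmodule of ker by <:].

Lemma kvalP (x : ker) : f (kval x) = 0. Proof. by case: x => x /= /eqP. Qed.

Lemma ker_l a (x : ker) : la a (kval x) \in in_ker f.
Proof. by apply/eqP; rewrite (bmap_la fb) kvalP la0. Qed.
Lemma ker_r (x : ker) b : ra (kval x) b \in in_ker f.
Proof. by apply/eqP; rewrite (bmap_ra fb) kvalP ra0. Qed.

Lemma ker_is_bimod : @is_bimod k L R ker (fun a x => Ker (ker_l a x)) (fun x b => Ker (ker_r x b)).
Proof.
by split; rewrite /addmap => *; apply: val_inj => /=;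
  rewrite ?(laDl, laD, laZl, la1, laM, raD, raDr, raZr, ra1, raM, la_ra).
Qed.

Definition ker_bimod : bimod L R := Bimod ker_is_bimod.

End Kernel.

Section Convert.
Variables (k : fieldType) (L : algebra k).

Lemma morphism_bmap (M N : bimodule L) (f : M -> N) : bimodule_morphism f ->
  @bmap k L L (of_bimodule M) (of_bimodule N) f.
Proof.
move=> [fl fla fra]; split=> // x y.
by have := fl 1 x y; rewrite !scale1r.
Qed.

End Convert.

Section Tower.
Variables (k : fieldType) (L : algebra k) (B : dgAlgebra k) (m : nat).
Variables (q : B -> L) (t t' : B).
Hypothesis qt : laurent_like m q t t'.
Variables (n : nat) (e : 'I_n -> L) (c : 'I_n -> L -> k).
Hypothesis ec : is_basis e c.

(** The object is the cone of a lift of the split injection of free bimodules that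
    eilenberg_swindle provides. *)
Lemma projective_object (P : bimodule L) : projective_bimodule P ->
  exists (X : dgbim L B) (al : X -> of_bimodule P),
    [/\ conc m 0 X, model q al, forall Z, faithful_to X Z & forall Z, full_to q al Z].
Proof.
move=> Pp.
have [N g gb gs|tau [rho [pi [taub rhob pib rt [pis pik]]]]] :=
    @eilenberg_swindle k L n e c ec (of_bimodule P).
  have [|//|//|s [[sl sla sra] gsE]] := Pp (to_bimodule N) P g (fun x => x).
  - split; [|exact: (bmap_la gb)|exact: (bmap_ra gb)].
    by move=> a x y; rewrite (bmapD gb) (bmapZ gb).
  - exists s => //; split=> // x y.
    by have := sl 1 x y; rewrite !scale1r.
set I : choiceType := (nat * of_bimodule P)%type in tau rho pi taub rhob pib rt pis pik.
have mF := freeq_model qt ec I.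
have [tau1 tm tE] := freeB_full qt mF taub.
have [rho1 rm rE] := freeB_full qt mF rhob.
have cF := @freeB_conc k L B m q t t' qt n e c ec I.
have ti v : tau v = 0 -> v = 0.
  by move=> tv; rewrite -[v]rt tv (addmap0 (bmapD rhob)).
have [ga [mG gE]] := cone_model qt tm mF mF cF pib tE ti pis pik.
exists (mcone tm), ga; split=> //.
- exact (cone_conc qt mF mF cF cF tE ti).
- move=> Z; apply: (cone_faithful_split rm); [|exact: freeB_faithful|exact: freeB_faithful].
  move=> y cy; have cty := dgm_cyc tm cy; apply/(mod_eq mF) => //.
    exact: dgm_cyc rm cty.
  by rewrite rE // tE // rt.
- move=> Z; apply: (cone_full qt mF mF cF pib tE ti pik gE); [exact: freeB_faithful|].
  by move=> N be mZ phi phib; exact: freeB_full.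
Qed.

Lemma resolution_ker (M : bimodule L) l (P : nat -> bimodule L)
    (d : forall i, P i.+1 -> P i) (ep : P 0%N -> M)
    (eb : @bmap k L L (of_bimodule (P 0%N)) (of_bimodule M) ep) :
  projective_resolution l.+1 d ep -> projdim_le (to_bimodule (ker_bimod eb)) l.
Proof.
move=> [Pp [db _] es [e0 dE] Pz].
have kP (y : P 1%N) : d 0%N y \in in_ker ep.
  by apply/eqP/(e0 _).2; exists y.
have d0b := morphism_bmap (db 0%N).
exists (fun i => P i.+1), (fun i => d i.+1), 
  (fun y => @Ker k L L (of_bimodule (P 0%N)) (of_bimodule M) ep _ (kP y) : ker_bimod eb).
split=> [i||y||i li x]; rewrite ?(Pp i.+1) //.
- split; first by move=> i; exact: db.
  split=> [a x y|a y|y a]; apply: val_inj => /=.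
  + by rewrite (bmapD d0b) (bmapZ d0b).
  + exact: (bmap_la d0b).
  + exact: (bmap_ra d0b).
- have [x xE] := (e0 (kval y)).1 (kvalP y).
  by exists x; apply: val_inj.
- split=> [x|i x]; last exact: dE.
  split=> [xE|yE]; first by apply/dE; exact: (congr1 (@kval _ _ _ _ _ _) xE).
  by apply: val_inj => /=; apply/dE.
- exact: Pz.
Qed.

(** By induction on the length l of the resolution: the first syzygy K of M is
    realized by some Y, its inclusion into the projective P_0 by a map from Y to a
    realization of P_0, and M by the cone of that map.

    The obstructions vanish for degree reasons.  Realizing maps out of a tower of
    length l needs faithfulness of a tower of length l - 1, hence that every map
    from a tower of length l - 2 to the shift of Z by -1 is null.  Such a map is
    made of classes of Z in the degrees -1, ..., -(l - 1), and none of these is a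
    multiple of m as long as l <= m. *)
Lemma tower l : (l <= m)%N -> forall M : bimodule L, projdim_le M l ->
  exists (Y : dgbim L B) (ga : Y -> of_bimodule M),
  [/\ conc m 0 Y, model q ga, forall Z, conc m 0 Z -> full_to q ga Z,
      (l < m)%N -> forall Z, conc m 0 Z -> faithful_to Y Z
    & forall s : int, (forall j : nat, (j <= l)%N -> ~~ (m%:Z %| s - j%:Z)%Z) -> kills m Y s].
Proof.
elim: l => [|l IH] lm M [P [d [ep res]]].
  have [Pp [db em] es [e0 dE] Pz] := res; have eb := morphism_bmap em.
  have [X [al [cX mX fX uX]]] := projective_object (Pp 0%N).
  exists X, (fun x => ep (al x)); split=> //.
  - split.
    + by move=> x y cx cy; rewrite (modD mX) // (bmapD eb).
    + by move=> a x cx; rewrite (mod_la mX) // (bmap_la eb).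
    + by move=> x b cx cb; rewrite (mod_ra mX) // (bmap_ra eb).
    + move=> x cx; split=> [/(e0 _).1 [y yx]|/(mod_eq0 mX cx) ->].
        apply/(mod_eq0 mX cx); rewrite -yx (Pz 1%N _ y) //.
        exact: addmap0 (bmapD (morphism_bmap (db 0%N))).
      exact: addmap0 (bmapD eb).
    + move=> v; have [y <-] := es v; have [x cx <-] := mod_surj mX y.
      by exists x.
  - move=> Z Zc N be mZ phi phib; exact: (uX Z N be mZ _ (bmap_comp phib eb)).
  - move=> s ms; apply: faithful_kills => //.
    by have := ms 0%N isT; rewrite subr0.
have [Pp [db em] es [e0 dE] Pz] := res; have eb := morphism_bmap em.
have [X [al [cX mX fX uX]]] := projective_object (Pp 0%N).
have [Y [ka [cY mY uY fY kY]]] := IH (ltnW lm) _ (resolution_ker eb res).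
have kb : @bmap k L L (of_bimodule (to_bimodule (ker_bimod eb))) (of_bimodule (P 0%N))
  (@kval k L L (of_bimodule (P 0%N)) (of_bimodule M) ep) by [].
have [f fm fE] := uY X cX _ al mX _ kb.
have ki (v : ker_bimod eb) : kval v = 0 -> v = 0 by move=> v0; exact: val_inj.
have kE v : ep v = 0 <-> exists w : ker_bimod eb, v = kval w.
  split=> [v0|[w ->]]; last exact (kvalP w).
  have hv : v \in in_ker ep by apply/eqP.
  by exists (@Ker k L L (of_bimodule (P 0%N)) (of_bimodule M) ep _ hv).
have [ga [mG gE]] := cone_model qt fm mY mX cY eb fE ki es kE.
exists (mcone fm), ga; split=> //.
- exact (cone_conc qt mY mX cY cX fE ki).
- move=> Z Zc; apply: (cone_full qt mY mX cY eb fE ki kE gE) => //.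
  by apply: fY.
- move=> lm' Z Zc; apply: (cone_faithful (m := m)) => //; apply (kY (-1)) => j jl.
  rewrite dvdzE (_ : absz (-1 - j%:Z)%R = j.+1); last by lia.
  by rewrite gtnNdvd //=; lia.
- move=> s ms; apply: cone_kills.
    by apply: faithful_kills => //; have := ms 0%N isT; rewrite subr0.
  apply: kY => j jl; have := ms j.+1 jl.
  by rewrite -addn1 PoszD opprD addrA addrAC.
Qed.

End Tower.

(** * Realizing multiplication by t *)

Section ShiftModel.
Variables (k : fieldType) (L : algebra k) (B : dgAlgebra k) (m : nat).
Variables (q : B -> L) (t t' : B).
Hypothesis qt : laurent_like m q t t'.

Lemma conc_shift_m (X : dgbim L B) : conc m 0 X -> conc m 0 (shift X m).
Proof.
move=> Xc i x mi /shift_cyc cx; apply/shift_bnd; apply: Xc => //.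
by move: mi; rewrite !addr0 rpredDr // dvdzz.
Qed.

(** H^m(X) is identified with H^0(X) by multiplication by t'.  That t commutes with
    L in the cohomology of B makes this compatible with the right action of L. *)
Lemma shift_model (X : dgbim L B) (M : bimod L L) (al : X -> M) :
  model q al -> model q (X := shift X m) (fun z => al (ra (z : X) t')).
Proof.
move=> mX; have tc := t'_cyc qt.
have ct z : cyc (shift X m) 0 z -> cyc X (0 + m%:Z) z /\ cyc X 0 (ra (z : X) t').
  move=> /shift_cyc cz; split=> //; rewrite -[0](addrK (m%:Z)).
  by have := cyc_t' qt cz; rewrite addrK.
split.
- move=> x y /ct [_ cx] /ct [_ cy]; rewrite -(modD mX) //.
  by congr al; exact: raD.
- move=> a x /ct [_ cx]; rewrite -(mod_la mX) //.
  by congr al; exact: la_ra.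
- move=> z b /ct [cz' cz] cb.
  have ctb : bcyc 0 (t * b * t').
    by have := bcycM (bcycM (t_cyc qt) cb) tc; rewrite addr0 subrr.
  rewrite -(q_conj qt cb) -(mod_ra mX) //; apply/(mod_eq mX).
  + rewrite -[ra (ra (z : X) b) t']raM; have := bcycM cb tc; rewrite add0r => -[h d].
    by have := cycr cz' h d; rewrite addrK.
  + exact: cycr0.
  + have -> : ra (ra (z : X) b) t' - ra (ra (z : X) t') (t * b * t') =
       ra (ra (z : X) (1 - t' * t)) (b * t').
      by rewrite -!raM -raBr mulrBl mul1r !mulrA.
    have [h d] := bcycM cb tc.
    have b1 : bnd X (0 + m%:Z) (ra (z : X) (1 - t' * t)).
      by rewrite raBr ra1; apply: (bnd_ra1 cz'); exact: t't qt.
    by have := bndr b1 h d; rewrite [0 - _]add0r addrK.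
- move=> x /ct [cx' cx]; split=> [/(mod_eq0 mX cx) bx|/shift_bnd bx].
    by apply/shift_bnd; apply: (bnd_t'I qt cx'); rewrite addrK.
  by apply/(mod_eq0 mX cx); have := bnd_t' qt bx; rewrite addrK.
- move=> v; have [x cx <-] := mod_surj mX v; have cxt := cyc_t qt cx.
  exists (ra x t); first by apply/shift_cyc.
  apply/(mod_eq mX) => //; first by have := cyc_t' qt cxt; rewrite addrK.
  by apply: bnd_sym; exact: (tt'_bnd qt cx).
Qed.

Lemma model_bij (X Y : dgbim L B) (M : bimod L L) (al : X -> M) (be : Y -> M)
    (f : X -> Y) : conc m 0 X -> conc m 0 Y -> model q al -> model q be -> dgmor f ->
  (forall x, cyc X 0 x -> be (f x) = al x) -> forall i, injH f i /\ surjH f i.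
Proof.
move=> cX cY mX mY fm fE i; split.
  apply: (injH_all qt) i => // x cx /(mod_eq0 mY (dgm_cyc fm cx)).
  by rewrite fE // => /(mod_eq0 mX cx).
apply: (surjH_all qt) i => // y cy; have [x cx xE] := mod_surj mX (be y).
exists x => //; apply/(mod_eq mY) => //; first exact: dgm_cyc fm cx.
by rewrite fE.
Qed.

End ShiftModel.

(** * Inverting an endomorphism: the mapping torus *)

(** A morphism T from X to its shift by m makes X a module over L[t].  To make t
    invertible, X is replaced by the homotopy colimit of X -> X -> ... along T,
    indexed by all integers so that t acts on it as the shift of the index: it is
    the cone of the difference of that shift and T on the sum of copies of X.  When
    T is invertible on cohomology, this does not change the cohomology. *)

Section Reindex.
Variables (k : fieldType) (U : lmodType k).

Lemma fsshift_supp (i : int) (f : fs int U) : finsupp (fun n => f (n - i)).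
Proof.
have [s _ f0] := fs_supp f; apply: finsuppP; exists [seq j + i | j <- s] => n ns.
apply: f0; apply: contra ns => ns; apply/mapP; exists (n - i) => //.
by rewrite subrK.
Qed.

Definition fsshift i (f : fs int U) : fs int U := Fs (fsshift_supp i f).

Lemma fs_bound (f : fs int U) : exists N : nat, forall n : int, (N < `|n|)%N -> f n = 0.
Proof.
have [s _ f0] := fs_supp f; exists (\max_(j <- s) `|j|%N) => n Nn.
apply: f0; apply: contraL Nn => ns; rewrite -leqNgt.
exact: (leq_bigmax_seq (F := fun j : int => `|j|%N)).
Qed.

End Reindex.

Section Torus.
Variables (k : fieldType) (L : algebra k) (B : dgAlgebra k) (m : nat).
Local Notation sg := (sg k).
Variables (X : dgbim L B) (T : X -> shift X m).
Hypothesis Tm : dgmor T.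

Let w (n : int) : int := n * m%:Z.

Definition tel : dgbim L B := dsum X w.

Definition tel_map (g : tel) : shift tel m :=
  fsshift 1 g - (fsmap (h := fun _ x => T x : X) (fun=> addmap0 (bmapD (dgm_b Tm))) g).

Lemma tel_mapE (g : tel) n :
  fsval (tel_map g) n = fsval g (n - 1) - (T (fsval g n) : X).
Proof. by []. Qed.

Lemma wS n : w (n + 1) = w n + m. Proof. by rewrite /w mulrDl mul1r. Qed.
Lemma wP n : w (n - 1) = w n - m%:Z. Proof. by rewrite /w mulrBl mul1r. Qed.

Lemma T_dd x : T (dd x) = sg m *: dd (T x : X).
Proof. by rewrite (dgm_d Tm). Qed.
Lemma T_hh i x : x \in hh X i -> (T x : X) \in hh X (i + m).
Proof. exact: (dgm_h Tm). Qed.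

Lemma tel_map_dgmor : dgmor tel_map.
Proof.
have TD := bmapD (dgm_b Tm); split.
- split=> [x y|a x|x b]; apply: fsP => n.
  + rewrite [RHS]fsDE !tel_mapE !fsDE TD opprD; exact: addrACA.
  + rewrite [RHS](@fs_laE _ L B int X a (tel_map x)) !tel_mapE !fs_laE (bmap_la (dgm_b Tm)).
    by rewrite laB.
  + rewrite [RHS](@fs_raE _ L B int X (tel_map x) b) !tel_mapE !fs_raE (bmap_ra (dgm_b Tm)).
    by rewrite raB.
- move=> i g /dsum_hhP hg; rewrite shift_hhE; apply/dsum_hhP => n.
  rewrite tel_mapE; apply: hhB.
    by have := hg (n - 1); rewrite wP opprB addrA addrAC.
  by have := T_hh (hg n); rewrite addrAC.
- move=> g; apply: fsP => n; rewrite shift_ddE fsZE dsum_ddE !tel_mapE !dsum_ddE.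
  rewrite wP sgD sgN (bmapZ (dgm_b Tm)) T_dd ddB !scalerBr !scalerA.
  by rewrite [sg m * _]mulrC.
Qed.

Definition torus : dgbim L B := mcone tel_map_dgmor.
Local Notation inl := (cone_inl tel_map_dgmor).
Local Notation inr := (cone_inr tel_map_dgmor).

Definition tel_delta (n : int) (x : X) : tel := delta n x.

Lemma tel_delta_bmap n : bmap (tel_delta n).
Proof. exact: delta_bmap. Qed.

Lemma tel_delta_dd n x : dd (tel_delta n x) = sg (w n) *: tel_delta n (dd x).
Proof.
apply: fsP => j; rewrite dsum_ddE fsZE !deltaE.
by case: eqP => [->|_]; rewrite ?dd0 ?scaler0.
Qed.

Lemma tel_delta_hh n i x : x \in hh X (i - w n) -> tel_delta n x \in hh tel i.
Proof. exact: delta_dsum_h. Qed.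

Lemma tel_delta_cyc n i x : cyc X (i - w n) x -> cyc tel i (tel_delta n x).
Proof.
move=> [hx dx]; split; first exact: tel_delta_hh.
by rewrite tel_delta_dd dx (addmap0 (bmapD (tel_delta_bmap n))) scaler0.
Qed.

Lemma tel_delta_bnd n i x : bnd X (i - w n) x -> bnd tel i (tel_delta n x).
Proof.
move=> [y hy ->]; exists (sg (w n) *: tel_delta n y).
  by apply: hhZ; apply: tel_delta_hh; rewrite addrAC.
by rewrite ddZ tel_delta_dd scalerA sgK scale1r.
Qed.

Definition torus_in (x : X) : torus := inl (tel_delta 1 x : shift tel m).

Lemma w1 : w 1 = m. Proof. by rewrite /w mul1r. Qed.

Lemma torus_in_dgmor : dgmor torus_in.
Proof.
apply: (@dgmor_comp _ _ _ _ _ _ inl (tel_delta 1 : X -> shift tel m)).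
  exact: cone_inl_dgmor.
split; first exact: tel_delta_bmap.
  by move=> i x hx; rewrite shift_hhE; apply: tel_delta_hh; rewrite w1 addrK.
by move=> x; rewrite shift_ddE tel_delta_dd w1 scalerA sgK scale1r.
Qed.

(** This difference is the boundary of x in the n-th cell: in cohomology copy number
    n + 1 is glued to copy number n along T. *)
Lemma torus_glue i n x : cyc X (i - w n) x ->
  bnd torus i (inl (tel_delta (n + 1) x : shift tel m) - inl (tel_delta n (T x : X) : shift tel m)).
Proof.
move=> cx; have [hx dx] := tel_delta_cyc cx.
exists (inr (tel_delta n x)); first by apply: cone_inr_hh; rewrite subrK.
rewrite cone_inr_dd dx (addmap0 (bmapD (cone_inr_bmap _))) subr0.
rewrite -(addmapB (bmapD (cone_inl_bmap _))); congr inl; apply: fsP => j.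
rewrite fsDE fsNE tel_mapE !deltaE subr_eq; congr (_ - _).
by case: eqP => // _; rewrite (addmap0 (bmapD (dgm_b Tm))).
Qed.

Hypothesis Tinj : forall i, injH T i.
Hypothesis Tsurj : forall i, surjH T i.

Lemma T_bnd i x : bnd X i x -> bnd X (i + m) (T x : X).
Proof. by move=> bx; apply/shift_bnd; exact: (dgm_bnd Tm bx). Qed.
Lemma T_cyc i x : cyc X i x -> cyc X (i + m) (T x : X).
Proof. by move=> bx; apply/shift_cyc; exact: (dgm_cyc Tm bx). Qed.
Lemma T_inj i x : cyc X i x -> bnd X (i + m) (T x : X) -> bnd X i x.
Proof. by move=> cx bx; apply: (Tinj cx); apply/shift_bnd. Qed.
Lemma T_surj (i : int) y : cyc X (i + m) y -> exists2 x, cyc X i x & bnd X (i + m) (y - (T x : X)).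
Proof.
move=> cy; have [|x cx bx] := Tsurj (i := i) (y := y); first by apply/shift_cyc.
by exists x => //; move/shift_bnd: bx.
Qed.

Lemma tel_cycP i (g : tel) : cyc tel i g <-> forall n, cyc X (i - w n) (fsval g n).
Proof.
split=> [[/dsum_hhP hg dg] n|cg].
  split=> //; have := congr1 (fun f : fs int X => sg (w n) *: f n) dg.
  by rewrite dsum_ddE scalerA sgK scale1r fs0E scaler0.
split; first by apply/dsum_hhP => n; case: (cg n).
by apply: fsP => n; rewrite dsum_ddE (cg n).2 scaler0.
Qed.

Lemma tel_bnd i (g : tel) : (forall n, bnd X (i - w n) (fsval g n)) -> bnd tel i g.
Proof.
move=> bg; pose R n (x y : X) := y \in hh X (i - 1 - w n) /\ x = sg (w n) *: dd y.
have [n|n|h hP] := @fs_choice k int X X R g.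
- have [y hy ->] := bg n; exists (sg (w n) *: y); split.
    by apply: hhZ; rewrite addrAC.
  by rewrite ddZ scalerA sgK scale1r.
- by split; rewrite ?hh0 ?dd0 ?scaler0.
- exists h; first by apply/dsum_hhP => n; case: (hP n).
  by apply: fsP => n; rewrite dsum_ddE; case: (hP n).
Qed.

(** Above its support g vanishes, and T maps coboundaries to coboundaries. *)
Lemma tel_descend i (g : tel) (n0 : int) : (forall n, cyc X (i - w n) (fsval g n)) ->
  (forall n, n0 <= n -> bnd X (i - w n) (fsval g n - (T (fsval g (n + 1)) : X))) ->
  forall n, n0 <= n -> bnd X (i - w n) (fsval g n).
Proof.
move=> cg step; have [N gN] := fs_bound g.
suff H (j : nat) : forall n, n0 <= n -> N%:Z + 1 - j%:Z <= n -> bnd X (i - w n) (fsval g n).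
  by move=> n nn; apply: (H (N + `|n|).+1) => //; lia.
elim: j => [|j IH] n nn jn; first by rewrite gN; [exact: bnd0|lia].
rewrite -[fsval g n](subrK (T (fsval g (n + 1)) : X)); apply: bndD; first exact: step.
have := T_bnd (IH (n + 1) _ _); rewrite wS opprD addrA subrK; apply; lia.
Qed.

(** Below its support g vanishes, and T reflects coboundaries. *)
Lemma tel_ascend i (g : tel) (n0 : int) : (forall n, cyc X (i - w n) (fsval g n)) ->
  (forall n, n < n0 -> bnd X (i - w n) (fsval g n - (T (fsval g (n + 1)) : X))) ->
  forall n, n <= n0 -> bnd X (i - w n) (fsval g n).
Proof.
move=> cg step; have [N gN] := fs_bound g.
suff H (j : nat) : forall n, n <= n0 -> n <= j%:Z - N%:Z - 1 -> bnd X (i - w n) (fsval g n).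
  by move=> n nn; apply: (H (N + `|n|).+1) => //; lia.
elim: j => [|j IH] n nn jn; first by rewrite gN; [exact: bnd0|lia].
apply: T_inj; first exact: cg.
have := step (n - 1); rewrite subrK wP opprB addrA addrAC => st.
have b1 : bnd X (i - w n + m) (fsval g (n - 1)).
  by have := IH (n - 1); rewrite wP opprB addrA addrAC; apply; lia.
by have := bndB b1 (st _); rewrite subKr; apply; lia.
Qed.

(** If copy number 1 of z bounds, the coefficients g of a primitive satisfy
    g n = T (g (n + 1)) on cohomology except at n = 0, where z intervenes.  They
    vanish for n >= 1 by descent and for n <= 0 by ascent, so z bounds. *)
Lemma torus_in_inj i : injH torus_in i.
Proof.
move=> z cz [p /cone_hhP [hf hg]]; rewrite cone_ddE => pE.
have dg : dd p.2 = 0.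
  by have := congr1 (fun z : tel * tel => - z.2) pE; rewrite /= opprK oppr0.
rewrite subrK in hg.
have cg := (tel_cycP i p.2).1 (conj hg dg).
have fE n : (if n == 1 then z else 0) =
    sg m *: (sg (w n) *: dd (fsval p.1 n)) + (fsval p.2 (n - 1) - (T (fsval p.2 n) : X)).
  have E1 : tel_delta 1 z = sg m *: dd (p.1 : tel) + tel_map p.2 := congr1 (fun z : tel * tel => z.1) pE.
  have := congr1 (fun f : fs int X => f n) E1.
  by rewrite fsDE fsZE dsum_ddE tel_mapE deltaE.
have /dsum_hhP hf' : (p.1 : tel) \in hh tel (i - 1 + m) := hf.
have bE n : bnd X (i - w n) ((if n + 1 == 1 then z else 0) -
    (fsval p.2 n - (T (fsval p.2 (n + 1)) : X))).
  rewrite fE !addrK; apply: bndZ; apply: bndZ.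
  have := bnd_dd (hf' (n + 1)); rewrite wS.
  by congr bnd; lia.
have bE' n : n != 0 -> bnd X (i - w n) (fsval p.2 n - (T (fsval p.2 (n + 1)) : X)).
  move=> n0; have := bE n; rewrite (_ : (n + 1 == 1) = false); last by lia.
  by rewrite sub0r => /bndN; rewrite opprK.
have b1 : bnd X (i - w 1) (fsval p.2 1).
  by apply: (tel_descend (n0 := 1) cg) => // n n1; apply: bE'; lia.
have b0 : bnd X (i - w 0) (fsval p.2 0).
  by apply: (tel_ascend (n0 := 0) cg) => // n n1; apply: bE'; lia.
have := bE 0; rewrite add0r eqxx => b2.
have := bndD b2 (bndB b0 (_ : bnd X (i - w 0) (T (fsval p.2 1) : X))).
rewrite subrK /w mul0r subr0; apply.
by have := T_bnd b1; rewrite w1 subrK.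
Qed.

(** The component of a cocycle on the cells is a coboundary by descent, so the
    cocycle can be moved to the base; there every copy is moved to copy number 1,
    from above along T, and from below along the inverse of T on cohomology. *)
Lemma torus_in_surj i : surjH torus_in i.
Proof.
move=> p cp; have [/cone_hhP [hf hg]] := cp; rewrite cone_ddE => dp.
have dg : dd p.2 = 0.
  by have := congr1 (fun z : tel * tel => - z.2) dp; rewrite /= opprK oppr0.
have cg := (tel_cycP (i + 1) p.2).1 (conj hg dg).
have bg : bnd tel (i + 1) p.2.
  apply: tel_bnd => n; apply: (tel_descend (n0 := n) cg) => // {}n _.
  have fE : sg m *: (sg (w (n + 1)) *: dd (fsval p.1 (n + 1))) +
      (fsval p.2 n - (T (fsval p.2 (n + 1)) : X)) = 0.
    have E1 : sg m *: dd (p.1 : tel) + tel_map p.2 = 0 := congr1 (fun z : tel * tel => z.1) dp.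
    have := congr1 (fun f : fs int X => f (n + 1)) E1.
    by rewrite fsDE fsZE dsum_ddE tel_mapE addrK.
  have -> : fsval p.2 n - (T (fsval p.2 (n + 1)) : X) =
     - (sg m *: (sg (w (n + 1)) *: dd (fsval p.1 (n + 1)))).
    by apply/eqP; rewrite -addr_eq0 addrC fE.
  apply: bndN; apply: bndZ; apply: bndZ.
  have /dsum_hhP hf' : (p.1 : tel) \in hh tel (i + m) := hf.
  have := bnd_dd (hf' (n + 1)); rewrite wS.
  by congr bnd; lia.
have [f cf bf] := cone_rep_bnd cp bg.
suff [z cz bz] : exists2 z, cyc X i z & bnd torus i (inl f - torus_in z).
  by exists z => //; exact: bnd_trans bf bz.
pose Q (f : shift tel m) := exists2 z, cyc X i z & bnd torus i (inl f - torus_in z).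
have inlD := bmapD (cone_inl_bmap tel_map_dgmor).
have inD := bmapD (dgm_b torus_in_dgmor).
have QD u v : Q u -> Q v -> Q (u + v).
  move=> [x cx bx] [y cy bY]; exists (x + y); first exact: cycD.
  by rewrite inlD inD opprD addrACA; exact: bndD.
have Q0 : Q 0.
  by exists 0; [exact: cyc0|rewrite (addmap0 inlD) (addmap0 inD) subr0; exact: bnd0].
have Qeq u v : bnd torus i (inl u - inl v) -> Q v -> Q u.
  by move=> uv [z cz bz]; exists z => //; exact: bnd_trans uv bz.
have Qd n : forall x, cyc X (i + m - w n) x -> Q (tel_delta n x).
  have up j : (forall x, cyc X (i + m - w j) x -> Q (tel_delta j x)) ->
      forall x, cyc X (i + m - w (j + 1)) x -> Q (tel_delta (j + 1) x).
    move=> IH x cx; have cx' : cyc X (i - w j) x.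
      by move: cx; rewrite wS; congr cyc; lia.
    by apply: (Qeq _ _ (torus_glue cx')); apply: IH; have := T_cyc cx'; rewrite addrAC.
  have down j : (forall x, cyc X (i + m - w (j + 1)) x -> Q (tel_delta (j + 1) x)) ->
      forall x, cyc X (i + m - w j) x -> Q (tel_delta j x).
    move=> IH x cx; have cx' : cyc X (i - w j + m) x by rewrite addrAC.
    have [y cy bY] := T_surj cx'.
    apply: (Qeq _ (tel_delta (j + 1) y)).
      apply: bnd_trans (bnd_sym (torus_glue cy)).
      rewrite -(addmapB inlD) -(addmapB (bmapD (tel_delta_bmap j))).
      apply: (dgm_bnd (cone_inl_dgmor tel_map_dgmor)); apply/shift_bnd.
      by apply: tel_delta_bnd; rewrite addrAC.
    by apply: IH; move: cy; rewrite wS; congr cyc; lia.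
  rewrite -[n](subrK 1); elim/int_rec: (n - 1) => [|j IH|j IH].
  - move=> x; rewrite add0r w1 addrK => cx; exists x => //.
    by rewrite subrr; exact: bnd0.
  - by move=> x; rewrite -addn1 PoszD; apply: up.
  - move=> x; apply: down; rewrite (_ : - j.+1%:Z + 1 + 1 = - j%:Z + 1) //; lia.
have /shift_cyc /tel_cycP cf' := cf.
have [s us fE] := fs_delta (f : fs int X).
have {}fE : f = \sum_(j <- s) tel_delta j (fsval f j) := fE.
change (Q f); rewrite fE.
by apply: (big_ind Q) => // j _; apply: Qd.
Qed.

End Torus.

(** * The action of Laurent polynomials *)

Section Monomials.
Variables (k : fieldType) (L : algebra k).

Lemma mono_supp (n : int) (a : L) : finsupp_pred (fun j => if j == n then a else 0).
Proof.
by apply/finsupp_seq; exists [:: n] => // j; rewrite inE => /negPf ->.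
Qed.

Definition mono n a : laurent L := Laurent (mono_supp n a).

Lemma monoE n a j : lcoef (mono n a) j = if j == n then a else 0. Proof. by []. Qed.

Lemma mono_homog m n a : mono n a \in laurent_homog m (n * m%:Z).
Proof. by apply/laurent_homogP => j; rewrite monoE; case: (j =P n) => // ->; rewrite eqxx. Qed.

Lemma lcoef_monoMl n a (f : laurent L) j : lcoef (lmul (mono n a) f) j = a * lcoef f (j - n).
Proof.
rewrite lcoefM (@lconvE _ _ _ _ [:: n]) // => [|i]; first by rewrite big_seq1 monoE eqxx.
by rewrite inE monoE => /negPf ->.
Qed.

Lemma lcoef_monoMr n a (f : laurent L) j : lcoef (lmul f (mono n a)) j = lcoef f (j - n) * a.
Proof.
have [s us fs] := laurent_seq f.
rewrite lcoefM (lconvE _ _ us) // (@big_supp _ _ _ s [:: j - n]) //.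
- by rewrite big_seq1 monoE subKr eqxx.
- by move=> i /fs ->; rewrite mul0r.
- move=> i; rewrite inE => ij; rewrite monoE (_ : (j - i == n) = false) ?mulr0 //.
  by apply: contraNF ij => /eqP <-; rewrite subKr.
Qed.

Lemma homog_mono m n (f : laurent L) : (0 < m)%N -> f \in laurent_homog m (n * m%:Z) ->
  f = mono n (lcoef f n).
Proof.
move=> m0 /laurent_homogP hf; apply: lcoefP => j; rewrite monoE.
case: eqP => [->//|/eqP jn]; apply: hf; apply: contra jn => /eqP jn.
by apply/eqP/(mulIf _ jn); lia.
Qed.

Lemma homog_ndvd m i (f : laurent L) : ~~ (m%:Z %| i)%Z -> f \in laurent_homog m i -> f = 0.
Proof.
move=> mi /laurent_homogP hf; apply: lcoefP => j; rewrite hf //.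
by apply: contra mi => /eqP <-; rewrite dvdz_mull.
Qed.

End Monomials.

(** A left L-module with an action tp of the integers that commutes with L is a
    left module over the Laurent polynomials. *)
Section LaurentAction.
Variables (k : fieldType) (L : algebra k) (B : dgAlgebra k) (m : nat).
Local Notation sg := (sg k).
Variables (X : dgbim L B) (tp : int -> X -> X).
Hypothesis tp_b : forall i, bmap (tp i).
Hypothesis tp_0 : forall x, tp 0 x = x.
Hypothesis tp_D : forall i j x, tp (i + j) x = tp i (tp j x).
Hypothesis tp_h : forall i l x, x \in hh X l -> tp i x \in hh X (i * m%:Z + l).
Hypothesis tp_d : forall i x, dd (tp i x) = sg (i * m%:Z) *: tp i (dd x).

Local Notation A := (graded_laurent L m).

Definition lauact (a : A) (x : X) : X := \sum_(i \in [set: int]) la (lcoef a i) (tp i x).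

Lemma lauactE (a : A) x (s : seq int) : uniq s -> (forall i, i \notin s -> lcoef a i = 0) ->
  lauact a x = \sum_(i <- s) la (lcoef a i) (tp i x).
Proof.
move=> us a0; rewrite /lauact (fsbigE s) //; last by move=> i _ /a0 ->; rewrite la0l.
by apply: eq_bigl => i; rewrite in_setT.
Qed.

Lemma lauact_mono n b x : lauact (mono n b) x = la b (tp n x).
Proof.
rewrite (@lauactE _ _ [:: n]) // => [|i]; first by rewrite big_seq1 monoE eqxx.
by rewrite inE monoE => /negPf ->.
Qed.

Lemma lauact_bmap (a : A) : addmap (lauact a) /\ forall x b, lauact a (ra x b) = ra (lauact a x) b.
Proof.
have [s us a0] := laurent_seq a; split=> [x y|x b]; rewrite !(lauactE _ us a0).
  by rewrite -big_split; apply: eq_bigr => i _; rewrite (bmapD (tp_b i)) laD.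
by rewrite ra_sum; apply: eq_bigr => i _; rewrite (bmap_ra (tp_b i)) la_ra.
Qed.

Lemma lauact_Dl (a b : A) x : lauact (a + b) x = lauact a x + lauact b x.
Proof.
have [s us a0] := laurent_seq a; have [r ur b0] := laurent_seq b.
have H i : i \notin undup (s ++ r) -> lcoef a i = 0 /\ lcoef b i = 0.
  by rewrite mem_undup mem_cat negb_or => /andP [/a0 -> /b0 ->].
have usr := undup_uniq (s ++ r).
rewrite !(lauactE _ usr) => [|i /H []|i /H []|i /H [ai bi]] //.
  by rewrite -big_split; apply: eq_bigr => i _; exact: laDl.
by rewrite [LHS]lcoefD ai bi addr0.
Qed.

Lemma lauact_M (a b : A) x : lauact (a * b) x = lauact a (lauact b x).
Proof.
have [s us a0] := laurent_seq a; have [r ur b0] := laurent_seq b.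
have usr := undup_uniq [seq i + j | i <- s, j <- r].
rewrite (lauactE _ usr) => [|i]; last exact: lconv_supp.
rewrite (lauactE _ us a0).
transitivity (\sum_(i <- s) \sum_(j <- r) la (lcoef a i) (la (lcoef b j) (tp (i + j) x))).
  transitivity (\sum_(n <- undup [seq i + j | i <- s, j <- r])
     \sum_(i <- s) la (lcoef a i * lcoef b (n - i)) (tp n x)).
    apply: eq_bigr => n _; rewrite -la_suml; congr (la _ _).
    by rewrite [LHS]lcoefM (lconvE _ _ us a0).
  rewrite exchange_big /= big_seq [RHS]big_seq; apply: eq_bigr => i si.
  transitivity (\sum_(n <- [seq i + j | j <- r]) la (lcoef a i * lcoef b (n - i)) (tp n x)).
    apply: big_supp_eq => // [|n|n].
    + by rewrite map_inj_uniq //; exact: addrI.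
    + rewrite mem_undup => ns; rewrite b0 ?mulr0 ?la0l //.
      apply: contra ns => nr; apply/allpairsP; exists (i, n - i); split=> //=.
      by rewrite addrC subrK.
    + move=> ns; rewrite b0 ?mulr0 ?la0l //.
      apply: contra ns => nr; apply/mapP; exists (n - i) => //.
      by rewrite addrC subrK.
  rewrite big_map; apply: eq_bigr => j _.
  by rewrite [i + j]addrC addrK laM.
apply: eq_bigr => i _; rewrite (lauactE _ ur b0) (addmap_sum (bmapD (tp_b i))) la_sum.
by apply: eq_bigr => j _; rewrite tp_D (bmap_la (tp_b i)).
Qed.

Lemma lauact_Z (c : k) (a : A) x : lauact (c *: a) x = c *: lauact a x.
Proof.
have [s us a0] := laurent_seq a; rewrite !(lauactE _ us) // => [|i /a0 ai].
  by rewrite scaler_sumr; apply: eq_bigr => i _; rewrite -laZl.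
by rewrite [LHS]lcoefZ ai scaler0.
Qed.

Lemma lauact_is_bimod : @is_bimod k (laurent_algebra L) B X lauact (fun x b => ra x b).
Proof.
have e1 : (1 : laurent_algebra L) = mono 0 (1 : L) by exact: lcoefP.
split=> *; rewrite ?(raD, raDr, raZr, ra1, raM) //.
- exact: lauact_Dl.
- exact: (lauact_bmap _).1.
- exact: lauact_Z.
- by rewrite e1 lauact_mono tp_0 la1.
- exact: lauact_M.
- exact: raDr.
- by rewrite (lauact_bmap _).2.
Qed.

Lemma lauact_hh i l (a : A) x : a \in homog A i -> x \in hh X l -> lauact a x \in hh X (i + l).
Proof.
move=> /laurent_homogP ha hx; have [s us a0] := laurent_seq a.
rewrite (lauactE _ us a0); apply: (dir_sum (@hh_sub _ _ _ X)) => n _.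
have [<-|ni] := eqVneq (n * m%:Z) i; first by apply: hhl; exact: tp_h.
by rewrite ha // la0l hh0.
Qed.

Lemma dd_lauact i (a : A) x : a \in homog A i -> dd (lauact a x) = sg i *: lauact a (dd x).
Proof.
move=> /laurent_homogP ha; have [s us a0] := laurent_seq a.
rewrite !(lauactE _ us a0) dd_sum scaler_sumr; apply: eq_bigr => n _.
have [<-|ni] := eqVneq (n * m%:Z) i; first by rewrite ddl tp_d laZ.
by rewrite ha // !la0l dd0 scaler0.
Qed.




End LaurentAction.

(** * Quasi-isomorphisms *)

Section Criterion.
Variables (k : fieldType) (B C : dgAlgebra k) (f : B -> C).
Hypothesis fP : dg_morphism f.

Lemma bnd_homog (D : dgAlgebra k) i (x y : D) : x \in homog D i -> x = diff y ->
  exists2 y', y' \in homog D (i - 1) & x = diff y'.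
Proof.
move=> hx xy; have [g yg] := decomposes_ex y; exists (g (i - 1)); first by case: yg.
have d2 := decomposes_diff yg; rewrite -xy in d2.
by have := congr1 (@^~ i) (decomposes_uniq (decomposes_homog hx) d2); rewrite eqxx.
Qed.

Let fl : linear f. Proof. by case: fP => -[]. Qed.
Let fD : addmap f. Proof. by move=> x y; have := fl 1 x y; rewrite !scale1r. Qed.
Let fd x : f (diff x) = diff (f x). Proof. by case: fP. Qed.
Let fh i x : x \in homog B i -> f x \in homog C i. Proof. by case: fP => -[_ _ H] _; exact: H. Qed.

Lemma cohom_map_morphism : graded_morphism (cohom_map fP).
Proof.
have [[_ [f1 fM] _] _] := fP.
split; last first.
- move=> i h /cohom_homogP [z hz ->]; rewrite cohom_map_cclass; apply/cohom_homogP.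
  by eexists; [|reflexivity]; exact: fh.
- split.
    by rewrite [X in cohom_map fP X]/(cclass (cone B)) cohom_map_cclass; congr cclass; exact: cocycleP.
  move=> g h; rewrite -[g]cclassK -[h]cclassK [X in cohom_map fP X]cclassM.
  rewrite !cohom_map_cclass [RHS]cclassM; congr cclass; apply: cocycleP; exact: fM.
- move=> a g h; rewrite -[g]cclassK -[h]cclassK.
  rewrite -[X in cohom_map fP (X + _)]cclassZE -[X in cohom_map fP X]cclassD.
  rewrite !cohom_map_cclass -[X in _ = X + _]cclassZE -[RHS]cclassD.
  by congr cclass; apply: cocycleP; exact: fl.
Qed.

(** The hypotheses speak of homogeneous elements only; an arbitrary class is
    decomposed first. *)
Lemma quasi_iso_criterion :
  (forall i z, z \in homog C i -> diff z = 0 ->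
    exists2 w, w \in homog B i & diff w = 0 /\ exists y, z = f w + diff y) ->
  (forall i w y, w \in homog B i -> diff w = 0 -> y \in homog C (i - 1) ->
    f w = diff y -> exists w', w = diff w') ->
  quasi_isomorphism fP.
Proof.
move=> fsurj finj; split; first exact: cohom_map_morphism.
have cD : addmap (cohom_map fP).
  by have [cl _ _] := cohom_map_morphism; move=> x y; have := cl 1 x y; rewrite !scale1r.
have inj : injective (cohom_map fP).
  move=> g h gh; apply/eqP; rewrite -subr_eq0; apply/eqP.
  have : cohom_map fP (g - h) = 0.
    by rewrite (addmapB cD) gh subrr.
  set x := g - h; rewrite -[x]cclassK cohom_map_cclass => /cclass0 [y /= xy].
  have [r xr] := decomposes_ex (cval (repr x)); have dr := cocycle_components xr (cvalP _).
  have [rh [s [us rs xs]]] := xr.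
  have fxr : decomposes (f (cval (repr x))) (fun i => f (r i)).
    split=> [i|]; first exact: fh.
    exists s; split=> // [i /rs ->|]; first exact: addmap0.
    by rewrite xs (addmap_sum fD).
  have [v yv] := decomposes_ex y; have := decomposes_diff yv; rewrite -xy => xv.
  have frv := decomposes_uniq fxr xv.
  have /choice [u uP] : forall i, exists u, r i = diff u.
    move=> i; apply: (finj i (r i) (v (i - 1))) => //; first by case: yv.
    exact: (congr1 (@^~ i) frv).
  apply/cclass0; exists (\sum_(i <- s) u i); rewrite xs diff_sum.
  by apply: eq_bigr => i _; exact: uP.
have surj h : exists g, cohom_map fP g = h.
  have [s [z [zh ->]]] := grading_span (cohom_is_grading C) h.
  elim: s => [|i s [g IH]]; first by exists 0; rewrite big_nil (addmap0 cD).
  have /cohom_homogP [w hw wE] := zh i.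
  have [x hx [dx [y wy]]] := fsurj i _ hw (cvalP w).
  have cx : x \in is_cocycle B by apply/eqP.
  exists (cclass (Cocycle cx) + g); rewrite cD IH big_cons cohom_map_cclass; congr (_ + _).
  by rewrite wE; apply/esym/cclassP; exists y.
have /choice [g gP] := surj.
by exists g => // x; apply: inj; rewrite gP.
Qed.

End Criterion.

(** * Gluing two DG algebras along a bimodule *)

(** Let N be a differential graded A-B-bimodule, x0 a cocycle of degree 1 of N, and
    phi the map a |-> (-1)^i a x0 on A^i.  On the upper triangular matrices with
    diagonal entries in A and B and upper entry in N, adding phi a - x0 b to the
    differential of the upper entry gives a DG algebra.  The kernel of its
    projection to A is the cone of b |-> x0 b, and the kernel of its projection to
    B that of phi.  So if both maps induce isomorphisms on cohomology, then A and B
    are quasi-isomorphic. *)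
Section Triangular.
Variables (k : fieldType) (A B : dgAlgebra k) (N : bimod A B).
Local Notation sg := (sg k).
Variables (d : N -> N) (h : int -> {pred N}).
Hypothesis hdir : is_direct h.
Hypothesis hl : forall i j a x, a \in homog A i -> x \in h j -> la a x \in h (i + j).
Hypothesis hr : forall i j x b, x \in h i -> b \in homog B j -> ra x b \in h (i + j).
Hypothesis dD : addmap d.
Hypothesis dZ : forall (c : k) x, d (c *: x) = c *: d x.
Hypothesis dh : forall i x, x \in h i -> d x \in h (i + 1).
Hypothesis dd : forall x, d (d x) = 0.
Hypothesis dl : forall i a x, a \in homog A i ->
  d (la a x) = la (diff a) x + sg i *: la a (d x).
Hypothesis dr : forall i x b, x \in h i ->
  d (ra x b) = ra (d x) b + sg i *: ra x (diff b).
Variables (x0 : N) (phi : A -> N).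
Hypothesis hx0 : x0 \in h 1.
Hypothesis dx0 : d x0 = 0.
Hypothesis phiD : addmap phi.
Hypothesis phiZ : forall (c : k) a, phi (c *: a) = c *: phi a.
Hypothesis phi1 : phi 1 = x0.
Hypothesis phiM : forall i a a', a \in homog A i -> phi (a * a') = sg i *: la a (phi a').
Hypothesis phih : forall i a, a \in homog A i -> phi a \in h (i + 1).
Hypothesis phid : forall a, phi (diff a) = - d (phi a).

Local Notation T := (A * N * B)%type.

Definition tri_one : T := (1, 0, 1).
Definition tri_mul (p r : T) : T :=
  (p.1.1 * r.1.1, la p.1.1 r.1.2 + ra p.1.2 r.2, p.2 * r.2).

Lemma triP (p r : T) : p.1.1 = r.1.1 -> p.1.2 = r.1.2 -> p.2 = r.2 -> p = r.
Proof. by case: p r => [[a u] b] [[a' u'] b'] /= -> -> ->. Qed.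

Lemma tri_is_algebra : @is_algebra k T tri_one tri_mul.
Proof.
split.
- move=> x y z; apply: triP; rewrite /= ?mulrA //.
  by rewrite laD raD !laM raM la_ra addrA.
- by move=> x; apply: triP; rewrite /= ?mul1r // la1 ra0 addr0.
- by move=> x; apply: triP; rewrite /= ?mulr1 // la0 ra1 add0r.
- move=> x y z; apply: triP; rewrite /= ?mulrDl //.
  by rewrite laDl raD addrACA.
- move=> x y z; apply: triP; rewrite /= ?mulrDr //.
  by rewrite laD raDr addrACA.
- move=> c x y; apply: triP; rewrite /= ?algZAl //.
  by rewrite laZl raZ scalerDr.
- move=> c x y; apply: triP; rewrite /= ?algZAr //.
  by rewrite laZ raZr scalerDr.
Qed.

Definition tri_algebra : algebra k := Algebra tri_is_algebra.

Definition tri_homog (i : int) : {pred tri_algebra} :=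
  fun p : T => [&& p.1.1 \in homog A i, p.1.2 \in h i & p.2 \in homog B i].

Lemma tri_homogP i (p : T) : p \in tri_homog i <->
  [/\ p.1.1 \in homog A i, p.1.2 \in h i & p.2 \in homog B i].
Proof. by split=> [/and3P|/and3P]. Qed.

Lemma tri_sub i : submod_closed (tri_homog i).
Proof.
have hsub := dir_sub hdir.
split; first by apply/tri_homogP; rewrite !homog0 dir0.
move=> c p r /tri_homogP [p1 p2 p3] /tri_homogP [r1 r2 r3]; apply/tri_homogP.
by rewrite !homogZD //; split=> //; exact: dirZD.
Qed.

Lemma tri_is_grading : is_grading tri_homog.
Proof.
have hsub := dir_sub hdir.
have s11 J (r : seq J) (P : pred J) (F : J -> tri_algebra) :
    (\sum_(j <- r | P j) F j : T).1.1 = \sum_(j <- r | P j) (F j : T).1.1.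
  exact: (big_morph (fun p : tri_algebra => (p : T).1.1)).
have s12 J (r : seq J) (P : pred J) (F : J -> tri_algebra) :
    (\sum_(j <- r | P j) F j : T).1.2 = \sum_(j <- r | P j) (F j : T).1.2.
  exact: (big_morph (fun p : tri_algebra => (p : T).1.2)).
have s2 J (r : seq J) (P : pred J) (F : J -> tri_algebra) :
    (\sum_(j <- r | P j) F j : T).2 = \sum_(j <- r | P j) (F j : T).2.
  exact: (big_morph (fun p : tri_algebra => (p : T).2)).
split.
- exact: tri_sub.
- by apply/tri_homogP; rewrite !homog1 dir0.
- move=> i j p r /tri_homogP [p1 p2 p3] /tri_homogP [r1 r2 r3]; apply/tri_homogP.
  split; [exact: homogM| |exact: homogM].
  by apply: dirD => //; [exact: hl|exact: hr].
- move=> p; suff [s [f [us fh ->]]] : spanned tri_homog p by exists s, f.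
  have -> : p = ((((p : T).1.1, 0), 0) : tri_algebra) + (((0, (p : T).1.2), 0) : tri_algebra)
       + (((0, 0), (p : T).2) : tri_algebra).
    by apply: triP; rewrite /= ?addr0 ?add0r.
  apply: (spannedD tri_sub); first apply: (spannedD tri_sub).
  + have [s [f [us fh ->]]] := direct_spanned (homog_direct A) (p : T).1.1.
    exists s, (fun i => ((f i, 0), 0)); split=> // [i|].
      by apply/tri_homogP; rewrite !homog0 fh dir0.
    by apply: triP; rewrite ?s11 ?s12 ?s2 //= [RHS]big1.
  + have [s [f [us fh ->]]] := direct_spanned hdir (p : T).1.2.
    exists s, (fun i => ((0, f i), 0)); split=> // [i|].
      by apply/tri_homogP; rewrite !homog0 fh.
    by apply: triP; rewrite ?s11 ?s12 ?s2 //= [RHS]big1.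
  + have [s [f [us fh ->]]] := direct_spanned (homog_direct B) (p : T).2.
    exists s, (fun i => ((0, 0), f i)); split=> // [i|].
      by apply/tri_homogP; rewrite !homog0 fh dir0.
    by apply: triP; rewrite ?s11 ?s12 ?s2 //= [RHS]big1.
- move=> s f us fh s0 i si; apply: triP.
  + apply: (dir_free (homog_direct A) us (f := fun i => (f i : T).1.1)) => // [j|].
      by case/tri_homogP: (fh j).
    by have := congr1 (fun p : tri_algebra => (p : T).1.1) s0; rewrite s11.
  + apply: (dir_free hdir us (f := fun i => (f i : T).1.2)) => // [j|].
      by case/tri_homogP: (fh j).
    by have := congr1 (fun p : tri_algebra => (p : T).1.2) s0; rewrite s12.
  + apply: (dir_free (homog_direct B) us (f := fun i => (f i : T).2)) => // [j|].
      by case/tri_homogP: (fh j).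
    by have := congr1 (fun p : tri_algebra => (p : T).2) s0; rewrite s2.
Qed.

Definition tri_ga : gradedAlgebra k := GradedAlgebra tri_is_grading.

Definition tri_d (p : T) : T :=
  (diff p.1.1, d p.1.2 + (phi p.1.1 - ra x0 p.2), diff p.2).

Lemma dx0b b : d (ra x0 b) = - ra x0 (diff b).
Proof. by rewrite (dr _ hx0) dx0 ra0 add0r sg1 scaleN1r. Qed.

Lemma tri_is_differential : @is_differential k tri_ga tri_d.
Proof.
have hsub := dir_sub hdir.
split.
- move=> c p r; apply: triP; rewrite /= ?diffZD //.
  rewrite dD dZ phiD phiZ raDr raZr opprD !scalerDr scalerN.
  by rewrite (AC (2*(2*2)) ((1*(3*5))*(2*(4*6)))).
- move=> i p /tri_homogP [p1 p2 p3]; apply/tri_homogP; split; [exact: diff_homog| |exact: diff_homog].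
  apply: dirD; [|exact: dh|] => //; apply: dirB => //; first exact: phih.
  by rewrite addrC; exact: hr.
- move=> p; apply: triP; rewrite /= ?diffK //.
  rewrite !dD dd add0r phid (addmapN dD) dx0b opprK.
  by rewrite addrACA subrr add0r subrr.
- move=> i p r /tri_homogP [p1 p2 p3]; rewrite sg_mul; apply: triP.
  + by rewrite /= (diffM _ p1) sg_mul.
  + rewrite /= dD (dl _ p1) (dr _ p2) (phiM _ p1) raM.
    have E : sg i *: la p.1.1 (ra x0 r.2) = ra (phi p.1.1) r.2.
      by rewrite -[p.1.1 in RHS]mulr1 (phiM _ p1) phi1 raZ la_ra.
    rewrite !laD !raD laN raN !scalerDr scalerN E.
    by rewrite [RHS](AC ((1*(1*2))*((1*2)*1)) ((((1*5)*(2*8))*(6*4))*(3*7))) /= subrr addr0.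
  + by rewrite /= (diffM _ p3) sg_mul.
Qed.

Definition tri_dg : dgAlgebra k := DGAlgebra tri_is_differential.

Definition tri_fst (p : tri_dg) : A := (p : T).1.1.
Definition tri_snd (p : tri_dg) : B := (p : T).2.

Lemma tri_fst_morphism : dg_morphism tri_fst.
Proof. by split=> //; split=> // i p /tri_homogP []. Qed.

Lemma tri_snd_morphism : dg_morphism tri_snd.
Proof. by split=> //; split=> // i p /tri_homogP []. Qed.

Hypothesis phi_surj : forall i u, u \in h (i + 1) -> d u = 0 ->
  exists2 a, a \in homog A i & diff a = 0 /\ exists2 v, v \in h i & u = phi a + d v.
Hypothesis phi_inj : forall i a v, a \in homog A i -> diff a = 0 -> v \in h i ->
  phi a = d v -> exists2 a', a' \in homog A (i - 1) & a = diff a'.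
Hypothesis psi_surj : forall i u, u \in h (i + 1) -> d u = 0 ->
  exists2 b, b \in homog B i & diff b = 0 /\ exists2 v, v \in h i & u = ra x0 b + d v.
Hypothesis psi_inj : forall i b v, b \in homog B i -> diff b = 0 -> v \in h i ->
  ra x0 b = d v -> exists2 b', b' \in homog B (i - 1) & b = diff b'.

Lemma tri_snd_quasi_iso : quasi_isomorphism tri_snd_morphism.
Proof.
have hsub := dir_sub hdir; have phi0 := addmap0 phiD.
apply: quasi_iso_criterion.
- move=> i b hb db; have [||a ha [da [v hv bE]]] := phi_surj (i := i) (u := ra x0 b).
  + by rewrite addrC; exact: hr.
  + by rewrite dx0b db ra0r oppr0.
  exists ((a, v, b) : T); first exact/tri_homogP.
  split; last by exists 0; rewrite diff0 addr0.
  by apply: triP; rewrite /= ?da ?db // bE opprD addNKr addrN.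
- move=> i p y /tri_homogP [p1 p2 p3] dp hy py.
  have da := congr1 (fun z : T => z.1.1) dp; have du := congr1 (fun z : T => z.1.2) dp.
  have {}du : d p.1.2 + (phi p.1.1 - ra x0 p.2) = 0 := du.
  have {}py : p.2 = diff y := py.
  have [|//|||a' ha' aE] := @phi_inj i p.1.1 (- (p.1.2 + ra x0 y)).
  + exact: p1.
  + apply: (dirN hsub); apply: dirD => //.
    by have := hr hx0 hy; rewrite addrC subrK.
  + rewrite (addmapN dD) dD dx0b -py.
    by apply/eqP; rewrite -subr_eq0 opprK addrCA du.
  have [||a ha [da2 [v hv vE]]] := phi_surj (i := i - 1) (u := p.1.2 - (phi a' - ra x0 y)).
  + rewrite subrK; apply: (dirB hsub) => //; apply: (dirB hsub).
      by have := phih ha'; rewrite subrK.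
    by have := hr hx0 hy; rewrite addrC subrK.
  + rewrite (addmapB dD) (addmapB dD) dx0b -py.
    have -> : d (phi a') = - phi (diff a') by rewrite phid opprK.
    by rewrite opprB opprK -aE addrC -du addrC [- ra _ _ + _]addrC.
  exists ((a' + a, v, y) : T); apply: triP => //=.
    by rewrite diffD da2 addr0 aE.
  move/eqP: vE; rewrite subr_eq => /eqP ->.
  by rewrite phiD; rewrite (AC (2*2) ((2*((3*1)*4)))) ; congr (_ + _); rewrite addrC.
Qed.

Lemma tri_fst_quasi_iso : quasi_isomorphism tri_fst_morphism.
Proof.
have hsub := dir_sub hdir; have phi0 := addmap0 phiD.
apply: quasi_iso_criterion.
- move=> i a ha da; have [||b hb [db [v hv aE]]] := psi_surj (i := i) (u := phi a).
  + exact: phih.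
  + by apply/eqP; rewrite -oppr_eq0 -phid da phi0.
  exists ((a, - v, b) : T).
    by apply/tri_homogP; split=> //; exact: dirN.
  split; last by exists 0; rewrite diff0 addr0.
  apply: triP; rewrite /= ?da ?db // (addmapN dD) aE.
  by rewrite [X in X - _]addrC addrK addNr.
- move=> i p y /tri_homogP [p1 p2 p3] dp hy py.
  have db := congr1 (fun z : T => z.2) dp; have du := congr1 (fun z : T => z.1.2) dp.
  have {}du : d p.1.2 + (phi p.1.1 - ra x0 p.2) = 0 := du.
  have {}py : p.1.1 = diff y := py.
  have du' : d p.1.2 + phi p.1.1 = ra x0 p.2 by apply/eqP; rewrite -subr_eq0 -addrA du.
  have dphi : phi p.1.1 = - d (phi y) by rewrite py phid.
  have [|//|||b' hb' bE] := @psi_inj i p.2 (p.1.2 - phi y).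
  + exact: p3.
  + by apply: (dirB hsub) => //; have := phih hy; rewrite subrK.
  + by rewrite (addmapB dD) -dphi du'.
  have [||b hb [db2 [v hv vE]]] := psi_surj (i := i - 1) (u := - (p.1.2 - (phi y - ra x0 b'))).
  + rewrite subrK; apply: (dirN hsub); apply: (dirB hsub) => //; apply: (dirB hsub).
      by have := phih hy; rewrite subrK.
    by have := hr hx0 hb'; rewrite addrC subrK.
  + rewrite (addmapN dD) (addmapB dD) (addmapB dD) dx0b -bE.
    have -> : d (phi y) = - phi p.1.1 by rewrite dphi opprK.
    by rewrite opprK -du' addrCA addNr addr0 subrr oppr0.
  exists ((y, - v, b' + b) : T); apply: triP => //=; last first.
    by rewrite diffD db2 addr0 bE.
  rewrite (addmapN dD) raDr opprD.
  move/eqP: vE; rewrite eqr_oppLR => /eqP vE.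
  have := congr1 (fun z => z + (phi y - ra x0 b')) vE; rewrite subrK => ->.
  by rewrite opprD addrC [- ra _ _ - _]addrC addrC; rewrite (AC (2*2) ((1*(3*(4*2))))).
Qed.

Lemma bimodule_zigzag : quasi_isomorphic A B.
Proof.
apply: (@rst_trans _ _ _ tri_dg).
  apply: rst_sym; apply: rst_step.
  by exists tri_fst, tri_fst_morphism; exact: tri_fst_quasi_iso.
apply: rst_step.
by exists tri_snd, tri_snd_morphism; exact: tri_snd_quasi_iso.
Qed.

End Triangular.

(** * The cohomology of the torus as a bimodule *)

Section TorusAction.
Variables (k : fieldType) (L : algebra k) (B : dgAlgebra k) (m : nat).
Local Notation sg := (sg k).
Variables (X : dgbim L B) (T : X -> shift X m).
Hypothesis Tm : dgmor T.
Local Notation W := (torus Tm).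
Local Notation G := (tel m X).

Definition tel_turn (i : int) (g : G) : G := fsshift i g.

Lemma tel_turnE i (g : G) n : fsval (tel_turn i g) n = fsval g (n - i). Proof. by []. Qed.

Lemma tel_turn_bmap i : bmap (tel_turn i).
Proof. by split=> [x y|a x|x b]; apply: fsP. Qed.

Lemma tel_turn_hh i l g : g \in hh G l -> tel_turn i g \in hh G (i * m%:Z + l).
Proof.
move=> /dsum_hhP hg; apply/dsum_hhP => n.
have := hg (n - i); congr (_ \in hh X _); rewrite mulrBl opprB addrA.
by rewrite [l + _]addrC.
Qed.

Lemma tel_turn_dd i (g : G) : dd (tel_turn i g) = sg (i * m%:Z) *: tel_turn i (dd g).
Proof.
apply: fsP => n; rewrite fsZE dsum_ddE !tel_turnE dsum_ddE scalerA -sgD.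
by congr (sg _ *: _); rewrite -mulrDl addrC subrK.
Qed.

Lemma tel_turn_map i (g : G) : tel_map Tm (tel_turn i g) = tel_turn i (tel_map Tm g).
Proof. by apply: fsP => n; rewrite tel_turnE !tel_mapE !tel_turnE addrAC. Qed.

(** The sign on the cells is forced by turn_dd: t commutes with the differential up
    to (-1)^m. *)
Definition turn (i : int) (p : W) : W :=
  (tel_turn i p.1, sg (i * m%:Z) *: tel_turn i p.2).

Lemma torusP (p r : W) : p.1 = r.1 -> p.2 = r.2 -> p = r.
Proof. exact: (@injective_projections G G). Qed.

Lemma turn_bmap i : bmap (turn i).
Proof.
have tb := tel_turn_bmap i; have tb' := bmap_scale (sg (i * m%:Z)) tb.
split=> [x y|a x|x b]; refine (torusP _ _).
- exact: (bmapD tb).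
- exact: (bmapD tb').
- exact: (bmap_la tb).
- exact: (bmap_la tb').
- exact: (bmap_ra tb).
- exact: (bmap_ra tb').
Qed.

Lemma turn0 p : turn 0 p = p.
Proof.
by refine (torusP _ _); apply: fsP => n; rewrite /= ?mul0r ?sg0 ?scale1r !subr0.
Qed.

Lemma turnD i j p : turn (i + j) p = turn i (turn j p).
Proof.
refine (torusP _ _); apply: fsP => n /=.
  by congr (fsval _ _); rewrite opprD addrA.
rewrite scalerA -sgD -mulrDl; congr (_ *: fsval _ _).
by rewrite opprD addrA.
Qed.

Lemma turn_hh i l p : p \in hh W l -> turn i p \in hh W (i * m%:Z + l).
Proof.
move=> /cone_hhP [h1 h2]; apply/cone_hhP; split.
  have h1' : p.1 \in hh G (l + m) := h1.
  by have := tel_turn_hh i h1'; rewrite addrA.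
by apply: hhZ; rewrite -addrA; exact: tel_turn_hh.
Qed.

Lemma turn_dd i p : dd (turn i p) = sg (i * m%:Z) *: turn i (dd p).
Proof.
have tZ := bmapZ (tel_turn_bmap i); refine (torusP _ _).
  change ((sg m *: dd (tel_turn i p.1) : G) + tel_map Tm (sg (i * m%:Z) *: tel_turn i p.2) =
    sg (i * m%:Z) *: tel_turn i ((sg m *: dd (p.1 : G) : G) + tel_map Tm p.2) :> G).
  rewrite (bmapD (tel_turn_bmap i)) scalerDr tZ tel_turn_dd !scalerA.
  rewrite [sg m * _]mulrC -tel_turn_map; congr (_ + _).
  exact: (bmapZ (dgm_b (tel_map_dgmor Tm))).
change (- dd (sg (i * m%:Z) *: tel_turn i p.2 : G) =
  sg (i * m%:Z) *: (sg (i * m%:Z) *: tel_turn i (- dd (p.2 : G))) :> G).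
by rewrite ddZ tel_turn_dd (addmapN (bmapD (tel_turn_bmap i))) !scalerN.
Qed.

Lemma turn_cyc i l p : cyc W l p -> cyc W (i * m%:Z + l) (turn i p).
Proof.
move=> [hp dp]; split; first exact: turn_hh.
by rewrite turn_dd dp (addmap0 (bmapD (turn_bmap i))) scaler0.
Qed.

Lemma turn_bnd i l p : bnd W l p -> bnd W (i * m%:Z + l) (turn i p).
Proof.
move=> [y hy ->]; exists (sg (i * m%:Z) *: turn i y).
  by apply: hhZ; rewrite -addrA; exact: turn_hh.
by rewrite ddZ turn_dd scalerA sgK scale1r.
Qed.

End TorusAction.

Section TorusCohomology.
Variables (k : fieldType) (L : algebra k) (B : dgAlgebra k) (m : nat).
Hypothesis m0 : (0 < m)%N.
Variables (q : B -> L) (t t' : B).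
Hypothesis qt : laurent_like m q t t'.
Variables (X : dgbim L B) (T : X -> shift X m).
Hypothesis Tm : dgmor T.
Hypothesis Tinj : forall i, injH T i.
Hypothesis Tsurj : forall i, surjH T i.
Hypothesis Xc : conc m 0 X.
Local Notation Lreg := (of_bimodule (regular_bimodule L)).
Variables (ga : X -> Lreg) (x0 : X).
Hypothesis mX : model q ga.
Hypothesis cx0 : cyc X 0 x0.
Hypothesis ga1 : ga x0 = 1.
Local Notation W := (torus Tm).
Local Notation A := (graded_laurent L m).
Local Notation x1 := (torus_in Tm x0).

Lemma torus_in_cyc i x : cyc X i x -> cyc W i (torus_in Tm x).
Proof. exact: dgm_cyc (torus_in_dgmor Tm). Qed.
Lemma torus_in_bnd i x : bnd X i x -> bnd W i (torus_in Tm x).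
Proof. exact: dgm_bnd (torus_in_dgmor Tm). Qed.

Lemma torus_conc : conc m 0 W.
Proof.
move=> i p mi cp; have [z cz bz] := torus_in_surj Tsurj cp.
rewrite -[p](subrK (torus_in Tm z)); apply: bndD bz _; apply: torus_in_bnd.
exact: Xc.
Qed.

Lemma torus_laurent_surj i u : cyc W i u ->
  exists2 a : A, a \in homog A i & bnd W i (u - lauact (turn (Tm := Tm)) a x1).
Proof.
move=> cu; have [/dvdzP [n iE]|mi] := boolP (m%:Z %| i)%Z; last first.
  exists 0; first exact: homog0.
  rewrite (@lauactE _ _ _ _ _ _ _ _ [::]) // big_nil subr0.
  by apply: torus_conc; rewrite ?addr0.
rewrite {}iE in cu *.
have cu' : cyc W 0 (turn (- n) u) by have := turn_cyc (- n) cu; rewrite mulNr addNr.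
have [z cz bz] := torus_in_surj Tsurj cu'.
exists (mono n (ga z)); first exact: mono_homog.
rewrite lauact_mono -(bmap_la (turn_bmap Tm n)).
have := turn_bnd n (bndD bz (torus_in_bnd (_ : bnd X 0 (z - la (ga z) x0)))).
rewrite (addmapB (bmapD (dgm_b (torus_in_dgmor Tm)))) addrA subrK addr0.
rewrite (bmap_la (dgm_b (torus_in_dgmor Tm))) (addmapB (bmapD (turn_bmap Tm n))).
rewrite -turnD subrr turn0; apply.
apply/(mod_eq mX) => //; first exact: cycl.
by rewrite (mod_la mX) // ga1; exact/esym/mulr1.
Qed.

Lemma torus_laurent_inj i (a : A) : a \in homog A i ->
  bnd W i (lauact (turn (Tm := Tm)) a x1) -> a = 0.
Proof.
move=> ha; have [/dvdzP [n iE]|mi] := boolP (m%:Z %| i)%Z; last first.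
  by move=> _; exact: homog_ndvd mi ha.
rewrite {}iE in ha *; rewrite (homog_mono m0 ha) lauact_mono => /(turn_bnd (- n)).
rewrite mulNr addNr (bmap_la (turn_bmap Tm _)) -turnD addNr turn0.
rewrite -(bmap_la (dgm_b (torus_in_dgmor Tm))).
move/(torus_in_inj Tinj (cycl _ cx0))/(mod_eq0 mX (cycl _ cx0)).
rewrite (mod_la mX) // ga1 => a0; have {}a0 : lcoef a n = 0 by rewrite -[LHS]mulr1.
by rewrite a0; apply: lcoefP => j; rewrite monoE; case: ifP.
Qed.

Lemma torus_right_surj i u : cyc W i u ->
  exists2 b, bcyc i b & bnd W i (u - ra x1 b).
Proof.
have [mi|mi] := boolP (m%:Z %| i)%Z; last first.
  move=> cu; exists 0; first exact: bcyc0.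
  by rewrite ra0r subr0; apply: torus_conc; rewrite ?addr0.
move: i mi u; apply: int_period => [u cu|i IH u cu|i IH u cu].
- have [z cz bz] := torus_in_surj Tsurj cu.
  have [b cb qb] := q_surj qt (ga z); exists b => //.
  apply: bnd_trans bz _; rewrite -(bmap_ra (dgm_b (torus_in_dgmor Tm))).
  rewrite -(addmapB (bmapD (dgm_b (torus_in_dgmor Tm)))); apply: torus_in_bnd.
  apply/(mod_eq mX) => //; first exact: cycr0.
  by rewrite (mod_ra mX) // ga1 qb; exact/esym/mul1r.
- have [|b cb bb] := IH (ra u t'); first by have := cyc_t' qt cu; rewrite addrK.
  exists (b * t); first exact: bcycM cb (t_cyc qt).
  apply: bnd_trans (t't_bnd qt cu) _; rewrite raM -raB; exact: (bnd_t qt bb).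
- have [|b cb bb] := IH (ra u t); first by have := cyc_t qt cu; rewrite subrK.
  exists (b * t'); first exact: bcycM cb (t'_cyc qt).
  apply: bnd_trans (tt'_bnd qt cu) _; rewrite raM -raB; exact: (bnd_t' qt bb).
Qed.

Lemma torus_right_inj i b : bcyc i b -> bnd W i (ra x1 b) -> bbnd i b.
Proof.
have [mi|mi] := boolP (m%:Z %| i)%Z; last by move=> cb _; exact: (b_conc qt mi cb).
move: i mi b; apply: int_period => [b cb|i IH b cb bb|i IH b cb bb].
- rewrite -(bmap_ra (dgm_b (torus_in_dgmor Tm))).
  move/(torus_in_inj Tinj (cycr0 cx0 cb))/(mod_eq0 mX (cycr0 cx0 cb)).
  rewrite (mod_ra mX) // ga1 => b0; apply/(q_eq0 qt) => //.
  by rewrite -[LHS]mul1r.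
- have cbt := bcycM cb (t'_cyc qt); rewrite addrK in cbt.
  have := IH _ cbt; rewrite raM => /(_ _) b1.
  apply: (bbnd_unit cb (t't qt)); rewrite mulrA; apply: bbndMl (t_cyc qt); apply: b1.
  by have := bnd_t' qt bb; rewrite addrK.
- have cbt := bcycM cb (t_cyc qt); rewrite subrK in cbt.
  have := IH _ cbt; rewrite raM => /(_ _) b1.
  apply: (bbnd_unit cb (tt' qt)); rewrite mulrA; apply: bbndMl (t'_cyc qt); apply: b1.
  by have := bnd_t qt bb; rewrite subrK.
Qed.

End TorusCohomology.

(** * Formality *)

Section FiniteBasis.
Variables (k : fieldType) (L : algebra k).

(** A spanning family of minimal size is a basis. *)
Lemma finite_basis : finite_dimensional L ->
  exists (n : nat) (e : 'I_n -> L) (c : 'I_n -> L -> k), is_basis e c.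
Proof.
move=> [s sP].
pose Q n := `[< exists e : 'I_n -> L, forall v, exists c : 'I_n -> k, v = \sum_i c i *: e i >].
have exQ : exists n, Q n.
  exists (size s); apply/asboolP; exists (fun i => s`_i) => v.
  by have [c cE] := sP v; exists (fun i => c i).
have [n /asboolP [e eP] nmin] := ex_minnP exQ.
have free (a : 'I_n -> k) : \sum_i a i *: e i = 0 -> forall i, a i = 0.
  move=> a0 i; apply/eqP/negPn/negP => ai.
  case: n e eP nmin a a0 i ai => [|n] e eP nmin a a0 i ai; first by case: i {ai}.
  suff : (n.+1 <= n)%N by rewrite ltnn.
  apply: nmin; apply/asboolP; exists (fun j => e (lift i j)) => v.
  have [c cE] := eP v.
  exists (fun j => c (lift i j) - c i * (a i)^-1 * a (lift i j)).
  have -> : v = \sum_j (c j - c i * (a i)^-1 * a j) *: e j.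
    transitivity (v - (c i * (a i)^-1) *: \sum_j a j *: e j).
      by rewrite a0 scaler0 subr0.
    rewrite {1}cE scaler_sumr -sumrB; apply: eq_bigr => j _.
    by rewrite scalerBl scalerA.
  rewrite (bigD1_ord i) //=.
  by rewrite -mulrA mulVf // mulr1 subrr scale0r add0r.
have /choice [c0 c0E] := eP.
have uniqc (a b : 'I_n -> k) : \sum_i a i *: e i = \sum_i b i *: e i -> forall i, a i = b i.
  move=> ab i; apply/eqP; rewrite -subr_eq0; apply/eqP; move: i.
  apply: free; rewrite -[RHS](subrr (\sum_i b i *: e i)) -{1}ab -sumrB.
  by apply: eq_bigr => j _; rewrite scalerBl.
exists n, e, (fun i v => c0 v i); split.
- move=> i x y; move: i; apply: uniqc; rewrite -c0E {1}[x]c0E {1}[y]c0E -big_split.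
  by apply: eq_bigr => j _; rewrite scalerDl.
- move=> i a x; move: i; apply: uniqc; rewrite -c0E {1}[x]c0E scaler_sumr.
  by apply: eq_bigr => j _; rewrite scalerA.
- exact: c0E.
- move=> i j; move: i; apply: (uniqc _ (fun i => (i == j)%:R)); rewrite -c0E.
  rewrite (bigD1 j) //= eqxx scale1r big1 ?addr0 // => l /negPf ->.
  by rewrite scale0r.
Qed.

End FiniteBasis.

Section FromCohomology.
Variables (k : fieldType) (L : algebra k) (B : dgAlgebra k) (m : nat).
Hypothesis m0 : (0 < m)%N.
Local Notation A := (graded_laurent L m).
Variable psi : cohomology B -> A.
Hypothesis psiP : graded_iso psi.

Let psiD : addmap psi.
Proof. by case: psiP => -[l _ _] _ x y; have := l 1 x y; rewrite !scale1r. Qed.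
Let psiZ (c : k) x : psi (c *: x) = c *: psi x.
Proof. by case: psiP => -[l _ _] _; have := l c x 0; rewrite !addr0 (addmap0 psiD) addr0. Qed.
Let psi1 : psi 1 = 1. Proof. by case: psiP => -[_ [H _] _]. Qed.
Let psiM x y : psi (x * y) = psi x * psi y. Proof. by case: psiP => -[_ [_ H] _] _; exact: H. Qed.
Let psih i x : x \in homog (cohomology B) i -> psi x \in homog A i.
Proof. by case: psiP => -[_ _ H] _; exact: H. Qed.
Let psi_inj : injective psi. Proof. by case: psiP => _; exact: bij_inj. Qed.

(** The inverse of psi preserves degrees as well, since the components of a class
    are mapped to the components of its image. *)
Lemma class_homog i (f : A) : f \in homog A i ->
  exists2 z : cocycle B, cval z \in homog B i & psi (cclass z) = f.
Proof.
move=> hf; have [psi' _ psiK] := psiP.2.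
pose h := psi' f; have [r xr] := decomposes_ex (cval (repr h)).
have dr := cocycle_components xr (cvalP _).
have cr i' : r i' \in is_cocycle B by apply/eqP.
have [rh [s [us rs xs]]] := xr.
have fr : decomposes f (fun j => psi (cclass (Cocycle (cr j)))).
  split=> [j|].
    by apply: psih; apply/cohom_homogP; exists (Cocycle (cr j)); first exact: rh.
  exists s; split=> // [j js|].
    rewrite (_ : cclass _ = 0) ?(addmap0 psiD) //.
    by apply/cclass0; exists 0; rewrite diff0 /= rs.
  rewrite -[LHS]psiK -/h -(addmap_sum psiD); congr psi.
  rewrite -cclass_sum -[LHS]cclassK; congr cclass; apply: cocycleP.
  by rewrite cval_sum.
exists (Cocycle (cr i)); first exact: rh.
by have := congr1 (@^~ i) (decomposes_uniq fr (decomposes_homog hf)); rewrite eqxx.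
Qed.

Lemma laurent_like_ex : exists (q : B -> L) (t t' : B), laurent_like m q t t'.
Proof.
have /choice [K KP] : forall b : B, exists f : A, forall z : cocycle B,
    cval z = b -> f = psi (cclass z).
  move=> b; have [db|ndb] := EM (diff b = 0); last first.
    by exists 0 => z zb; case: ndb; rewrite -zb cvalP.
  have cb : b \in is_cocycle B by apply/eqP.
  by exists (psi (cclass (Cocycle cb))) => z zb; congr (psi (cclass _)); exact: cocycleP.
have cP b : diff b = 0 -> exists z : cocycle B, cval z = b.
  by move=> db; have cb : b \in is_cocycle B by [apply/eqP]; exists (Cocycle cb).
have KZD (c : k) x y : diff x = 0 -> diff y = 0 -> K (c *: x + y) = c *: K x + K y.
  move=> /cP [z <-] /cP [z' <-]; rewrite (KP _ (c *: z + z')) // (KP _ z) // (KP _ z') //.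
  by rewrite cclassD cclassZE psiD psiZ.
have KM x y : diff x = 0 -> diff y = 0 -> K (x * y) = K x * K y.
  move=> /cP [z <-] /cP [z' <-]; rewrite (KP _ (cmul z z')) // (KP _ z) // (KP _ z') //.
  by rewrite -psiM -cclassM.
have K1 : K 1 = 1 by rewrite (KP _ (cone B)) // -psi1.
have K0 x : diff x = 0 -> K x = 0 <-> exists y, x = diff y.
  move=> /cP [z <-]; rewrite (KP _ z) //; split=> [z0|zd].
    by apply/cclass0; apply: psi_inj; rewrite z0 (addmap0 psiD).
  by rewrite (cclass0 z).2 // (addmap0 psiD).
have Kh i x : bcyc i x -> K x \in laurent_homog m i.
  move=> [hx /cP [z zx]]; rewrite (KP _ z) //; apply: psih.
  by apply/cohom_homogP; exists z; rewrite ?zx.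
have Ks i (f : A) : f \in homog A i -> exists2 b, bcyc i b & K b = f.
  move=> /class_homog [z hz zf]; exists (cval z); first by split; rewrite ?cvalP.
  by rewrite (KP _ z).
have K00 x : bcyc 0 x -> K x = mono 0 (lcoef (K x) 0).
  by move=> cx; apply: homog_mono m0 _; rewrite mul0r; exact: Kh.
have Kb i x : bcyc i x -> K x = 0 -> bbnd i x.
  by move=> [hx dx] /(K0 _ dx).1 [y xy]; have [y' hy' ->] := bnd_homog hx xy; exists y'.
have [t ct Kt] : exists2 t, bcyc m t & K t = mono 1 1.
  by apply: Ks; have := mono_homog m 1 (1 : L); rewrite mul1r.
have [t' ct' Kt'] : exists2 t, bcyc (- m%:Z) t & K t = mono (- 1) 1.
  by apply: Ks; have := mono_homog m (- 1) (1 : L); rewrite mulN1r.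
have KB x y : diff x = 0 -> diff y = 0 -> K (x - y) = K x - K y.
  by move=> dx dy; have := KZD (-1) y x dy dx; rewrite !scaleN1r addrC [X in _ = X -> _]addrC.
have inv x y i : bcyc i x -> bcyc (- i) y -> K x * K y = 1 -> bbnd 0 (1 - x * y).
  move=> cx cy xy; have cxy := bcycM cx cy; rewrite subrr in cxy.
  have [h1 d1] := bcyc1 B; have [h2 d2] := cxy; have [_ dx] := cx; have [_ dy] := cy.
  apply: Kb; first by split; [rewrite homogD ?homogN|rewrite diffD diffN d1 d2 subrr].
  by rewrite KB // K1 KM // xy subrr.
have mono11 n : (mono n 1 : A) * mono (- n) 1 = 1.
  apply: lcoefP => j; rewrite [LHS]lcoef_monoMl mul1r monoE /=.
  by rewrite subr_eq addNr.
exists (fun b => lcoef (K b) 0), t, t'; split=> //.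
- by move=> c x y [_ dx] [_ dy]; rewrite KZD.
- by rewrite K1.
- move=> x y cx cy; have [_ dx] := cx; have [_ dy] := cy.
  by rewrite KM // (K00 _ cx) [LHS]lcoef_monoMl subr0.
- move=> x cx; split=> [q0|[y hy xy]].
    by apply: Kb => //; rewrite K00 // q0; apply: lcoefP => j; rewrite monoE; case: ifP.
  by rewrite (K0 x cx.2).2 //; exists y.
- move=> a; have [|b cb Kba] := Ks 0 (mono 0 a); first by have := mono_homog m 0 a; rewrite mul0r.
  by exists b => //; rewrite Kba monoE eqxx.
- by move=> i x mi cx; apply: Kb => //; apply: homog_ndvd mi _; exact: Kh.
- by apply: inv ct ct' _; rewrite Kt Kt' mono11.
- apply: inv ct' _ _; first by rewrite opprK.
  by rewrite Kt Kt'; have := mono11 (- 1); rewrite opprK.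
- move=> x cx; have [_ dx] := cx; have [_ dt] := ct; have [_ dt'] := ct'.
  have [_ dtx] := bcycM ct cx.
  rewrite KM // KM // Kt Kt' [LHS]lcoef_monoMr mulr1 [LHS]lcoef_monoMl mul1r.
  by rewrite sub0r opprK subrr.
Qed.

Lemma cohomology_zero_dg : quasi_isomorphic (zero_dg (cohomology B)) (zero_dg A).
Proof.
have pm : @dg_morphism k (zero_dg (cohomology B)) (zero_dg A) psi.
  by split; [exact: psiP.1|move=> x; exact: addmap0 psiD].
apply: rst_step; exists psi, pm; apply: quasi_iso_criterion.
- move=> i z hz _; have [w hw wz] := class_homog hz.
  exists (cclass w); first by apply/cohom_homogP; exists w.
  by split=> //; exists 0; rewrite wz addr0.
- move=> i w y _ _ _ wy; exists 0; apply: psi_inj.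
  by rewrite wy (addmap0 psiD).
Qed.

End FromCohomology.

Section Assembly.
Variables (k : fieldType) (L : algebra k) (B : dgAlgebra k) (m : nat).
Hypothesis m0 : (0 < m)%N.
Local Notation sg := (sg k).
Local Notation A := (graded_laurent L m).
Variables (q : B -> L) (t t' : B).
Hypothesis qt : laurent_like m q t t'.

Lemma laurent_quasi_isomorphic d : finite_dimensional L ->
  projdim_le (regular_bimodule L) d -> (d <= m)%N ->
  quasi_isomorphic (zero_dg A) B.
Proof.
move=> fdL pdL dm; have [n [e [c ec]]] := finite_basis fdL.
have [X [ga [Xc mX Xfull _ _]]] := tower qt ec dm pdL.
have Sc := conc_shift_m Xc; have mS := shift_model qt mX.
have [T Tm TE] := Xfull _ Sc _ _ mS id (@bmap_id _ _ _ (of_bimodule (regular_bimodule L))).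
have Tiso := model_bij qt Xc Sc mX mS Tm TE.
have Tinj i := (Tiso i).1; have Tsurj i := (Tiso i).2.
have [x0 cx0 ga1] := mod_surj mX (1 : L).
pose W := mcone (tel_map_dgmor Tm).
pose x1 : W := torus_in Tm x0.
have cx1 : cyc W 0 x1 by exact: torus_in_cyc.
(* the bimodule to glue along is the shift of W by -1, on which an element of degree
   i acts with the additional sign (-1)^i *)
pose tp (i : int) (x : W) : W := sg (i * m%:Z) *: turn i x.
have tpb i : bmap (tp i) by apply: bmap_scale; exact: turn_bmap.
have tp0 x : tp 0 x = x by rewrite /tp mul0r sg0 scale1r turn0.
have tpD i j x : tp (i + j) x = tp i (tp j x).
  by rewrite /tp (bmapZ (turn_bmap Tm i)) scalerA -sgD -mulrDl turnD.
have tph i l x : x \in hh W l -> tp i x \in hh W (i * m%:Z + l).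
  by move=> hx; apply: hhZ; exact: turn_hh.
have tpd i x : dd (tp i x) = sg (i * m%:Z) *: tp i (dd x).
  by rewrite /tp ddZ turn_dd.
pose N : bimod A B := Bimod (lauact_is_bimod m tpb tp0 tpD).
pose S := shift W (-1).
pose phi (a : A) : N := lauact (turn (Tm := Tm)) a x1.
have tph' i l x : x \in hh W l -> turn i x \in hh W (i * m%:Z + l) by exact: turn_hh.
have signs i (a : A) x : a \in homog A i ->
    lauact (turn (Tm := Tm)) a x = sg i *: lauact tp a x.
  move=> /laurent_homogP ha; have [s us a0] := laurent_seq a.
  rewrite !(lauactE _ _ us a0) scaler_sumr; apply: eq_bigr => j _.
  have [<-|ji] := eqVneq (j * m%:Z) i; last by rewrite ha // !la0l scaler0.
  by rewrite /tp laZ scalerA sgK scale1r.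
have Sd (x : W) : dd (x : S) = - dd (x : W) by rewrite shift_ddE sgN sg1 scaleN1r.
have cycS i (u : S) : u \in hh S (i + 1) -> dd u = 0 -> cyc W i u.
  by move=> hu du; have /shift_cyc := conj hu du; rewrite addrK.
apply: (@bimodule_zigzag k (zero_dg A) B N (@dd _ _ _ S) (@hh _ _ _ S)
  _ _ _ _ _ _ _ _ _ x1 phi).
- exact: dgb_dir (dg_ax S).
- move=> i j a x ha hx; rewrite shift_hhE -addrA; exact: (lauact_hh tph ha).
- exact: (@hhr _ _ _ S).
- exact: (@ddD _ _ _ S).
- exact: (@ddZ _ _ _ S).
- exact: (@hhd _ _ _ S).
- exact: (@ddd _ _ _ S).
- move=> i a x ha; rewrite !Sd.
  have -> : la (diff a) x = 0 :> N by exact: (@la0l _ _ _ N).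
  rewrite add0r laN scalerN; congr (- _); exact: (dd_lauact tpd).
- exact: (@ddr _ _ _ S).
- by rewrite shift_hhE subrr; case: cx1.
- by rewrite Sd cx1.2 oppr0.
- move=> a b; exact: lauact_Dl.
- move=> b a; exact: lauact_Z.
- have e1 : (1 : zero_dg A) = mono 0 (1 : L) :> A by exact: lcoefP.
  by rewrite e1 /phi lauact_mono turn0 la1.
- move=> i a a' ha; rewrite -[la a _]/(lauact tp a (phi a')) -(signs i) //.
  exact: (lauact_M (turn_bmap Tm) (@turnD _ _ _ _ _ _ Tm)).
- move=> i a ha; rewrite shift_hhE addrK -[i]addr0.
  by apply: (lauact_hh tph' ha); case: cx1.
- move=> a; rewrite Sd opprK.
  have -> : phi (diff a) = 0.
    by rewrite /phi (@lauactE _ _ _ _ _ _ _ _ [::]) // big_nil.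
  have [s us a0] := laurent_seq (a : laurent L).
  rewrite /phi (lauactE _ _ us a0) dd_sum big1 // => j _.
  by rewrite ddl turn_dd cx1.2 (addmap0 (bmapD (turn_bmap Tm j))) scaler0 la0.
- move=> i u hu du; have [a ha [v hv uE]] :=
    torus_laurent_surj Tsurj Xc mX cx0 ga1 (cycS i u hu du).
  exists a => //; split=> //; exists (- v); first exact: hhN.
  by rewrite Sd ddN opprK -uE addrC subrK.
- move=> i a v ha _ hv aE; exists 0; first exact: homog0.
  apply: (torus_laurent_inj m0 Tinj mX cx0 ga1 ha).
  exists (- v); first exact: hhN.
  by rewrite ddN -Sd; exact: aE.
- move=> i u hu du; have [b [hb db] [v hv uE]] :=
    torus_right_surj qt Tsurj Xc mX cx0 ga1 (cycS i u hu du).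
  exists b => //; split=> //; exists (- v); first exact: hhN.
  by rewrite Sd ddN opprK -uE addrC subrK.
- move=> i b v hb db hv bE.
  suff [y hy yE] : bbnd i b by exists y.
  apply: (torus_right_inj qt Tinj mX cx0 ga1 (conj hb db)).
  exists (- v); first exact: hhN.
  by rewrite ddN -Sd; exact: bE.
Qed.

End Assembly.

Theorem theorem3 (k : fieldType) (m : nat) (Lambda : algebra k) (d : nat) :
  (0 < m)%N ->
  finite_dimensional Lambda ->
  projdim_eq (regular_bimodule Lambda) d ->
  (d <= m)%N ->
  intrinsically_formal (graded_laurent Lambda m).
Proof.
move=> m0 fdL [pdL _] dm B [psi psiP].
have [q [t [t' qt]]] := laurent_like_ex m0 psiP.
apply: (@rst_trans _ _ _ (zero_dg (graded_laurent Lambda m))).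
  by apply: rst_sym; exact: (laurent_quasi_isomorphic m0 qt fdL pdL dm).
by apply: rst_sym; exact: cohomology_zero_dg psiP.
Qed.
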